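(* Let $G$ be a graph with $n \ge 3$ vertices, without loops or parallel edges. If $G$ can be drawn as a simple topological graph in which every two edges that cross a common third edge share a common endpoint, then $G$ has at most $5n-10$ edges. If, moreover, $G$ admits such a drawing in which every edge is drawn as a straight-line segment, then $G$ has at most $5n-11$ edges.
   Context: A topological graph (drawing) is a graph drawn in the plane with vertices as distinct points and edges as Jordan arcs connecting the corresponding points and not passing through any other vertex; any two edges have finitely many common points, each of which is either a shared endpoint or a proper crossing. A topological graph is simple if every two edges intersect in at most one point (a shared endpoint or a single crossing). The condition in the theorem says: whenever two distinct edges $e_1,e_2$ both cross an edge $e$, then $e_1$ and $e_2$ have a common endpoint. *)

(* Defs.v *)
From HB Require Import structures.
From mathcomp Require Import all_boot all_order all_algebra.
From mathcomp Require Import all_classical all_reals topology normedtype.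
Set Implicit Arguments. Unset Strict Implicit. Unset Printing Implicit Defensive.
Import Order.TTheory GRing.Theory Num.Theory numFieldNormedType.Exports.
Local Open Scope classical_set_scope.
Local Open Scope ring_scope.

Notation pt R := ((R : realType) * (R : realType))%type.

Section TopologicalGraphs.
Variable R : realType.

Definition I01 : set R := `[(0:R), 1]%classic.

Definition jordan_arc (g : R -> pt R) : Prop :=
  {within I01, continuous g} /\ set_inj I01 g.

Definition trace (g : R -> pt R) : set (pt R) := g @` I01.

Definition osquare (eps : R) : set (pt R) :=
  [set q | `|q.1| < eps /\ `|q.2| < eps].

(* p is a proper crossing of the curves A and B: there is a homeomorphism of
   the plane sending p to the origin and, near the origin, A onto the
   horizontal axis and B onto the vertical axis (so the curves locally cross
   like two perpendicular lines; touchings are excluded). *)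
Definition proper_crossing (A B : set (pt R)) (p : pt R) : Prop :=
  exists (phi psi : pt R -> pt R),
    [/\ cancel phi psi, cancel psi phi, continuous phi, continuous psi
      & phi p = (0, 0)] /\
    exists2 eps : R, 0 < eps &
      (phi @` A) `&` osquare eps = [set q | q.2 = 0 /\ `|q.1| < eps] /\
      (phi @` B) `&` osquare eps = [set q | q.1 = 0 /\ `|q.2| < eps].

Definition simple_graph (T : finType) (E : rel T) : Prop :=
  symmetric E /\ irreflexive E.

Definition num_edges (T : finType) (E : rel T) : nat :=
  #|[set s : {set T} | [exists x, exists y, E x y && (s == [set x; y]%SET)]]|.

Definition topological_drawing (T : finType) (E : rel T)
    (pos : T -> pt R) (arc : T -> T -> R -> pt R) : Prop :=
  [/\ injective pos,
      (forall x y, E x y ->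
         [/\ jordan_arc (arc x y), arc x y 0 = pos x & arc x y 1 = pos y]),
      (forall x y, E x y -> trace (arc x y) = trace (arc y x)),
      (forall x y z, E x y -> z != x -> z != y -> ~ trace (arc x y) (pos z))
    &
      (forall x1 y1 x2 y2, E x1 y1 -> E x2 y2 ->
         [set x1; y1]%SET != [set x2; y2]%SET :> {set T} ->
         finite_set (trace (arc x1 y1) `&` trace (arc x2 y2)) /\
         forall p, trace (arc x1 y1) p -> trace (arc x2 y2) p ->
           (exists2 v, v \in [set x1; y1]%SET :&: [set x2; y2]%SET & p = pos v)
           \/ proper_crossing (trace (arc x1 y1)) (trace (arc x2 y2)) p)].

Definition simple_drawing (T : finType) (E : rel T)
    (pos : T -> pt R) (arc : T -> T -> R -> pt R) : Prop :=
  topological_drawing E pos arc /\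
  forall x1 y1 x2 y2, E x1 y1 -> E x2 y2 ->
    [set x1; y1]%SET != [set x2; y2]%SET :> {set T} ->
    forall p q, trace (arc x1 y1) p -> trace (arc x2 y2) p ->
                trace (arc x1 y1) q -> trace (arc x2 y2) q -> p = q.

Definition edges_cross (T : finType) (arc : T -> T -> R -> pt R)
    (x1 y1 x2 y2 : T) : Prop :=
  exists p, [/\ trace (arc x1 y1) p, trace (arc x2 y2) p
              & proper_crossing (trace (arc x1 y1)) (trace (arc x2 y2)) p].

Definition crossing_condition (T : finType) (E : rel T)
    (arc : T -> T -> R -> pt R) : Prop :=
  forall a b c d u v, E a b -> E c d -> E u v ->
    [set a; b]%SET != [set c; d]%SET :> {set T} ->
    edges_cross arc a b u v -> edges_cross arc c d u v ->
    [set a; b]%SET :&: [set c; d]%SET != finset.set0.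

Definition segment (a b : pt R) : set (pt R) :=
  [set ((1 - t) * a.1 + t * b.1, (1 - t) * a.2 + t * b.2) | t in I01].

Definition straight_line (T : finType) (E : rel T)
    (pos : T -> pt R) (arc : T -> T -> R -> pt R) : Prop :=
  forall x y, E x y -> trace (arc x y) = segment (pos x) (pos y).

End TopologicalGraphs.

(* Main.v *)
(* Vertices of degree at most five are removed by induction, so let all degrees be large.  The
   arcs are replaced by polygons: between consecutive vertices and crossings, shortest polygons
   in disjoint tubes around the arcs; inside small discs, radii at the vertices and chords at
   the crossings.  Two chords in a disc meet at most once, so the polygons still form a simple
   drawing in which edges crossing a common edge share an endpoint.

   The polygons give a plane map with n + X nodes and m + 2X edges, X being the number of
   crossings.  Every cycle modulo 2 of the map two-colours its faces, by the parity of the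
   number of segments of the cycle above a point; counting cycles and colourings gives Euler's
   inequality F >= (m + 2X) - (n + X) + 2.

   Give 8 units to every dart leaving a vertex and 5 to every dart leaving a crossing, in all
   16m + 20X.  By the fan condition the units can be moved between the faces so that each of
   the F faces keeps at least 20, hence 4m + 40 <= 20n.

   In a straight-line drawing the leftmost and rightmost vertices and a vertex farthest from the
   line joining them lie on the unbounded face, or several faces are coloured like the unbounded
   one; either case gains 4 units. *)
Require Import Defs.
From mathcomp Require Import all_boot all_order all_algebra.
From mathcomp Require Import boolp zify ring lra.

Set Implicit Arguments. Unset Strict Implicit. Unset Printing Implicit Defensive.

(** The weights are forced by Euler's inequality, 20 F >= 20 m + 20 X - 20 n + 40: four darts of 5
    units at each crossing make the terms in X cancel, and 16 m against 20 m leaves the factor 4.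
    With these weights the only faces that start below 20 are triangles with one vertex corner, 8 +
    5 + 5, since three pairwise crossing edges contradict the fan condition. The obstacle is that a
    face paying two units to several triangles can itself fall short: a quadrilateral with one
    vertex corner asked twice, or a pentagon or hexagon of crossings. These take single units in a
    second round, from darts next to a vertex; the fan condition and degrees of at least four show
    that such darts are distinct and can spare the unit.

    The polygons may lose crossings of the drawing but never gain any, and all conditions on
    crossings pass to fewer crossings; so it is enough to control where the polygons meet. Straight
    drawings are only subdivided, because the gain of 4 units rests on convexity. *)

Module Discharging.

(** * Arithmetic of the faces that may run short *)

Lemma quad_count (N b1 b2 b3 : nat) (g r1 r2 a1 a3 : bool) : g + 8 <= N ->
  (a1 -> ~~ r1) -> (a3 -> ~~ r2) -> (r1 -> r2 -> g) ->
  20 <= N + (5 + b1 - (2 * r1 + a1)) + (5 + b2 - (2 * r2 + false))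
        + (5 + b3 - (2 * false + a3)).
Proof.
case: r1 r2 a1 a3 g => [] [] [] [] [] gN h1 h2 h3;
  try (by move: (h1 isT)); try (by move: (h2 isT)); try (by move: (h3 isT isT)); lia.
Qed.

(** With r requested sides, at least 2r - 5 corners of the pentagon lie between two of them, which
    is just what 25 - 2r lacks. *)
Lemma pent_count (v0 v1 v2 v3 v4 : nat) (r0 r1 r2 r3 r4 : bool) :
  5 + (r0 && r4) <= v0 + 2 * r0 -> 5 + (r1 && r0) <= v1 + 2 * r1 ->
  5 + (r2 && r1) <= v2 + 2 * r2 -> 5 + (r3 && r2) <= v3 + 2 * r3 ->
  5 + (r4 && r3) <= v4 + 2 * r4 -> 20 <= v0 + v1 + v2 + v3 + v4.
Proof. by case: r0 r1 r2 r3 r4 => [] [] [] [] []; rewrite /=; lia. Qed.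

(** Only six requests bring 30 below 20, by two units. *)
Lemma hex_count (g0 g1 g2 g3 g4 g5 : nat) (r0 r1 r2 r3 r4 r5 : bool) :
  ~~ [&& r0, r1, r2, r3, r4 & r5] \/ [/\ 1 <= g0 & 1 <= g1] ->
  20 <= 5 + g0 - 2 * r0 + (5 + g1 - 2 * r1) + (5 + g2 - 2 * r2)
     + (5 + g3 - 2 * r3) + (5 + g4 - 2 * r4) + (5 + g5 - 2 * r5).
Proof.
by case=> [|[]]; case: r0 r1 r2 r3 r4 r5 => [] [] [] [] [] [] //; lia.
Qed.

Lemma gap_count i m : i < m.+4 -> 0 < i -> 20 <= 8 + (2 * (i - 1) + (8 + 2 * (m.+4 - i.+1))).
Proof. lia. Qed.

Lemma long_count m : 20 <= 8 + 2 + 3 * (m.+4 - 2) + 4.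
Proof. lia. Qed.

Lemma ring_count (g : nat) (r : bool) : 3 <= 5 + g - 2 * r.
Proof. by case: r; lia. Qed.

Lemma corner_count (g r r' : bool) : (r && r' -> g) ->
  5 + (r && r') <= 5 + g - 2 * r + 2 * r.
Proof. by case: r; case: r'; case: g => //= /(_ isT). Qed.

Lemma total_count V W g t r a :
  V + (2 * r + a) = W + g + 2 * t -> g <= a -> t <= r -> V <= W.
Proof. lia. Qed.

(** * Discharging on a plane map with the fan condition *)

Section FanMap.
(* The darts of a plane map whose nodes are the vertices and the crossings of a drawing:
   [rev d] is [d] reversed, [sg] rotates about the source, [crs d] says that the source is a
   crossing, [fin d] is the end of the edge [ed d] in the direction of [d], and [ix d] is the
   position of [d] along this edge. *)
Variables (D V Ed : finType).
Variables (rev sg : D -> D) (crs : pred D) (fin : D -> V).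
Variables (ed : D -> Ed) (en : Ed -> {set V}) (ix : D -> nat).
Hypothesis revK : involutive rev.
Hypothesis sg_inj : injective sg.
Hypothesis ed_rev : forall d, ed (rev d) = ed d.
Hypothesis fin_neq : forall d, fin d != fin (rev d).
Hypothesis en_ed : forall d, en (ed d) = [set fin d; fin (rev d)].
Hypothesis en_inj : injective en.
Hypothesis crs_sg : forall d, crs (sg d) = crs d.
Hypothesis sg4 : forall d, crs d -> sg (sg (sg (sg d))) = d.
Hypothesis ed_sg2 : forall d, crs d -> ed (sg (sg d)) = ed d.
Hypothesis fin_sg2 : forall d, crs d -> fin (sg (sg d)) = fin (rev d).
Hypothesis real_sg : forall d, ~~ crs d -> fin (rev (sg d)) = fin (rev d).
Hypothesis real_inj : forall d d', ~~ crs d -> ~~ crs d' ->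
  fin (rev d) = fin (rev d') -> fin d = fin d' -> d = d'.
Hypothesis deg1 : forall d, ~~ crs d -> sg d <> d.
Hypothesis deg2 : forall d, ~~ crs d -> sg (sg d) <> d.
Hypothesis deg3 : forall d, ~~ crs d -> sg (sg (sg d)) <> d.
Hypothesis crs_disj : forall d, crs d -> [disjoint en (ed d) & en (ed (sg d))].
Hypothesis crs_simple : forall d d', crs d -> crs d' -> ed d = ed d' ->
  ed (sg d) = ed (sg d') -> d' = d \/ d' = sg (sg d).
Hypothesis crs_fan : forall d d', crs d -> crs d' -> ed d = ed d' ->
  ~~ [disjoint en (ed (sg d)) & en (ed (sg d'))].
Hypothesis ix_next : forall d, crs (rev d) -> ix (sg (sg (rev d))) = (ix d).+1.

Definition face d := sg (rev d).
Local Notation f := face.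

Lemma face_inj : injective f.
Proof. by move=> x y /sg_inj /(can_inj revK). Qed.

Lemma crs_face d : crs (f d) = crs (rev d).
Proof. exact: crs_sg. Qed.

Lemma face_rev d : f (rev d) = sg d. Proof. by rewrite /face revK. Qed.

Definition cross e e' := exists d, [/\ crs d, ed d = e & ed (sg d) = e'].

Lemma crossC e e' : cross e e' -> cross e' e.
Proof. by case=> d [cd <- <-]; exists (sg d); rewrite crs_sg ed_sg2. Qed.

Lemma cross_disj e e' v : cross e e' -> v \in en e -> v \in en e' -> False.
Proof. by case=> d [/crs_disj/pred0P dj <- <-] ve ve'; have := dj v; rewrite /= ve ve'. Qed.

Lemma cross_fan e e1 e2 : cross e e1 -> cross e e2 ->
  exists2 v, v \in en e1 & v \in en e2.
Proof.
case=> d [cd <- <-] [d' [cd' eqd <-]].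
have /pred0Pn[v /andP[v1 v2]] := crs_fan cd cd' (esym eqd).
by exists v.
Qed.

Lemma cross_face d : crs (f d) -> cross (ed d) (ed (f d)).
Proof. by rewrite crs_face => cd; exists (rev d); rewrite ed_rev. Qed.

Lemma en2 e u w x : u \in en e -> w \in en e -> u != w -> x \in en e ->
  (exists d, ed d = e) -> x = u \/ x = w.
Proof.
move=> ue we uw xe [d eqd]; move: ue we xe; rewrite -eqd en_ed !inE.
by case/orP=> /eqP ?; case/orP=> /eqP ?; case/orP=> /eqP ?; subst;
  rewrite ?eqxx // in uw *; auto.
Qed.

Lemma en_uniq d d' u w : u != w -> u \in en (ed d) -> w \in en (ed d) ->
  u \in en (ed d') -> w \in en (ed d') -> ed d = ed d'.
Proof.
move=> uw u1 w1 u2 w2; apply: en_inj; apply/setP=> x.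
apply/idP/idP=> xe.
  by case: (en2 u1 w1 uw xe) => [|->|->] //; exists d.
by case: (en2 u2 w2 uw xe) => [|->|->] //; exists d'.
Qed.

Lemma fin_en d : fin d \in en (ed d). Proof. by rewrite en_ed !inE eqxx. Qed.
Lemma src_en d : fin (rev d) \in en (ed d).
Proof. by rewrite en_ed !inE eqxx orbT. Qed.

Lemma en_cases d x : x \in en (ed d) -> x = fin d \/ x = fin (rev d).
Proof. by rewrite en_ed !inE => /orP[]/eqP ->; auto. Qed.

Lemma fin_rev_sg d : crs d -> fin (rev (sg d)) = fin (sg (sg (sg d))).
Proof. by move=> cd; rewrite fin_sg2 // crs_sg. Qed.

(** An edge cannot return to a piece already passed, because [ix] grows by one at each crossing. *)
Lemma straight_neq d : crs (rev d) -> sg (sg (rev d)) <> d.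
Proof. by move=> /ix_next ixd eqd; move: ixd; rewrite eqd => /n_Sn. Qed.

Lemma straight2_neq d : crs d -> crs (rev d) -> crs (rev (sg (sg d))) ->
  rev (sg (sg d)) <> sg (sg (rev d)) /\ rev (sg (sg d)) <> rev d.
Proof.
move=> cd cr cr2; split=> eqd.
  have := ix_next cr; rewrite -eqd => i1.
  have := ix_next (d := rev (sg (sg d))); rewrite revK !crs_sg sg4 // => /(_ cd) i2.
  by move/eqP: i2; rewrite i1 -addn2 -[X in X == _]addn0 eqn_add2l.
move/(can_inj revK): eqd => eqd.
have := crs_disj cd; have := fin_sg2 cd; rewrite eqd => fd.
by have := fin_neq d; rewrite fd eqxx.
Qed.

(** A face of length one would be an edge crossing itself or a loop. *)
Lemma face_neq d : f d <> d.
Proof.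
rewrite /face => eqd; case cd: (crs d).
  have cr : crs (rev d) by rewrite -crs_sg eqd.
  have := crs_disj cr; rewrite eqd ed_rev => /pred0P/(_ (fin d)).
  by rewrite /= fin_en.
have cr : ~~ crs (rev d) by rewrite -crs_sg eqd cd.
by have := real_sg cr; rewrite eqd revK => e; have := fin_neq d; rewrite e eqxx.
Qed.

Lemma crs_simple_ed d d' : crs d -> crs d' -> ed d = ed d' ->
  ed (sg d) = ed (sg d') -> d' = d \/ d' = sg (sg d).
Proof. exact: crs_simple. Qed.

(** A face of length two would be bounded by two edges that cross twice, or that cross and share an
    endpoint, or by the two sides of one edge, whose end would have degree one. *)
Lemma face2_neq d : f (f d) <> d.
Proof.
move=> e2; set d1 := f d in e2.
have c1 : crs d1 = crs (rev d) by rewrite crs_face.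
have c0 : crs d = crs (rev d1) by rewrite -e2 crs_face.
case cd: (crs d); case cr: (crs (rev d)).
- have c1' : crs (sg (rev d)) by rewrite crs_sg.
  have e3 : ed (sg d) = ed d1.
    by rewrite -e2 /face ed_sg2 ?ed_rev // -c0.
  case: (@crs_simple_ed (rev d) d cr cd); rewrite ?ed_rev //.
  + by move=> e; have := fin_neq d; rewrite -{1}e eqxx.
  + by move=> e; apply: (straight_neq cr).
- have x1 : cross (ed d1) (ed d) by rewrite -e2; apply: cross_face; rewrite e2.
  have cr1 : ~~ crs (rev d) by rewrite cr.
  have vd : fin d \in en (ed d1).
    have /= := real_sg cr1; rewrite revK => <-; exact: src_en.
  exact: (cross_disj x1 vd (fin_en d)).
- have x1 : cross (ed d) (ed d1) by apply: cross_face; rewrite c1.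
  have cr1 : ~~ crs (rev d1) by rewrite -c0 cd.
  have vd : fin d1 \in en (ed d).
    have /= := real_sg cr1; rewrite revK => <-; rewrite -[sg _]/(f d1) e2; exact: src_en.
  exact: (cross_disj x1 vd (fin_en d1)).
- have cr1 : ~~ crs (rev d) by rewrite cr.
  have crd1 : ~~ crs d1 by rewrite c1.
  have cr2 : ~~ crs (rev d1) by rewrite -c0 cd.
  have s0 := real_sg cr1; rewrite -[sg _]/d1 revK in s0.
  have s1 := real_sg cr2; rewrite -[sg _]/(f d1) e2 revK in s1.
  have e : rev d = d1 by apply: real_inj; rewrite // revK.
  by have := deg1 cr1; rewrite -/(f d) -/d1 e.
Qed.

(* Names of faces count the vertex corners: [quad0] has none, [tri1] has one. *)
Definition quad0 d :=
  [&& crs d, crs (f d), crs (f (f d)), crs (f (f (f d))) & f (f (f (f d))) == d].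
Definition tri1 d :=
  [&& ~~ crs d, crs (f d), crs (f (f d)) & f (f (f d)) == d].

Lemma quad0_face d : quad0 d -> quad0 (f d).
Proof.
case/and5P=> c0 c1 c2 c3 /eqP e; apply/and5P; split=> //; rewrite ?e //.
Qed.

Lemma rev_pred x y : f x = y -> crs y -> rev x = sg (sg (sg y)).
Proof. by move=> <-; rewrite crs_sg => cx; rewrite /face sg4. Qed.

Lemma ed_sg_pred x y : f x = y -> crs y -> ed (sg y) = ed x.
Proof. by move=> e cy; rewrite -(ed_rev x) (rev_pred e cy) ed_sg2 // crs_sg. Qed.

(* [wedge x w a b]: the edges [a] and [b] cross the edge of [x] at the source and the
   target of [x], and both run to [w] on the side of [x] where the face of [x] lies. *)
Definition wedge x w a b :=
  [/\ crs x, crs (rev x), fin (sg (sg (sg x))) = w & fin (f x) = w]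
  /\ (ed (sg x) = a /\ ed (f x) = b).

(** When a quadrilateral lies behind [x], this is its side opposite to [x]. *)
Definition stp x := f (f (rev x)).

Lemma stp_inj : injective stp.
Proof. by move=> x y /face_inj/face_inj/(can_inj revK). Qed.

(* A triangle with one vertex corner lacks two units; it takes them across its side opposite
   to the vertex, from the first face behind it that is not a [quad0].  The same two edges
   bound all the faces passed, by the fan condition. *)
Inductive fanw (d0 : D) : nat -> D -> Prop :=
| FanTri : tri1 d0 -> fanw d0 0 (f d0)
| FanQuad n x : fanw d0 n x -> quad0 (rev x) -> fanw d0 n.+1 (stp x).

Lemma tri1_wedge d : tri1 d -> wedge (f d) (fin (rev d)) (ed d) (ed (f (f d))).
Proof.
case/and4P=> c0 c1 c2 /eqP e3; rewrite /wedge.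
have r1 := rev_pred (erefl (f d)) c1.
have e1 := ed_sg_pred (erefl (f d)) c1.
split; split=> //.
- by rewrite -crs_face.
- by rewrite -r1.
- have c3 : ~~ crs (rev (f (f d))) by rewrite -crs_face e3.
  by have := real_sg c3; rewrite -/(f _) e3 revK.
Qed.

(** The sides of the quadrilateral next to [x] continue the edges [a] and [b], so the opposite side
    is crossed by the same two edges. *)
Lemma stp_wedge x w a b : wedge x w a b -> quad0 (rev x) -> wedge (stp x) w a b.
Proof.
case=> [[cx crx fa fb] [ea eb]] /and5P[_ c1 c2 c3 /eqP e4].
rewrite /stp; set s := rev x in c1 c2 c3 e4 *.
have fs : f s = sg x by rewrite /s face_rev.
have r2 := rev_pred (erefl (f (f s))) c2.
have e2 := ed_sg_pred (erefl (f (f s))) c2.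
have r4 := rev_pred e4 crx.
split; split=> //.
- by rewrite -crs_face.
- by rewrite -r2 fs fin_rev_sg.
- have -> : f (f (f s)) = rev (sg (sg (sg s))) by rewrite -r4 revK.
  by rewrite fin_rev_sg ?crs_sg // sg4 ?crs_sg.
- by rewrite e2 fs.
- by rewrite -(ed_rev (f _)) r4 ed_sg2 ?crs_sg.
Qed.

Lemma fanw_wedge d n x : fanw d n x ->
  tri1 d /\ wedge x (fin (rev d)) (ed d) (ed (f (f d))).
Proof.
elim=> [t|m y _ [t W] q]; first by split=> //; apply: tri1_wedge.
by split=> //; apply: stp_wedge.
Qed.

Lemma fanw_quad d n x : fanw d n x ->
  (n = 0 /\ x = f d /\ tri1 d) \/
  (exists m y, [/\ n = m.+1, fanw d m y, quad0 (rev y) & x = f (f (rev y))]).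
Proof. by case=> [t|m y F q]; [left | right; exists m, y]. Qed.

Lemma quad0_tri1 x d : quad0 x -> tri1 d -> x = f d -> False.
Proof.
case/and5P=> _ _ c2 _ _ /and4P[c0 _ _ /eqP e3] e; move: c2 c0.
by rewrite e e3 => ->.
Qed.

Lemma quad0_stp y : quad0 (rev y) -> quad0 (stp y).
Proof. by move=> q; do 2!apply: quad0_face. Qed.

(** The walk can be run backwards: [stp] is injective, and the start, a dart of a [tri1], is never a
    dart of a [quad0]. So two triangles never take from the same dart. *)
Lemma fanw_inj d d' n n' x : fanw d n x -> fanw d' n' x -> n = n' /\ d = d'.
Proof.
move=> F; elim: F n' => [t|m y F IH q] n' F'.
  case: (fanw_quad F') => [[-> [e _]]|[m [y [_ _ /quad0_stp q e]]]].
    by split=> //; apply: face_inj.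
  by case: (quad0_tri1 q t (esym e)).
case: (fanw_quad F') => [[-> [e t]]|[m' [y' [-> F1 q' /face_inj/face_inj e]]]].
  by case: (quad0_tri1 (quad0_stp q) t e).
by move: F1; rewrite -(can_inj revK e) => /IH [-> ->].
Qed.

(** An injective map of the finite set of darts is a permutation, so an endless walk would return to
    its start after a positive number of steps, against [fanw_inj]. *)
Lemma fanw_land d : tri1 d -> exists n x, fanw d n x /\ ~~ quad0 (rev x).
Proof.
move=> t; apply: contrapT => nE.
have W n : fanw d n (iter n stp (f d)).
  elim: n => [|n IH]; first exact: FanTri.
  rewrite iterS; apply: FanQuad => //; apply: contrapT => /negP nq.
  by apply: nE; exists n, (iter n stp (f d)).
have := W (order stp (f d)); rewrite (iter_order stp_inj) => /fanw_inj/(_ (W 0)).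
by case=> /= o0; have := order_gt0 stp (f d); rewrite o0.
Qed.

(** The dart [s] belongs to the face that pays; the request of the triangle arrives across its
    side. *)
Definition requested s := `[< exists d n, fanw d n (rev s) /\ ~~ quad0 s >].

Lemma requestedP s : requested s ->
  [/\ crs s, crs (rev s), fin (sg s) = fin (sg (sg (sg (rev s)))),
     ~~ quad0 s & (exists d n, fanw d n (rev s))].
Proof.
move/asboolP=> [d [n [F nq]]]; have [t [[c1 c2 e1 e2] _]] := fanw_wedge F.
rewrite revK in c2; split=> //; last by exists d, n.
by rewrite e1 -e2 face_rev.
Qed.

Lemma fanw_dir d n x : fanw d n x -> (exists d', tri1 d' /\ x = f d') \/ quad0 x.
Proof.
case/fanw_quad=> [[_ [-> t]]|[m [y [_ _ q ->]]]]; first by left; exists d.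
by right; apply: quad0_stp.
Qed.

Lemma fin_sg_pred x y : f x = y -> crs y -> fin (sg y) = fin x.
Proof.
move=> e cy; have r := rev_pred e cy.
by rewrite -[in RHS](revK x) r -fin_sg2 ?crs_sg // sg4 ?crs_sg.
Qed.

Lemma fin_sg3_rev x : crs (f x) -> fin (sg (sg (sg (rev x)))) = fin (rev (f x)).
Proof. by move=> cx; rewrite -/(face x) fin_sg2. Qed.

(** Beyond a requested side, the sides before and after it both run on to the vertex of the
    triangle. *)
Lemma requested_fin x : requested (f x) -> fin x = fin (rev (f (f x))).
Proof.
case/requestedP=> c1 c2 e _ _.
by rewrite -(fin_sg_pred (erefl (f x)) c1) e fin_sg3_rev // crs_face.
Qed.

Lemma requested_dir s : requested s ->
  (exists2 d, tri1 d & rev s = f d) \/ quad0 (rev s).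
Proof.
case/requestedP=> _ _ _ _ [d [n /fanw_dir [[d' [t e]]|q]]]; last by right.
by left; exists d'.
Qed.

(** The two edges through the ends of [x] also bound the quadrilateral behind it, hence cross its
    far side. If the far side lay on the edge of [x], one of them would cross that edge twice. *)
Lemma quad_across x : crs x -> quad0 (rev x) ->
  [/\ cross (ed (sg x)) (ed (stp x)), cross (ed (f x)) (ed (stp x)) & ed (stp x) <> ed x].
Proof.
move=> cx /and5P[crx c1 c2 c3 /eqP e4].
have fs : f (rev x) = sg x by rewrite face_rev.
split.
- by rewrite -fs; apply: cross_face.
- have -> : ed (f x) = ed (f (f (f (rev x)))).
    by rewrite -(ed_sg_pred e4 crx).
  by apply: crossC; apply: cross_face.
- move=> eqd; set y := sg x in fs.
  have cry : crs (rev y) by rewrite -crs_face -fs.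
  case: (@crs_simple_ed y (rev y)); rewrite ?crs_sg ?ed_rev //.
  + by rewrite ed_sg2 // -eqd /stp fs.
  + by move=> e; have := fin_neq y; rewrite e eqxx.
  + by move=> e; apply: (straight_neq cry); rewrite e sg4 // crs_sg.
Qed.

(* A quadrilateral with one vertex corner from which two triangles take two units each lacks
   one unit afterwards. *)
Definition bad x :=
  [&& ~~ crs x, crs (f x), crs (f (f x)), crs (f (f (f x))) & f (f (f (f x))) == x]
  && requested (f x) && requested (f (f x)).

Lemma badP x : bad x ->
  [/\ [/\ ~~ crs x, crs (f x), crs (f (f x)), crs (f (f (f x))) & f (f (f (f x))) = x],
      requested (f x), requested (f (f x)) &
    [/\ fin (rev (f (f x))) = fin x, fin (rev (f (f (f x)))) = fin (f x)
      & fin (f (f (f x))) = fin (rev x)]].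
Proof.
case/andP=> /andP[/and5P[c0 c1 c2 c3 /eqP e4] r1 r2]; split=> //.
have cr3 : ~~ crs (rev (f (f (f x)))) by rewrite -crs_face e4.
split; rewrite -?requested_fin //.
by have := real_sg cr3; rewrite -/(face _) e4 revK.
Qed.

(** Both [b1] and the edge of [f (f (f x))] cross the edge of [f (f x)], so they share an endpoint.
    It is not the corner vertex [fin (rev x)], which lies on the edge of [x], crossed by [b1]. *)
Lemma bad_col x : bad x -> quad0 (rev (f x)) -> let b1 := ed (stp (f x)) in
  [/\ cross (ed x) b1, cross (ed (f (f x))) b1, b1 <> ed (f x),
      fin (f x) \in en b1 & fin (rev x) \notin en b1].
Proof.
move=> B q b1; have [[c0 c1 c2 c3 e4] r1 r2 [e1 e2 e3]] := badP B.
have [x1 x2 x3] := quad_across c1 q; rewrite (ed_sg_pred (erefl (f x))) // in x1.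
have nv : fin (rev x) \notin en b1.
  by apply/negP; apply: (cross_disj x1); apply: src_en.
split=> //.
have [z z1 z2] := cross_fan x2 (cross_face c3).
case: (en_cases z2) => zE; last by rewrite -e2 -zE.
by move: z1; rewrite zE e3 -/b1 (negPf nv).
Qed.

(** The mirror image of [bad_col]. *)
Lemma bad_row x : bad x -> quad0 (rev (f (f x))) -> let c1 := ed (stp (f (f x))) in
  [/\ cross (ed (f x)) c1, cross (ed (f (f (f x)))) c1, c1 <> ed (f (f x)),
      fin x \in en c1 & fin (rev x) \notin en c1].
Proof.
move=> B q d1; have [[c0 c1 c2 c3 e4] r1 r2 [e1 e2 e3]] := badP B.
have [x1 x2 x3] := quad_across c2 q; rewrite (ed_sg_pred (erefl (f (f x)))) // in x1.
have nv : fin (rev x) \notin en d1.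
  by apply/negP; apply: (cross_disj x2); rewrite -e3; apply: fin_en.
split=> //.
have [z z1 z2] := cross_fan x1 (crossC (cross_face c1)).
case: (en_cases z2) => zE; first by rewrite -zE.
by move: z1; rewrite zE -/d1 (negPf nv).
Qed.

Lemma bad_apex_notin x : bad x ->
  fin (rev x) \notin en (ed (f x)) /\ fin (rev x) \notin en (ed (f (f x))).
Proof.
move=> B; have [[c0 c1 c2 c3 e4] r1 r2 [e1 e2 e3]] := badP B.
split; apply/negP=> vin.
  by apply: (cross_disj (cross_face c1)) vin; apply: src_en.
by apply: (cross_disj (cross_face c3) vin); rewrite -e3; apply: fin_en.
Qed.

(** If the request came, the edges of [f x], [stp (f x)] and [y] would all cross the edge of [f y].
    The fan condition puts the far end of [y] on the first two, whose only common vertex is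
    [fin (f x)]; then [y] is [rev (f (f (f x)))] and the corner vertex has degree two. *)
Lemma bad_left_1quad x : bad x -> quad0 (rev (f x)) -> let y := sg x in
  ~~ crs y -> crs (f y) -> crs (f (f y)) -> f (f (f y)) = rev x ->
  f (f (f (f y))) = y -> ~~ requested (f (f y)).
Proof.
move=> B q y d0 d1 d2 p3 p4; apply/negP=> rq.
have [[c0 c1 c2 c3 e4] r1 r2 [e1 e2 e3]] := badP B.
have [nvb nvc] := bad_apex_notin B.
have [k1 k2 k3 k4 k5] := bad_col B q.
have fq : f (rev (f x)) = sg (f x) by rewrite face_rev.
have crx : crs (rev x) by rewrite -crs_face.
have rs : rev (f (f y)) = sg (sg (f x)).
  by rewrite (rev_pred p3).
have cru : crs (rev (sg (f x))).
  by case/and5P: q => _ _; rewrite fq crs_face.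
have fz : f (rev (sg (f x))) = sg (sg (f x)) by rewrite face_rev.
case: (requested_dir rq) => [[d t e]|qz].
  have ed' : d = rev (sg (f x)) by apply: face_inj; rewrite -e rs fz.
  by case/and4P: t; rewrite ed' cru.
rewrite rs in qz; case/and5P: qz => z0 z1 z2 z3 /eqP z4.
set z := sg (sg (f x)) in rs fz z0 z1 z2 z3 z4.
have z3E : f (f (f z)) = rev (sg (f x)) by apply: face_inj; rewrite z4 fz.
have edz : ed z = ed (f x) by rewrite /z ed_sg2.
have edfz : ed (f z) = ed (f y).
  have -> : f z = sg (f (f y)) by rewrite -rs face_rev.
  exact: ed_sg_pred.
have edffz : ed (f (f z)) = ed (stp (f x)).
  rewrite -(ed_sg_pred z3E) // /stp fq.
  by rewrite -/(face (sg (f x))).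
have x1 : cross (ed (f y)) (ed (f x)).
  by rewrite -edfz -edz; apply: crossC; apply: cross_face.
have x2 : cross (ed (f y)) (ed (stp (f x))).
  by rewrite -edfz -edffz; apply: cross_face.
have x3 : cross (ed (f y)) (ed y) by apply: crossC; apply: cross_face.
have ysrc : fin (rev y) = fin (rev x) by apply: real_sg.
have in1 : fin y \in en (ed (f x)).
  have [w w1 w2] := cross_fan x1 x3; case: (en_cases w2) => wE; first by rewrite -wE.
  by rewrite wE ysrc (negPf nvb) in w1.
have in2 : fin y \in en (ed (stp (f x))).
  have [w w1 w2] := cross_fan x2 x3; case: (en_cases w2) => wE; first by rewrite -wE.
  by rewrite wE ysrc (negPf k5) in w1.
have yq : fin y = fin (f x).
  apply/eqP; apply: contrapT => /negP ne; apply: k3.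
  by apply: (en_uniq (u := fin y) (w := fin (f x))) => //; apply: fin_en.
have yr : y = rev (f (f (f x))).
  apply: real_inj; rewrite // ?revK ?e2 //; first by rewrite -crs_face e4.
  by rewrite ysrc e3.
apply: (deg2 c0); rewrite -/y yr.
exact: e4.
Qed.

(** A quadrilateral behind [f (f x)] is impossible: its far edge would contain both ends of the edge
    of [f (f x)], one by [bad_row] and the other by the fan of the edges crossing that of [f x]. *)
Lemma bad_left_tri x : bad x -> quad0 (rev (f x)) -> tri1 (sg x) ->
  fin (sg x) = fin (f (f x)) /\ ~~ quad0 (rev (f (f x))).
Proof.
move=> B q t; have [[c0 c1 c2 c3 e4] r1 r2 [e1 e2 e3]] := badP B.
have [nvb nvc] := bad_apex_notin B.
set y := sg x in t *.
case/and4P: t => d0 d1 d2 /eqP d3.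
have ysrc : fin (rev y) = fin (rev x) by apply: real_sg.
have fry : f (rev x) = y by rewrite face_rev.
have p2 : f (f y) = rev x by apply: face_inj; rewrite d3.
have xb : cross (ed (f x)) (ed y).
  have r1' : rev (f y) = sg (sg (f x)).
    by rewrite (rev_pred p2) // -p2.
  have : ed (f y) = ed (f x) by rewrite -ed_rev r1' ed_sg2.
  by move=> <-; apply: crossC; apply: cross_face.
have xc : cross (ed (f x)) (ed (f (f x))) by apply: cross_face.
have fy : fin y = fin (f (f x)).
  have [w w1 w2] := cross_fan xb xc.
  case: (en_cases w1) => wE; last by rewrite wE ysrc (negPf nvc) in w2.
  case: (en_cases w2) => wE'; first by rewrite -wE -wE'.
  have xy : y = x by apply: real_inj; rewrite // -wE wE'.
  by case: (deg1 c0).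
split=> //; apply/negP=> q2.
have [k1 k2 k3 k4 k5] := bad_row B q2.
have [w w1 w2] := cross_fan xb k1.
case: (en_cases w1) => wE; last by rewrite wE ysrc (negPf k5) in w2.
apply: k3; apply: (en_uniq (u := fin x) (w := fin (f (f x)))) => //.
- by rewrite -e1 eq_sym fin_neq.
- by rewrite -fy -wE.
- by rewrite -e1 src_en.
- exact: fin_en.
Qed.

(** In both cases the last side [z] of the face at [y] ends at the corner vertex, and the fan
    condition restricts its other end to [fin (f x)], [fin x] or [fin (f (f x))]. It is then the
    reverse of [y], [x] or [sg x], and the vertex has degree at most three. *)
Lemma bad_right_face x : bad x -> quad0 (rev (f x)) -> tri1 (sg x) ->
  let y := rev (f (f (f x))) in ~~ tri1 y /\
  ~ [/\ crs (f (f y)), crs (f (f (f y))) & f (f (f (f y))) = y].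
Proof.
move=> B q t y; have [fs nq2] := bad_left_tri B q t.
have [[c0 c1 c2 c3 e4] r1 r2 [e1 e2 e3]] := badP B.
have [nvb nvc] := bad_apex_notin B.
have [k1 k2 k3 k4 k5] := bad_col B q.
have fy : f y = sg (f (f (f x))) by rewrite /y face_rev.
have edfy : ed (f y) = ed (f (f x)) by rewrite fy; apply: ed_sg_pred.
have cy : ~~ crs y by rewrite /y -crs_face e4.
have cfy : crs (f y) by rewrite fy crs_sg.
have ysrc : fin (rev y) = fin (rev x) by rewrite /y revK e3.
have sy : sg y = x by rewrite -e4.
have xb : cross (ed (f (f x))) (ed (f x)) by apply: crossC; apply: cross_face.
have srcE z : f z = y -> fin z = fin (rev x).
  move=> e; have cz : ~~ crs (rev z) by rewrite -crs_face e.
  by have := real_sg cz; rewrite -/(f z) e revK ysrc.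
have crz z : f z = y -> ~~ crs (rev z) by move=> e; rewrite -crs_face e.
split.
  apply/negP=> /and4P[_ _ c4 /eqP e5]; set z := f (f y) in c4 e5.
  have x1 : cross (ed (f (f x))) (ed z) by rewrite -edfy; apply: cross_face.
  have zs := srcE _ e5.
  have m1 : fin (rev z) \in en (ed (f x)).
    have [w w1 w2] := cross_fan x1 xb.
    case: (en_cases w1) => wE; last by rewrite -wE.
    by rewrite wE zs (negPf nvb) in w2.
  have m2 : fin (rev z) \in en (ed (stp (f x))).
    have [w w1 w2] := cross_fan x1 k2.
    case: (en_cases w1) => wE; last by rewrite -wE.
    by rewrite wE zs (negPf k5) in w2.
  have zq : fin (rev z) = fin (f x).
    apply/eqP; apply: contrapT => /negP ne; apply: k3.
    by apply: (en_uniq (u := fin (rev z)) (w := fin (f x))) => //; apply: fin_en.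
  have zy : rev z = y.
    by apply: real_inj; rewrite ?(crz _ e5) // ?revK ?zs ?ysrc // zq /y e2.
  by apply: (deg1 cy); rewrite -{1}zy -e5.
case=> c4 c5 e5; set z2 := f (f y) in c4 c5 e5; set z := f z2 in c5 e5.
have x1 : cross (ed (f (f x))) (ed z2) by rewrite -edfy; apply: cross_face.
have x2 : cross (ed z2) (ed z) by apply: cross_face.
have zs := srcE _ e5.
(* Otherwise [z2] would share three different endpoints with the edges of [f x], [stp (f x)] and
   [f (f (f x))]. *)
have qz2 : fin (f x) \in en (ed z2).
  apply: contrapT => /negP nq.
  have [w w1 w2] := cross_fan x1 xb; have [w' w1' w2'] := cross_fan x1 k2.
  have [w'' w1'' w2''] := cross_fan x1 (cross_face c3).
  have w''E : w'' = fin (rev x).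
    case: (en_cases w2'') => // wE; first by rewrite wE e3.
    by move: nq; rewrite -e2 -wE w1''.
  have ww' : w != w'.
    apply: contra_notN k3 => /eqP ww'; rewrite -ww' in w1' w2'.
    apply: (en_uniq (u := w) (w := fin (f x))) => //; last exact: fin_en.
    by apply: contraNneq nq => <-.
  case: (en2 w1 w1' ww' w1''); first by exists z2.
    by move=> wE; move: w2; rewrite -wE w''E (negPf nvb).
  by move=> wE; move: w2'; rewrite -wE w''E (negPf k5).
have [w w1 w2] := cross_fan x2 (crossC x1).
case: (en_cases w1) => wE; first by rewrite wE zs (negPf nvc) in w2.
have rz := crz _ e5.
have sgrz : sg (rev z) = y by exact: e5.
case: (en_cases w2) => wE'.
  have e : rev z = sg x.
    apply: real_inj; rewrite // ?crs_sg ?revK ?zs -?wE ?wE' ?fs //.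
    by rewrite real_sg.
  by apply: (deg3 c0); rewrite -e sgrz sy.
have e : rev z = x.
  by apply: real_inj; rewrite // ?revK ?zs -?wE ?wE' ?e1.
by apply: (deg2 c0); rewrite -{1}e sgrz sy.
Qed.

(* Starting across the second far side of the bad face of [x], [climb] follows the
   crossings of the edge of [f x] outwards as long as it passes triangles. *)
Inductive climb x : D -> Prop :=
| Climb0 : climb x (rev (f (f x)))
| ClimbS u : climb x u -> quad0 u -> tri1 (f (sg (f u))) -> climb x (rev (f (f u))).

(** Each step can be undone, and no climb starts where another one passes, since a [bad] face has a
    vertex corner and a [quad0] has none. *)
Lemma climb_inj x x' u : bad x -> bad x' -> climb x u -> climb x' u -> x = x'.
Proof.
move=> B B' C; have nq y z : bad y -> quad0 z -> rev (f (f y)) = rev (f (f z)) -> False.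
  case/badP=> [[c0 _ _ _ e4] _ _ _] /quad0_face/quad0_face qz /(can_inj revK) e.
  by case/and5P: qz; rewrite -e e4 (negPf c0).
elim: C => [|v _ IH q _] C'.
  move: C'; case E: _ / => [|v _ q _].
    by move/(can_inj revK)/face_inj/face_inj: E.
  by case: (nq _ _ B q E).
case E: _ / C' => [|w C' q' _]; first by case: (nq _ _ B' q (esym E)).
by move/(can_inj revK)/face_inj/face_inj: E => E; rewrite -E in C'; apply: IH.
Qed.

(** The climb runs backwards along the walk that arrives at [f (f x)], between the edges of [f x]
    and [f (f (f x))]. Beside it, across the edge of [f x], lie triangles with their vertex at
    [fin x]: the one at [rev t] is already known, the face on the side of [t] is examined next. *)
Lemma climb_inv x u : bad x -> ~~ quad0 (rev (f x)) -> climb x u -> let t := sg (f u) in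
  [/\ (exists d n, fanw d n u), crs (f u), ~~ crs (rev t), tri1 (rev t) &
    [/\ fin t = fin x, ed (f u) = ed (f x), ed (sg u) = ed (f (f (f x))),
        fin x \in en (ed u) & sg (sg t) = f (f x) \/ quad0 (sg (sg t))]].
Proof.
move=> B nq; have [[c0 c1 c2 c3 e4] r1 r2 [e1 e2 e3]] := badP B.
have [nvb nvc] := bad_apex_notin B.
elim=> [|u1 C IH q t1].
  have fu : f (rev (f (f x))) = sg (f (f x)) by rewrite face_rev.
  have [d td ed'] : exists2 d, tri1 d & rev (f x) = f d.
    by case: (requested_dir r1) => // q; rewrite q in nq.
  have rd : rev d = sg (sg (f (f x))).
    by rewrite (rev_pred (esym ed')) -?crs_face // .
  rewrite /= !fu -rd revK; case/and4P: (td) => d0 _ _ _.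
  case/requestedP: (r2) => _ _ _ _ F.
  split=> //; first by rewrite crs_sg.
  split.
  - by rewrite rd fin_sg2 // e1.
  - exact: ed_sg_pred.
  - by rewrite -face_rev face_rev.
  - by rewrite ed_rev -e1 src_en.
  - by left; rewrite rd sg4.
have [[d [n F]] cfu rt rtt [f1 f2 f3 f4 f5]] := IH.
set t := sg (f u1) in IH t1 rt rtt f1 f5 *.
have frfu : f (rev (f u1)) = t by rewrite face_rev.
case/and4P: (t1) => g0 g1 g2 /eqP g3.
have fft : f (f t) = rev (f u1) by do 2!apply: face_inj; rewrite g3 frfu.
case/and5P: (q) => q0 q1 q2 q3 /eqP q4.
have cru : crs (rev u1) by rewrite -crs_face.
have fu' : f (rev (f (f u1))) = sg (f (f u1)) by rewrite face_rev.
have tE : sg (f (rev (f (f u1)))) = rev (f t).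
  rewrite (rev_pred fft) -?fft //.
  by rewrite fft face_rev.
have edfu : ed (f (rev (f (f u1)))) = ed (f x).
  by rewrite fu' -f2; apply: ed_sg_pred.
have edsu : ed (sg (rev (f (f u1)))) = ed (f (f (f x))).
  rewrite -/(face (f (f u1))) -f3; symmetry.
  exact: ed_sg_pred.
rewrite /= tE revK; split=> //.
- case: (fanw_quad F) => [[_ [uE td]]|[m [y [_ F' _ uE]]]].
    by case: (quad0_tri1 q td uE).
  exists d, m; suff -> : rev (f (f u1)) = y by [].
  apply: (can_inj revK); rewrite revK; do 2!apply: face_inj.
  by rewrite q4 uE.
- by rewrite fu' crs_sg.
split=> //.
- have cr : ~~ crs (rev t) by [].
  by have := real_sg cr; rewrite -/(face t) revK f1.
- rewrite ed_rev.
  have x1 : cross (ed (f x)) (ed (f (f u1))) by rewrite -f2; apply: cross_face.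
  have x2 : cross (ed (f (f (f x)))) (ed (f (f u1))).
    rewrite -f3 (ed_sg_pred q4) //; apply: crossC; apply: cross_face => //.
  have [w w1 w2] := cross_fan x1 (crossC (cross_face c1)).
  case: (en_cases w2) => wE; first by rewrite -wE.
  case: (cross_disj x2 (v := w)) => //.
  by rewrite wE -e3 fin_en.
right; have -> : sg (sg (rev (f t))) = f (f u1).
  by rewrite -tE fu' sg4.
by do 2!apply: quad0_face.
Qed.

(** Each step undoes one step of the walk arriving at [f (f x)], so the length of the walk bounds
    the climb. In the triangle where the walk began, [f u] ends at a vertex, and the next face
    cannot be a [tri1]. *)
Lemma climb_end x : bad x -> ~~ quad0 (rev (f x)) ->
  exists2 u, climb x u & ~~ tri1 (f (sg (f u))).
Proof.
move=> B nq; have [[c0 c1 c2 c3 e4] r1 r2 _] := badP B.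
case/requestedP: r2 => _ _ _ _ [d [n F]].
suff H m u : fanw d m u -> climb x u -> exists2 u, climb x u & ~~ tri1 (f (sg (f u))).
  exact: H F (Climb0 x).
elim: m u => [|m IH] u Fu C; case t1: (tri1 (f (sg (f u)))); try by exists u; rewrite ?t1.
  have frfu : f (rev (f u)) = sg (f u) by rewrite face_rev.
  case/and4P: t1 => g0 g1 g2 /eqP g3.
  have fft : f (f (sg (f u))) = rev (f u) by do 2!apply: face_inj; rewrite g3 frfu.
  case: (fanw_quad Fu) => [[_ [uE /and4P[d0 _ _ /eqP d3]]]|[k [y []]]] //.
  by move: g1; rewrite fft -crs_face uE d3 (negPf d0).
case: (fanw_quad Fu) => [[]|[k [y [[<-] Fy q uE]]]] //.
have qu : quad0 u by rewrite uE; apply: quad0_stp.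
have yE : rev (f (f u)) = y.
  apply: (can_inj revK); rewrite revK; do 2!apply: face_inj.
  by case/and5P: qu => _ _ _ _ /eqP ->.
apply: (IH y) => //; rewrite -yE.
exact: ClimbS.
Qed.

(** A request there would give the edge of [u] and the edge of the far side [f (f u)] a second
    common vertex besides [fin x], so they would be one edge, against [quad_across]. *)
Lemma climb_not_requested x u : bad x -> ~~ quad0 (rev (f x)) -> climb x u ->
  ~~ requested (rev (f u)).
Proof.
move=> B nq C; apply/negP=> rq.
have [[d [n F]] cfu rt rtt [f1 f2 f3 f4 f5]] := climb_inv B nq C.
case/requestedP: rq => c1 c2 fE _ _.
have qu : quad0 u.
  case: (fanw_dir F) => // [[d' [/and4P[d0 _ _ /eqP d3] uE]]].
  by move: c1; rewrite uE -crs_face d3 (negPf d0).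
have cru : crs (rev u) by rewrite -crs_face.
have cu : crs u by case/and5P: qu.
have qru : quad0 (rev (rev u)) by rewrite revK.
have [_ _] := quad_across cru qru; rewrite ed_rev /stp revK; apply.
have p2 : fin (rev (sg (f u))) \in en (ed (f (f u))).
  rewrite -fin_sg2 ?crs_sg //.
  move: fE; rewrite revK -[sg (rev (f u))]/(f (f u)) => <-; exact: fin_en.
have p1 : fin x \in en (ed (f (f u))).
  case/and5P: (qu) => q0 q1 q2 q3 /eqP q4.
  have [[b0 b1 b2 b3 b4] _ _ [_ _ b7]] := badP B.
  have y1 : cross (ed (f x)) (ed (f (f u))) by rewrite -f2; apply: cross_face.
  have y2 : cross (ed (f (f (f x)))) (ed (f (f u))).
    rewrite -f3 (ed_sg_pred q4) //; apply: crossC; apply: cross_face => //.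
  have [w w1 w2] := cross_fan y1 (crossC (cross_face b1)).
  case: (en_cases w2) => wE; first by rewrite -wE.
  case: (cross_disj y2 (v := w)) => //.
  by rewrite wE -b7 fin_en.
have edt : ed (sg (f u)) = ed u by apply: ed_sg_pred.
apply: (en_uniq (u := fin x) (w := fin (rev (sg (f u))))) => //.
- by rewrite -f1 fin_neq.
- by rewrite -edt src_en.
Qed.

(** * Paying faces without vertex corners, and the second round *)

Definition pent0 x := [&& crs x, crs (f x), crs (f (f x)), crs (f (f (f x))),
  crs (f (f (f (f x)))) & f (f (f (f (f x)))) == x].
Definition hex0 x := [&& crs x, crs (f x), crs (f (f x)), crs (f (f (f x))),
  crs (f (f (f (f x)))), crs (f (f (f (f (f x))))) & f (f (f (f (f (f x))))) == x].

Lemma pent0_face x : pent0 x -> pent0 (f x).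
Proof.
case/and5P=> c0 c1 c2 c3 /andP[c4 /eqP e].
by rewrite /pent0 e c0 c1 c2 c3 c4 eqxx.
Qed.

Lemma hex0_face x : hex0 x -> hex0 (f x).
Proof.
case/and5P=> c0 c1 c2 c3 /and3P[c4 c5 /eqP e].
by rewrite /hex0 e c0 c1 c2 c3 c4 c5 eqxx.
Qed.

(** Sides of the pentagon at distance two cross the side between them, so they share an endpoint.
    The far side of a quadrilateral behind [x] crosses both neighbours of [x], and by the fan
    condition it contains [p02] and [p03]; these are the two ends of the edge of [x]. *)
Lemma pent_direct x : pent0 x -> ~~ quad0 (rev x).
Proof.
case/and5P=> c0 c1 c2 c3 /andP[c4 /eqP e5]; apply/negP=> q.
set x1 := f x in c1 c2 c3 c4 e5; set x2 := f x1 in c2 c3 c4 e5.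
set x3 := f x2 in c3 c4 e5; set x4 := f x3 in c4 e5.
have [y1 y2 y3] := quad_across c0 q; rewrite (ed_sg_pred e5) // -/x1 in y1 y2.
set e' := ed (stp x) in y1 y2 y3.
have k01 : cross (ed x) (ed x1) by apply: cross_face.
have k12 : cross (ed x1) (ed x2) by apply: cross_face.
have k23 : cross (ed x2) (ed x3) by apply: cross_face.
have k34 : cross (ed x3) (ed x4) by apply: cross_face.
have k40 : cross (ed x4) (ed x) by rewrite -e5; apply: cross_face; rewrite e5.
have [p03 p03a p03b] := cross_fan k40 (crossC k34).
have [p13 p13a p13b] := cross_fan (crossC k12) k23.
have [p02 p02a p02b] := cross_fan (crossC k01) k12.
have [p24 p24a p24b] := cross_fan (crossC k23) k34.
have n1 : p03 != p13.
  by apply/eqP=> E; apply: (cross_disj k01 p03a); rewrite E.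
have n2 : p02 != p24.
  by apply/eqP=> E; apply: (cross_disj k40 _ p02a); rewrite E.
have [w3 w3a w3b] := cross_fan y1 (crossC k34).
have [w2 w2a w2b] := cross_fan y2 k12.
have w3E : w3 = p03.
  case: (en2 p03b p13b n1 w3b) => //; first by exists x3.
  by move=> E; case: (cross_disj y2 p13a); rewrite -E.
have w2E : w2 = p02.
  case: (en2 p02b p24a n2 w2b) => //; first by exists x2.
  by move=> E; case: (cross_disj y1 p24b); rewrite -E.
apply: y3; apply: (en_uniq (u := p02) (w := p03)) => //.
- by apply/eqP=> E; apply: (cross_disj k23 p02b); rewrite E.
- by rewrite -w2E.
- by rewrite -w3E.
Qed.

Definition full6 x := [&& hex0 x, requested x, requested (f x), requested (f (f x)),
  requested (f (f (f x))), requested (f (f (f (f x))))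
  & requested (f (f (f (f (f x)))))].

Lemma full6_face x : full6 x -> full6 (f x).
Proof.
case/and5P=> h r0 r1 r2 /and3P[r3 r4 r5]; rewrite /full6 hex0_face // r1 r2 r3 r4 r5.
by case/and5P: h => _ _ _ _ /and3P[_ _ /eqP ->].
Qed.

(** By the requests at the sides between them, the edges of [x], [f (f x)] and [f (f (f (f x)))]
    form a triangle on three vertices. The far side of a quadrilateral behind [x] shares an endpoint
    with each of these edges, so it contains two of the three vertices; yet it lies on none of the
    three edges. *)
Lemma full6_direct x : full6 x -> ~~ quad0 (rev x).
Proof.
case/and5P=> /and5P[c0 c1 c2 c3 /and3P[c4 c5 /eqP e6]] _ r1 _ /and3P[r3 _ r5].
apply/negP=> q.
have E0 := requested_fin r1; have E2 := requested_fin r3.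
have E4 := requested_fin r5; rewrite e6 in E4.
have [y1 y2 y3] := quad_across c0 q; rewrite (ed_sg_pred e6) // in y1.
set x1 := f x in c1 c2 c3 c4 c5 e6 E0 E2 E4 y1 y2.
set x2 := f x1 in c2 c3 c4 c5 e6 E0 E2 E4 y1.
set x3 := f x2 in c3 c4 c5 e6 E2 E4 y1.
set x4 := f x3 in c4 c5 e6 E2 E4 y1; set x5 := f x4 in c5 e6 y1.
have k01 : cross (ed x) (ed x1) by apply: cross_face.
have k12 : cross (ed x1) (ed x2) by apply: cross_face.
have k45 : cross (ed x4) (ed x5) by apply: cross_face.
have fsx : f (rev x) = sg x by rewrite face_rev.
have [s0 s1 s2 s3 s4] := and5P q.
have s3E : f (f (f (rev x))) = rev (sg (sg x1)).
  by rewrite -[LHS]revK (rev_pred (eqP s4)).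
have cr1 : crs (rev x1) by rewrite -crs_face.
have n2 : ed (stp x) <> ed x2.
  move=> E; have cs : crs (rev (sg (sg x1))) by rewrite -s3E.
  have [nn1 nn2] := straight2_neq c1 cr1 cs.
  case: (@crs_simple_ed (rev x1) (rev (sg (sg x1)))); rewrite ?ed_rev ?ed_sg2 //.
  by rewrite -[sg (rev x1)]/x2 -E -s3E; symmetry; apply: ed_sg_pred.
have n4 : ed (stp x) <> ed x4.
  move=> E; have sx : sg x = sg (sg (rev x5)) by rewrite -[in LHS]e6.
  have cs : crs (rev (sg (sg (rev x5)))) by rewrite -sx -crs_face -fsx.
  have cr5 : crs (rev x5) by rewrite -crs_face e6.
  have crr5 : crs (rev (rev x5)) by rewrite revK.
  have [] := straight2_neq cr5 crr5 cs; rewrite revK => nn1 nn2.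
  have csx : crs (rev (sg x)) by rewrite sx.
  have ed5 : ed x5 = ed (rev (sg x)) by rewrite ed_rev sx ed_sg2 // ed_rev.
  have ed4 : ed (sg x5) = ed (sg (rev (sg x))).
    by rewrite (ed_sg_pred (erefl x5)) // -E /stp fsx.
  case: (crs_simple_ed c5 csx ed5 ed4); rewrite sx // => e.
have [w0 w0a w0b] := cross_fan y2 (crossC k01).
have [w2 w2a w2b] := cross_fan y2 k12.
have [w4 w4a w4b] := cross_fan y1 (crossC k45).
have AB := fin_neq x; have BC := fin_neq x2; have CA := fin_neq x4.
rewrite -E0 -?E2 in BC; rewrite -E2 E4 in CA.
have i0 := fin_en x; have i0' := src_en x; have i2 := fin_en x2.
have := src_en x2; rewrite -E0 => i2'; have := fin_en x4; rewrite E4 => i4.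
have := src_en x4; rewrite -E2 => i4'.
have w0E : w0 = fin x \/ w0 = fin (rev x) by apply: en_cases.
have w2E : w2 = fin x2 \/ w2 = fin x by rewrite E0; apply: en_cases.
have w4E : w4 = fin (rev x) \/ w4 = fin x2.
  by rewrite -E4 E2; apply: en_cases.
have h0 : fin x \in en (ed (stp x)) -> fin (rev x) \in en (ed (stp x)) -> False.
  by move=> h h'; apply: y3; apply: (en_uniq AB).
have h2 : fin x \in en (ed (stp x)) -> fin x2 \in en (ed (stp x)) -> False.
  by move=> h h'; apply: n2; apply: (en_uniq BC).
have h4 : fin (rev x) \in en (ed (stp x)) -> fin x2 \in en (ed (stp x)) -> False.
  by move=> h h'; apply: n4; apply: (en_uniq CA).
by case: w0E w0a => ->; case: w2E w2a => ->; case: w4E w4a => ->; auto.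
Qed.

(** The triangles behind [y] and [x] have their vertices on the two edges that cross at the corner.
    So in the face opposite to the corner both neighbours of the crossing are vertices. *)
Lemma direct_corner y x : f y = x -> crs x -> requested x -> requested y ->
  ~~ quad0 (rev x) -> ~~ quad0 (rev y) ->
  ~~ crs (rev (sg (sg x))) /\ exists2 z, f z = sg (sg x) & ~~ crs z.
Proof.
move=> e cx rx ry nx ny; have cry : crs (rev y) by rewrite -crs_face e.
have reals d x' : tri1 d -> rev x' = f d -> ~~ crs (rev (sg x')).
  case/and4P=> d0 _ _ /eqP d3 e'; rewrite -crs_face.
  by rewrite -[sg x']face_rev e' d3.
split.
  case: (requested_dir ry) => [[d t e']|q]; last by rewrite q in ny.
  case/and4P: t => d0 d1 d2 _.
  have := rev_pred (esym e') cry.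
  by rewrite -[sg (rev y)]/(f y) e => <-; rewrite revK.
case: (requested_dir rx) => [[d t e']|q]; last by rewrite q in nx.
by exists (rev (sg x)); rewrite ?face_rev ?(reals d).
Qed.

(** In a pentagon [f (f (f (f x)))] is the side before [x], so a corner between two requested sides
    asks; in a hexagon all corners ask when all sides are requested. *)
Definition asks0 x :=
  [&& pent0 x, requested x & requested (f (f (f (f x))))] || full6 x.

(* The four places from which a face that is still short takes a unit. *)
Inductive gets : nat -> D -> D -> Prop :=
| GetsFar x u : bad x -> ~~ quad0 (rev (f x)) -> climb x u ->
    ~~ tri1 (f (sg (f u))) -> gets 0 x (sg (f u))
| GetsLeft x : bad x -> quad0 (rev (f x)) -> ~~ tri1 (sg x) -> gets 1 x (rev x)
| GetsRight x : bad x -> quad0 (rev (f x)) -> tri1 (sg x) -> gets 2 x (sg (f (f (f x))))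
| GetsOpp x : asks0 x -> gets 3 x (sg (sg x)).

Definition gives x := bad x || asks0 x.

Lemma gets_ex x : gives x -> exists i t, gets i x t.
Proof.
case/orP=> [B|a]; last by exists 3, (sg (sg x)); constructor.
case q: (quad0 (rev (f x))).
  case t: (tri1 (sg x)); last by exists 1, (rev x); constructor; rewrite ?t.
  by exists 2, (sg (f (f (f x)))); constructor.
have [|u C nt] := climb_end B; first by rewrite q.
by exists 0, (sg (f u)); constructor; rewrite ?q.
Qed.

Definition ring0 x := (pent0 x || hex0 x).

Lemma asks0_ring x : asks0 x -> ring0 x.
Proof. by rewrite /ring0; case/orP=> [/and3P[->]|/and5P[->]] //; rewrite orbT. Qed.

Lemma ring0_crs x : ring0 x -> [/\ crs x, crs (f x), crs (f (f x)) & crs (f (f (f x)))].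
Proof. by case/orP=> [/and5P[]|/and5P[]]. Qed.

Lemma ring0_quad0 x : ring0 x -> quad0 x -> False.
Proof.
move=> r /and5P[_ _ _ _ /eqP e]; case/orP: r.
  by case/and5P=> _ _ _ _ /andP[_ /eqP]; rewrite e; apply: face_neq.
by case/and5P=> _ _ _ _ /and3P[_ _ /eqP]; rewrite e; apply: face2_neq.
Qed.

(** For equal kinds the place determines the face that asks, by injectivity of [sg], [face] and the
    climb. For different kinds the faces around the crossing at the place are of incompatible
    types. *)
Lemma gets_inj i j x y t : gets i x t -> gets j y t -> i <= j -> x = y.
Proof.
have bd z : bad z -> quad0 z -> False by case/badP=> [[c0 _ _ _ _] _ _ _] /and5P[]; rewrite (negPf c0).
have opL z : bad z -> sg (sg (rev z)) = sg (f z).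
  case/badP=> [[_ c1 _ _ _] _ _ _].
  by rewrite (rev_pred (erefl (f z))) // sg4 // crs_sg.
have opR z : bad z -> sg (sg (sg (f (f (f z))))) = rev (f (f z)).
  by case/badP=> [[_ _ _ c3 _] _ _ _]; rewrite -(rev_pred (erefl _)).
have opQ z : quad0 (rev (f z)) -> quad0 (sg (f z)).
  by move/quad0_face; rewrite face_rev.
have triR z : bad z -> quad0 (rev (f z)) -> tri1 (sg z) ->
    exists2 d, tri1 d & rev (f (f z)) = f d.
  move=> B q t1; have [_ nq] := bad_left_tri B q t1; have [_ _ r2 _] := badP B.
  by case: (requested_dir r2) => // q'; rewrite q' in nq.
case=> {i x t}.
- move=> x u B nq C nt; set t := sg (f u).
  have [[d [n F]] cfu rt rtt [f1 f2 f3 f4 f5]] := climb_inv B nq C.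
  move E: t => t' G; case: G E => {t' j y}.
  + move=> y v B' nq' C' nt'; rewrite /t => /sg_inj/face_inj E _.
    by rewrite -E in C'; apply: (climb_inj B B' C C').
  + move=> y B' _ _ E _; move: rtt; rewrite -/t E revK => /and4P[_ _ _ /eqP e3].
    by have [[c0 _ _ c3 _] _ _ _] := badP B'; rewrite e3 (negPf c0) in c3.
  + move=> y B' _ _ /sg_inj/face_inj E _.
    have [[c0 c1 _ _ e4] _ _ _] := badP B'.
    case: (fanw_dir F) => [[d' [/and4P[d0 _ _ _] /esym]]|/and5P[_ _ c _ _]].
      by rewrite E => /face_inj d'E; rewrite d'E c1 in d0.
    by rewrite E e4 (negPf c0) in c.
  + move=> y /asks0_ring ry E _; have [c0 c1 c2 c3] := ring0_crs ry.
    have E2 : sg (sg t) = y by rewrite E sg4.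
    rewrite -/t E2 in f5; case: f5 => [yE|q]; last by case: (ring0_quad0 ry q).
    by have [[b0 _ _ _ b4] _ _ _] := badP B; rewrite yE b4 (negPf b0) in c2.
- move=> x B q nt; move E: (rev x) => t G; case: G E => {t j y} //.
  + by move=> y B' q' t' /(can_inj revK).
  + move=> y B' q' t' E _; have [d td dE] := triR y B' q' t'.
    have := opL x B; rewrite E opR // dE => E'.
    by case: (quad0_tri1 (opQ x q) td).
  + move=> y /asks0_ring ry E _; have [c0 _ _ _] := ring0_crs ry.
    have := opL x B; rewrite E sg4 // => yE.
    by have := opQ x q; rewrite -yE => /(ring0_quad0 ry).
- move=> x B q t1; move E: (sg (f (f (f x)))) => t G; case: G E => {t j y} //.
  + by move=> y _ _ _ /sg_inj/face_inj/face_inj/face_inj.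
  + move=> y /asks0_ring ry E _; have [c0 _ c2 _] := ring0_crs ry.
    have := opR x B; rewrite E sg4 // => yE.
    have [d /and4P[d0 _ _ /eqP d3] dE] := triR x B q t1.
    by rewrite yE dE d3 (negPf d0) in c2.
- move=> x a; move E: (sg (sg x)) => t G; case: G E => {t j y} //.
  by move=> y _ /sg_inj/sg_inj.
Qed.

(** This is what keeps a donor above 20: it has a vertex corner next to [t] and is no [tri1]. A
    quadrilateral with one vertex corner can spare three units, and one request never coincides with
    two single units there. *)
Lemma gets_props i x t : gets i x t ->
  [/\ crs t, ~~ crs (rev t) \/ (exists2 z, f z = t & ~~ crs z),
     (forall y, tri1 y -> f y <> t /\ f (f y) <> t) &
     (forall y, crs (f y) -> crs (f (f y)) -> crs (f (f (f y))) ->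
        ~~ crs y -> f (f (f (f y))) = y ->
        (f y = t -> ~~ requested t) /\ (f (f (f y)) = t -> ~~ requested (f (f y))))].
Proof.
case=> {i x t}.
- move=> x u B nq C nt; have [_ cfu rt rtt _] := climb_inv B nq C.
  set t := sg (f u) in nt rt rtt *.
  have crt : crs (f t) = false by rewrite crs_face (negPf rt).
  split; [by rewrite crs_sg | by left| |].
    move=> y /and4P[y0 y1 y2 /eqP y3]; split=> E; first by rewrite E crt in y2.
    by move: nt; rewrite -E y3 /tri1 y0 y1 y2 y3 eqxx.
  move=> y y1 y2 y3 y0 y4; split=> E; first by rewrite E crt in y2.
  have -> : f (f y) = rev (f u) by apply: face_inj; rewrite E face_rev.
  exact: (climb_not_requested B nq C).
- move=> x B q nt; have [[c0 c1 c2 c3 e4] r1 r2 _] := badP B.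
  have crt : crs (f (rev x)) = false by rewrite face_rev crs_sg (negPf c0).
  split; rewrite ?revK -?crs_face; [by []| by left| |].
    move=> y ty; split=> E; first by case/and4P: ty; rewrite E crt.
    by case/and4P: (ty) => _ _ _ /eqP; rewrite E face_rev => yE; rewrite yE ty in nt.
  move=> y y1 y2 y3 y0 y4; split=> E; first by rewrite E crt in y2.
  have yE : sg x = y by rewrite -y4 E face_rev.
  by rewrite -yE; apply: bad_left_1quad => //; rewrite yE.
- move=> x B q t1; have [nt nq] := bad_right_face B q t1.
  have [[c0 c1 c2 c3 e4] _ _ _] := badP B.
  set z := rev (f (f (f x))) in nt nq.
  have fz : f z = sg (f (f (f x))) by rewrite face_rev.
  have cz : crs z = false by rewrite /z -crs_face e4 (negPf c0).
  rewrite -fz; split; [by rewrite fz crs_sg | by right; exists z; rewrite ?cz| |].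
    move=> y ty; split=> /face_inj E; first by rewrite -E ty in nt.
    by case/and4P: ty; rewrite E cz.
  move=> y y1 y2 y3 y0 y4; split=> /face_inj E; last by rewrite E cz in y2.
  by case: nq; rewrite -E.
- move=> x a; have [c0 c1 c2 c3] := ring0_crs (asks0_ring a).
  have [rt [z fz cz]] : ~~ crs (rev (sg (sg x))) /\ exists2 z, f z = sg (sg x) & ~~ crs z.
    case/orP: a => [/and3P[p r r4]|a].
      have p4 : pent0 (f (f (f (f x)))) by do 4!apply: pent0_face.
      have e5 : f (f (f (f (f x)))) = x by case/and5P: p => _ _ _ _ /andP[_ /eqP].
      by apply: (direct_corner e5); rewrite // pent_direct.
    have e6 : f (f (f (f (f (f x))))) = x by case/and5P: a => /and5P[_ _ _ _ /and3P[_ _ /eqP]].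
    have a5 : full6 (f (f (f (f (f x))))) by do 5!apply: full6_face.
    have r1 : requested x by case/and5P: a.
    have r5 : requested (f (f (f (f (f x))))) by case/and5P: a5.
    by apply: (direct_corner e6); rewrite // full6_direct.
  have crt : crs (f (sg (sg x))) = false by rewrite crs_face (negPf rt).
  split; [by rewrite !crs_sg | by left | |].
    move=> y /and4P[y0 y1 y2 /eqP y3]; split=> E; first by rewrite E crt in y2.
    by move: cz; rewrite -(face_inj (etrans E (esym fz))) y1.
  move=> y y1 y2 y3 y0 y4; split=> E; first by rewrite E crt in y2.
  by move: cz; rewrite -(face_inj (etrans E (esym fz))) y2.
Qed.

(** * The balance of each face *)

Definition asked t := `[< exists i x, gives x /\ gets i x t >].

Lemma card_gives : #|gives| <= #|asked|.
Proof.
have /choice[g gP] : forall x, exists t, gives x -> exists i, gets i x t.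
  move=> x; case gx: (gives x); last by exists x.
  by have [i [t G]] := gets_ex gx; exists t => _; exists i.
rewrite -(card_in_image (f := g) (A := gives)).
  apply: subset_leq_card; apply/subsetP=> t /imageP[x gx ->].
  by apply/asboolP; have [i G] := gP x gx; exists i, x.
move=> x y gx gy e; have [i Gx] := gP x gx; have [j Gy] := gP y gy.
rewrite -e in Gy; case: (leqP i j) => [ij|/ltnW ji]; first exact: gets_inj Gx Gy ij.
by rewrite (gets_inj Gy Gx ji).
Qed.

Lemma card_tri1 : #|tri1| <= #|requested|.
Proof.
have /choice[g gP] : forall d, exists s, tri1 d -> exists n, fanw d n (rev s) /\ ~~ quad0 s.
  move=> d; case td: (tri1 d); last by exists d.
  have [n [x [F nq]]] := fanw_land td.
  by exists (rev x) => _; exists n; rewrite revK.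
rewrite -(card_in_image (f := g) (A := tri1)).
  apply: subset_leq_card; apply/subsetP=> s /imageP[d td ->].
  by apply/asboolP; have [n G] := gP d td; exists d, n.
move=> d d' td td' e; have [n [F _]] := gP d td; have [n' [F' _]] := gP d' td'.
by rewrite -e in F'; have [_ ->] := fanw_inj F F'.
Qed.

(* A face with [l] darts, [v] of them leaving vertices, has [5 * l + 3 * v] units; it must
   keep [20]. *)
Definition weight d := if crs d then 5 else 8.
Definition debit d := 2 * requested d + asked d.
Definition value d := weight d + gives d + 2 * tri1 d - debit d.

(** The subtraction in [value] is in [nat]; this bound keeps it exact in the sum over all darts. *)
Lemma debit_le d : debit d <= weight d + gives d + 2 * tri1 d.
Proof.
rewrite /debit /weight -!addnA; apply: (@leq_trans 5); last by case: ifP => _; apply: leq_addr.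
by case: requested; case: asked.
Qed.

Lemma requested_crs d : requested d -> crs d /\ crs (f d).
Proof. by case/requestedP=> c1 c2 _ _ _; rewrite crs_face. Qed.

Lemma askedP t : asked t ->
  [/\ crs t, ~~ crs (rev t) \/ (exists2 z, f z = t & ~~ crs z),
     (forall y, tri1 y -> f y <> t /\ f (f y) <> t) &
     (forall y, crs (f y) -> crs (f (f y)) -> crs (f (f (f y))) ->
        ~~ crs y -> f (f (f (f y))) = y ->
        (f y = t -> ~~ requested t) /\ (f (f (f y)) = t -> ~~ requested (f (f y))))].
Proof. by case/asboolP=> i [x [_ /gets_props]]. Qed.

Lemma value_real d : ~~ crs d -> value d = 8 + gives d + 2 * tri1 d.
Proof.
move=> cd; rewrite /value /debit /weight (negPf cd).
have -> : requested d = false by apply/negP=> /requested_crs[]; rewrite (negPf cd).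
have -> : asked d = false by apply/negP=> /askedP[]; rewrite (negPf cd).
by rewrite subn0.
Qed.

Lemma value_crs d : crs d -> value d = 5 + gives d - (2 * requested d + asked d).
Proof. by rewrite /value /debit /weight /tri1 => ->; rewrite muln0 addn0. Qed.

Lemma value_ge2 d : 2 <= value d.
Proof.
case cd: (crs d); last by rewrite value_real ?cd // -addnA; apply: leq_trans (leq_addr _ _).
by rewrite value_crs //; case: requested; case: asked; case: gives.
Qed.

Lemma value_ge8 d : ~~ crs d -> 8 <= value d.
Proof. by move=> cd; rewrite value_real // -addnA; apply: leq_addr. Qed.

Lemma value_head d : crs d -> ~~ crs (f d) -> 4 <= value d.
Proof.
move=> cd cf; rewrite value_crs //.
have -> : requested d = false by apply/negP=> /requested_crs[_]; rewrite (negPf cf).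
by case: asked; case: gives.
Qed.

Lemma asked_inner z : crs z -> crs (f (f z)) -> asked (f z) = false.
Proof.
move=> cz cf; apply/negP=> /askedP[_ h _ _]; case: h => [|[y /face_inj -> ny]]; last by rewrite cz in ny.
by rewrite -crs_face cf.
Qed.

Lemma value_inner z : crs z -> crs (f z) -> crs (f (f z)) -> 3 <= value (f z).
Proof.
move=> cz cfz cf; rewrite value_crs // asked_inner //.
by case: requested; case: gives.
Qed.

Definition fsum x := \sum_(0 <= i < order f x) value (iter i f x).

Lemma order_ge3 x : 2 < order f x.
Proof.
have e := iter_order face_inj x; have := order_gt0 f x.
case: (order f x) e => [|[|[|n]]] // e _.
  by case: (face_neq (d := x)).
by case: (face2_neq (d := x)).
Qed.

(** A triangle with one vertex corner reaches 10 + 5 + 5, as nothing is taken from it; with two such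
    corners it keeps at least 8 + 8 + 4. The quadrilateral with one vertex corner is the tight
    case. *)
Lemma fsum_ge1 x : ~~ crs x -> 20 <= fsum x.
Proof.
move=> cx; have e := iter_order face_inj x; have o3 := order_ge3 x.
rewrite /fsum; move: (order f x) e o3 => m.
case: m => [|[|[|[|m]]]] // e _.
  have {}e : f (f (f x)) = x by [].
  rewrite !big_nat_recr // big_nil /= add0n.
  case c1: (crs (f x)); case c2: (crs (f (f x))).
  - have t : tri1 x by rewrite /tri1 cx c1 c2 e eqxx.
    have h0 : 10 <= value x by rewrite value_real // t addnAC leq_addr.
    have n1 : requested (f x) = false.
      apply/negP=> /requested_fin E.
      have xr : x = rev (f (f x)).
        apply: real_inj; rewrite // ?revK -?crs_face ?e //.
        have cr : ~~ crs (rev (f (f x))) by rewrite -crs_face e.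
        by have := real_sg cr; rewrite -/(face _) e revK.
      by apply: (deg1 cx); rewrite {1}xr -/(face _) e.
    have n2 : requested (f (f x)) = false.
      by apply/negP=> /requested_crs[_]; rewrite e (negPf cx).
    have a1 : asked (f x) = false by apply/negP=> /askedP[_ _ /(_ x t)[]].
    have a2 : asked (f (f x)) = false by apply/negP=> /askedP[_ _ /(_ x t)[]].
    have h1 : 5 <= value (f x) by rewrite value_crs // n1 a1 subn0 leq_addr.
    have h2 : 5 <= value (f (f x)) by rewrite value_crs // n2 a2 subn0 leq_addr.
    exact: (leq_add (leq_add h0 h1) h2).
  - have h0 := value_ge8 cx; have h2 := value_ge8 (negbT c2).
    have h1 : 4 <= value (f x) by apply: value_head; rewrite ?c2.
    exact: (leq_add (leq_add h0 h1) h2).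
  - have h0 := value_ge8 cx; have h1 := value_ge8 (negbT c1).
    have h2 : 4 <= value (f (f x)) by apply: value_head; rewrite ?e.
    exact: (leq_add (leq_add h0 h1) h2).
  - have h0 := value_ge8 cx; have h1 := value_ge8 (negbT c1); have h2 := value_ge8 (negbT c2).
    exact: (leq_trans _ (leq_add (leq_add h0 h1) h2)).
rewrite big_ltn // [X in _ <= value X + _]/=.
have h0 := value_ge8 cx.
(* A second vertex corner at position [i] has 8 units, and any other dart keeps 2. *)
case cr: [forall i : 'I_m.+4, (0 < i) ==> crs (iter i f x)]; last first.
  case/negbT/forallPn: cr => i; rewrite negb_imply => /andP[i0 ci].
  have hi : 8 <= value (iter i f x) by apply: value_ge8.
  have -> : \sum_(1 <= j < m.+4) value (iter j f x) =
      \sum_(1 <= j < i) value (iter j f x) + (value (iter i f x)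
      + \sum_(i.+1 <= j < m.+4) value (iter j f x)).
    rewrite (@big_cat_nat _ _ _ i) //=; last by rewrite ltnW.
    by rewrite [in LHS](@big_ltn _ _ _ i).
  have hs a b : 2 * (b - a) <= \sum_(a <= j < b) value (iter j f x).
    rewrite -{1}[b - a]/(b - a) mulnC -sum_nat_const_nat.
    by apply: leq_sum => j _; apply: value_ge2.
  have l1 := hs 1 i; have l2 := hs i.+1 m.+4.
  have il := ltn_ord i.
  apply: leq_trans (leq_add h0 (leq_add l1 (leq_add hi l2))).
  by apply: gap_count; rewrite ?ltn_ord.
have {}cr i : 0 < i < m.+4 -> crs (iter i f x).
  by case/andP=> i0 im; have /forallP/(_ (Ordinal im)) := cr; rewrite /= i0.
case: m e cr => [|m] e cr.
  have {}e : f (f (f (f x))) = x by [].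
  have c1 := cr 1 isT; have c2 := cr 2 isT; have c3 := cr 3 isT.
  have -> : \sum_(1 <= i < 4) value (iter i f x) =
      value (iter 1 f x) + value (iter 2 f x) + value (iter 3 f x).
    by rewrite big_nat_recr // big_nat_recr // big_nat1.
  rewrite !addnA [iter 1 f x]/= [iter 2 f x]/= [iter 3 f x]/=.
  move: c1 c2 c3; rewrite /= => c1 c2 c3.
  have a2 := asked_inner c1 c3.
  have r3 : requested (f (f (f x))) = false.
    by apply/negP=> /requested_crs[_]; rewrite e (negPf cx).
  have A1 : asked (f x) -> ~~ requested (f x).
    by case/askedP=> _ _ _ /(_ x c1 c2 c3 cx e)[/(_ (erefl _))].
  have A3 : asked (f (f (f x))) -> ~~ requested (f (f x)).
    by case/askedP=> _ _ _ /(_ x c1 c2 c3 cx e)[_ /(_ (erefl _))].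
  have BB : requested (f x) -> requested (f (f x)) -> gives x.
    by move=> b1 b2; rewrite /gives /bad cx c1 c2 c3 e eqxx b1 b2.
  have g0 : gives x + 8 <= value x by rewrite value_real // [_ + gives x]addnC -addnA leq_add2l leq_addr.
  have v1 := value_crs c1; have v2 := value_crs c2; have v3 := value_crs c3.
  by rewrite v1 v2 v3 a2 r3; apply: quad_count g0 A1 A3 BB.
(* One vertex corner and length at least five: only the two darts next to the vertex can lose a
   single unit, so the others keep 3. *)
rewrite big_ltn // big_nat_recr //= addnA addnA.
have c1 := cr 1 isT.
have hl : 4 <= value (iter m.+4 f x).
  apply: value_head; first by apply: cr; rewrite ltnSn.
  by rewrite -iterS e.
have h1 := value_ge2 (f x).
have hm : 3 * (m.+4 - 2) <= \sum_(2 <= j < m.+4) value (iter j f x).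
  rewrite mulnC -sum_nat_const_nat big_nat_cond [X in _ <= X]big_nat_cond.
  apply: leq_sum => j; rewrite andbT => /andP[j2 jm].
  case: j j2 jm => // j j2 jm; apply: value_inner; rewrite -?iterS; apply: cr.
  + by move: j2 jm; rewrite ltnS => -> /ltnW/ltnW jm; apply: leq_trans jm _.
  + by rewrite /= (ltn_trans jm).
  + by rewrite /= ltnS.
exact: leq_trans (long_count m) (leq_add (leq_add (leq_add h0 h1) hm) hl).
Qed.

(** Single units are taken only next to a vertex, so each dart keeps 3 and length seven suffices. A
    triangle would consist of three pairwise crossing edges, and requests pass through a
    quadrilateral. *)
Lemma fsum_ring x : (forall i, crs (iter i f x)) -> 20 <= fsum x.
Proof.
move=> cr; have e := iter_order face_inj x; have o3 := order_ge3 x.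
have na i : asked (iter i f x) = false.
  apply/negP=> /askedP[_ h _ _]; case: h => [|[z zE cz]].
    by rewrite -crs_face (cr i.+1).
  have zo : z = iter (i + (order f x).-1) f x.
    apply: face_inj; rewrite zE -iterS -addnS prednK ?order_gt0 //.
    by rewrite iterD e.
  by rewrite zo cr in cz.
have v i : value (iter i f x) = 5 + gives (iter i f x) - 2 * requested (iter i f x).
  by rewrite value_crs // na addn0.
have v3 i : 3 <= value (iter i f x) by rewrite v; apply: ring_count.
have c0 := cr 0; have c1 := cr 1; have c2 := cr 2; have c3 := cr 3.
have c4 := cr 4; have c5 := cr 5; rewrite /= in c0 c1 c2 c3 c4 c5.
rewrite /fsum; move: (order f x) e o3 => m.
case: m => [|[|[|[|[|[|[|m]]]]]]] // e _.
- have {}e : f (f (f x)) = x by [].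
  have x01 := cross_face c1; have x12 := cross_face c2.
  have x20 : cross (ed (f (f x))) (ed x) by rewrite -{2}e; apply: cross_face.
  have [w w0 w2] := cross_fan (crossC x01) x12.
  by case: (cross_disj x20 w2 w0).
- have {}e : f (f (f (f x))) = x by [].
  have q i : quad0 (iter i f x).
    elim: i => [|i IH]; last by rewrite iterS; apply: quad0_face.
    by rewrite /quad0 c0 c1 c2 c3 e eqxx.
  have h i : 5 <= value (iter i f x).
    rewrite v; have -> : requested (iter i f x) = false.
      by apply/negP=> /requestedP[_ _ _]; rewrite q.
    by rewrite subn0 leq_addr.
  rewrite -(mul1n 20) -[20]/(4 * 5) mul1n -[4]subn0 -sum_nat_const_nat.
  exact: leq_sum.
- have {}e : f (f (f (f (f x)))) = x by [].
  have p i : pent0 (iter i f x).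
    elim: i => [|i IH]; last by rewrite iterS; apply: pent0_face.
    by rewrite /pent0 c0 c1 c2 c3 c4 e eqxx.
  have h i : 5 + (requested (iter i f x) && requested (iter (i + 4) f x)) <=
      value (iter i f x) + 2 * requested (iter i f x).
    have : requested (iter i f x) && requested (iter (i + 4) f x) -> gives (iter i f x).
      rewrite addnC iterD => r; rewrite /gives /asks0 p.
      by case/andP: r => /= -> ->; rewrite orbT.
    by rewrite v; apply: corner_count.
  rewrite !big_nat_recr // big_nil /= add0n.
  have h0 := h 0; have h1 := h 1; have h2 := h 2; have h3 := h 3; have h4 := h 4.
  move: h0 h1 h2 h3 h4; rewrite /= !e.
  exact: pent_count.
- have {}e : f (f (f (f (f (f x))))) = x by [].
  rewrite !big_nat_recr // big_nil /= add0n.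
  have v0 := v 0; have v1 := v 1; have v2 := v 2; have v3' := v 3; have v4 := v 4.
  have v5 := v 5; rewrite /= in v0 v1 v2 v3' v4 v5.
  rewrite v0 v1 v2 v3' v4 v5.
  apply: hex_count; case h: (full6 x); last first.
    by left; move: h; rewrite /full6 /hex0 c0 c1 c2 c3 c4 c5 e eqxx /= => ->.
  have g y : full6 y -> 1 <= gives y by rewrite /gives /asks0 => ->; rewrite !orbT.
  by right; split; apply: g => //; apply: full6_face.
apply: (@leq_trans ((m.+4.+3 - 0) * 3)); first by rewrite subn0 (@leq_trans (7 * 3)) // leq_mul2r.
by rewrite -sum_nat_const_nat; apply: leq_sum.
Qed.

Lemma fsum_orbit x : fsum x = \sum_(y <- orbit f x) value y.
Proof.
rewrite /fsum /orbit; elim: (order f x) => [|n IH]; first by rewrite !big_nil.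
by rewrite big_nat_recr // IH trajectSr -cats1 big_cat big_seq1.
Qed.

Lemma fsum_connect x : fsum x = \sum_(y | fconnect f x y) value y.
Proof.
rewrite fsum_orbit big_uniq ?orbit_uniq //; apply: eq_bigl => y.
by rewrite fconnect_orbit.
Qed.

Lemma fsum_ge x : 20 <= fsum x.
Proof.
case: (boolP [exists y, fconnect f x y && ~~ crs y]) => [/existsP[y /andP[xy cy]]|].
  apply: leq_trans (fsum_ge1 cy) _; rewrite !fsum_connect; apply: eq_leq.
  by apply: eq_bigl => z; rewrite (same_connect (fconnect_sym face_inj) xy).
move/existsPn => h; apply: fsum_ring => i.
by have := h (iter i f x); rewrite fconnect_iter /= negbK.
Qed.

Lemma sum_fsum : \sum_(x in froots f) fsum x = \sum_d value d.
Proof.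
rewrite [RHS](partition_big (froot f) (mem (froots f))) /=; last first.
  by move=> x _; apply: roots_root; apply: fconnect_sym face_inj.
apply: eq_bigr => x rx; rewrite fsum_connect; apply: eq_bigl => y.
rewrite -(root_connect (fconnect_sym face_inj)) eq_sym.
by have /eqP -> : froot f x == x by [].
Qed.

Lemma sum_weight : \sum_d value d <= \sum_d weight d.
Proof.
have E : \sum_d value d + \sum_d debit d = \sum_d (weight d + gives d + 2 * tri1 d).
  by rewrite -big_split; apply: eq_bigr => d _; rewrite /= subnK // debit_le.
have S (p : pred D) : \sum_d (p d : nat) = #|p|
  by rewrite -sum1_card [RHS]big_mkcond; apply: eq_bigr => d _; rewrite unfold_in; case: (p d).
have S2 (p : pred D) : \sum_d (2 * p d) = 2 * #|p| by rewrite -S big_distrr.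
have E1 : \sum_d debit d = 2 * #|requested| + #|asked|.
  by rewrite -(S2 requested) -S -big_split.
have E2 : \sum_d (weight d + gives d + 2 * tri1 d) = \sum_d weight d + #|gives| + 2 * #|tri1|.
  by rewrite -(S2 tri1) -S -!big_split.
move: E; rewrite E1 E2.
by move/total_count; apply; [exact: card_gives | exact: card_tri1].
Qed.

Theorem faces_weight : 20 * #|froots f| <= \sum_d weight d.
Proof.
apply: leq_trans sum_weight; rewrite -sum_fsum mulnC -sum_nat_const.
apply: leq_sum => x _; exact: fsum_ge.
Qed.

(** Three vertex corners alone keep 8 + 8 + 8 units. *)
Theorem faces_weight_strict x y z : uniq [:: x; y; z] -> ~~ crs x -> ~~ crs y -> ~~ crs z ->
  fconnect f x y -> fconnect f x z -> 20 * #|froots f| + 4 <= \sum_d weight d.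
Proof.
move=> u cx cy cz xy xz; apply: leq_trans sum_weight; rewrite -sum_fsum.
have rx : froot f x \in froots f by apply: roots_root; apply: fconnect_sym face_inj.
rewrite (bigD1 (froot f x)) //= (cardD1 (froot f x)) rx mulnDr muln1 addnAC.
apply: leq_add.
  rewrite fsum_connect (eq_bigl (fconnect f x)); last first.
    move=> t; apply: (same_connect (fconnect_sym face_inj)).
    by rewrite (fconnect_sym face_inj) connect_root.
  move: u; rewrite /= !inE !negb_or !andbT => /andP[/andP[nxy nxz] nyz].
  rewrite (bigD1 x) ?connect0 //= (bigD1 y) ?xy 1?eq_sym //=.
  rewrite (bigD1 z) ?xz 1?[z == x]eq_sym 1?[z == y]eq_sym ?nxz //= !addnA.
  apply: leq_trans (leq_addr _ _).
  exact: (leq_add (leq_add (value_ge8 cx) (value_ge8 cy)) (value_ge8 cz)).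
rewrite mulnC -sum_nat_const [X in _ <= X](eq_bigl (mem [predD1 froots f & froot f x])).
  by apply: leq_sum => t _; apply: fsum_ge.
by move=> t; rewrite !inE andbC.
Qed.

End FanMap.

End Discharging.

(** * Euler's inequality from colourings of the faces *)

Module EulerInequality.

Section EulerFromColourings.
Variables (S : finType) (sg : S * bool -> S * bool).
Hypothesis sg_inj : injective sg.
Local Notation D := (S * bool)%type.
Definition flip (d : D) : D := (d.1, ~~ d.2).
Definition eface (d : D) : D := sg (flip d).
Local Notation f := eface.

(** The boundary modulo 2 of the chain [C] at the source of [d]. *)
Definition parity (C : S -> bool) (d : D) := \big[addb/false]_(y | fconnect sg d y) C y.1.

Variable O : {set D}.
Hypothesis O_roots : O \subset froots f.
Hypothesis colouring : forall C : S -> bool, (forall d, parity C d = false) ->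
  exists psi : D -> bool, [/\ forall d, psi (f d) = psi d,
    forall d, psi d (+) psi (flip d) = C d.1 & forall d, d \in O -> psi d = false].
Variable v0 : D.

(** Each segment is counted once for each of its two darts. *)
Lemma parity_total C : \big[addb/false]_(v in froots sg) parity C v = false.
Proof.
transitivity (\big[addb/false]_(d : D) C d.1).
  rewrite [RHS](partition_big (froot sg) (mem (froots sg))) /=; last first.
    by move=> x _; apply: roots_root; apply: fconnect_sym sg_inj.
  apply: eq_bigr => x rx; apply: eq_bigl => y.
  rewrite -(root_connect (fconnect_sym sg_inj)) eq_sym.
  by have /eqP -> : froot sg x == x by [].
rewrite -(pair_bigA _ (fun s b => C s)) /= big1 // => s _.
by rewrite big_bool /=; apply: addbb.
Qed.

Lemma parity_root C d : parity C (froot sg d) = parity C d.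
Proof.
apply: eq_bigl => y; apply: esym.
exact: (same_connect (fconnect_sym sg_inj) (connect_root _ d)).
Qed.

Lemma parity_add C C' d : parity (fun s => C s (+) C' s) d = parity C d (+) parity C' d.
Proof. by rewrite /parity big_split. Qed.

Local Notation r0 := (froot sg v0).
(** One node is left out because its parity follows from the others by [parity_total]; this is the 1
    in the final inequality. *)
Let Vt := {v : D | (v \in froots sg) && (v != r0)}.
Let Ft := {v : D | (v \in froots f) && (v \notin O)}.
Let delta (C : {ffun S -> bool}) : {ffun Vt -> bool} := [ffun v => parity C (val v)].

Lemma delta0 C C' : delta C = delta C' -> forall d, parity (fun s => C s (+) C' s) d = false.
Proof.
move=> e; have h v : v \in froots sg -> v != r0 -> parity C v = parity C' v.
  move=> rv nv; have vP : (v \in froots sg) && (v != r0) by rewrite rv.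
  by have /ffunP/(_ (exist _ v vP)) := e; rewrite !ffunE.
have r0r : r0 \in froots sg by apply: roots_root; apply: fconnect_sym sg_inj.
have h0 : parity C r0 = parity C' r0.
  have := parity_total C; have := parity_total C'.
  rewrite (bigD1 r0) //= [in X in _ -> X](bigD1 r0) //=.
  rewrite (eq_bigr (fun v => parity C v)) => [|v /andP[rv nv]]; last by rewrite h.
  by case: (parity C r0); case: (parity C' r0); case: (\big[addb/false]_(_ in _ | _) _).
move=> d; rewrite parity_add -parity_root -[parity C' d]parity_root.
case: (eqVneq (froot sg d) r0) => [->|n]; first by rewrite h0 addbb.
by rewrite h ?addbb //; apply: roots_root; apply: fconnect_sym sg_inj.
Qed.

Let Z := [set C : {ffun S -> bool} | [forall d, parity C d == false]].

(** Adding a fixed member [C0] maps a fibre of [delta] injectively into the cycles. *)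
Lemma card_fibres : #|{ffun S -> bool}| <= #|Z| * #|{ffun Vt -> bool}|.
Proof.
rewrite -[#|{ffun S -> bool}|]sum1_card (partition_big delta predT) //=.
rewrite mulnC -sum_nat_const; apply: leq_sum => y _.
case: (pickP (fun C => delta C == y)) => [C0 /eqP C0y|n0]; last first.
  by rewrite big1 // => C; rewrite n0.
rewrite sum1_card -(card_imset (f := fun C : {ffun S -> bool} => [ffun s => C s (+) C0 s])).
  apply: subset_leq_card; apply/subsetP=> C' /imsetP[C Cy ->].
  rewrite inE; apply/forallP=> d; apply/eqP.
  have e0 : delta C = delta C0 by rewrite C0y; apply/eqP; exact: Cy.
  rewrite -[RHS](delta0 e0 d).
  by apply: eq_bigr => s _; rewrite ffunE.
move=> C C' /ffunP e; apply/ffunP=> s; have := e s; rewrite !ffunE.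
exact: addIb.
Qed.

(** A cycle is recovered from its colouring, and the colouring from its values at the face roots
    outside [O]. *)
Lemma card_cycles : #|Z| <= #|{ffun Ft -> bool}|.
Proof.
have /fin_all_exists[psi psiP] : forall C : {ffun S -> bool}, exists p : {ffun D -> bool},
    C \in Z -> [/\ forall d, p (f d) = p d,
      forall d, p d (+) p (flip d) = C d.1 & forall d, d \in O -> p d = false].
  move=> C; case CZ: (C \in Z); last by exists [ffun=> false].
  have [|p [p1 p2 p3]] := @colouring C.
    by move: CZ; rewrite inE => /forallP h d; apply/eqP.
  exists (finfun p) => _; split=> [d|d|d dO]; rewrite !ffunE.
  - exact: p1.
  - exact: p2.
  - exact: p3.
rewrite -(card_in_imset (f := fun C => [ffun v : Ft => psi C (val v)])).
  exact: max_card.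
move=> C C' CZ CZ' /ffunP e; apply/ffunP=> s.
have [p1 p2 p3] := psiP C CZ; have [q1 q2 q3] := psiP C' CZ'.
have finj : injective f by move=> x y /sg_inj; case: x y => [a b] [c d] [-> /negb_inj ->].
have rt (p : D -> bool) (pf : forall d, p (f d) = p d) d : p d = p (froot f d).
  have /iter_findex <- : fconnect f d (froot f d) := connect_root _ d.
  by elim: findex => //= n ->; rewrite pf.
have h d : psi C d = psi C' d.
  rewrite (rt _ p1) (rt _ q1); case dO: (froot f d \in O); first by rewrite p3 // q3.
  have vP : (froot f d \in froots f) && (froot f d \notin O).
    by rewrite dO andbT; apply: roots_root; apply: fconnect_sym finj.
  by have := e (Sub (froot f d) vP); rewrite !ffunE.
by rewrite -(p2 (s, true)) -(q2 (s, true)) !h.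
Qed.

(** The two counts give 2^S <= 2^(F - O) 2^(V - 1), with the letters standing for the cardinals. *)
Theorem euler_colourings : #|S| + 1 + #|O| <= #|froots f| + #|froots sg|.
Proof.
have := leq_trans card_fibres (leq_mul card_cycles (leqnn _)).
rewrite !card_ffun card_bool -expnD leq_exp2l // => h.
have cV : #|{: Vt}| + 1 = #|froots sg|.
  have r0r : r0 \in froots sg by apply: roots_root; apply: fconnect_sym sg_inj.
  rewrite card_sig [RHS](cardD1 r0) r0r addn1 add1n.
  by congr _.+1; apply: eq_card => v; rewrite !inE andbC.
have cF : #|{: Ft}| + #|O| = #|froots f|.
  rewrite card_sig -(cardID (mem O) (froots f)) addnC; congr (_ + _).
    apply: eq_card => v; rewrite !inE; case vO: (v \in O); rewrite ?andbF ?andbT //.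
    by apply/esym; apply: (subsetP O_roots).
  by apply: eq_card => v; rewrite !inE andbC.
by rewrite -cV -cF addnACA -addnA [1 + _]addnC leq_add2r.
Qed.

End EulerFromColourings.

End EulerInequality.

(** * Two-colouring the complement of plane segments by the parity above a point *)

Module SegmentColouring.
Import Order.TTheory GRing.Theory Num.Theory.
Local Open Scope ring_scope.

Lemma big_addb_pred (I : finType) (P Q F : pred I) :
  \big[addb/false]_(i | P i) F i (+) \big[addb/false]_(i | Q i) F i =
  \big[addb/false]_(i | P i (+) Q i) F i.
Proof.
rewrite (big_mkcond P) (big_mkcond Q) [RHS]big_mkcond.
transitivity (\big[addb/false]_i ((if P i then F i else false) (+) (if Q i then F i else false))).
  by rewrite big_split.
by apply: eq_bigr => i _; case: (P i); case: (Q i); rewrite /= ?addbb ?addbF.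
Qed.

Lemma big_addb_pair (I : finType) (P : pred (I * bool)) (F : pred I) :
  \big[addb/false]_(d | P d) F d.1 =
  \big[addb/false]_(i | P (i, true)) F i (+) \big[addb/false]_(i | P (i, false)) F i.
Proof.
transitivity (\big[addb/false]_(d : I * bool) (if P (d.1, d.2) then F d.1 else false)).
  by rewrite big_mkcond; apply: eq_bigr => -[].
rewrite -(pair_bigA _ (fun i b => if P (i, b) then F i else false)) /=.
rewrite (big_mkcond (fun i => P (i, true))) (big_mkcond (fun i => P (i, false))).
transitivity (\big[addb/false]_i ((if P (i, true) then F i else false)
    (+) (if P (i, false) then F i else false))); last by rewrite big_split.
by apply: eq_bigr => i _; rewrite big_bool.
Qed.

Section SegmentColouring.
Variables (R : realFieldType) (U : finType) (lp rp : U -> R * R).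
Implicit Types (u v : U) (w : R * R) (x : R).

Definition slope u := ((rp u).2 - (lp u).2) / ((rp u).1 - (lp u).1).
Definition height u x := (lp u).2 + slope u * (x - (lp u).1).

Hypothesis lp_rp : forall u, (lp u).1 < (rp u).1.
Hypothesis ll_eq : forall u v, (lp u).1 = (lp v).1 -> lp u = lp v.
Hypothesis rr_eq : forall u v, (rp u).1 = (rp v).1 -> rp u = rp v.
(** Closed range for [u], open range for [v]: segments may share endpoints, but no endpoint lies
    inside another segment. *)
Hypothesis planar : forall u v x, u != v -> (lp u).1 <= x <= (rp u).1 ->
  (lp v).1 < x < (rp v).1 -> height u x != height v x.

Variable C : U -> bool.
Hypothesis even : forall w,
  \big[addb/false]_(u | lp u == w) C u = \big[addb/false]_(u | rp u == w) C u.

Lemma height_lp u : height u (lp u).1 = (lp u).2.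
Proof. by rewrite /height subrr mulr0 addr0. Qed.

Lemma height_rp u : height u (rp u).1 = (rp u).2.
Proof.
have := lp_rp u; rewrite -subr_gt0 => h.
by rewrite /height /slope divfK ?gt_eqF // addrC subrK.
Qed.

Lemma height_slope u x y : height u y = height u x + slope u * (y - x).
Proof. rewrite /height; ring. Qed.

Definition over v w := [&& (lp v).1 < w.1, w.1 < (rp v).1 & w.2 < height v w.1].
Definition up w := \big[addb/false]_(v | over v w) C v.
(** The parity of [C] just above [u] near its left end: a segment leaving the same point counts if
    it is steeper. At the right end the comparison of slopes is reversed. *)
Definition above_lp u :=
  up (lp u) (+) \big[addb/false]_(v | (lp v == lp u) && (slope u < slope v)) C v.
Definition above_rp u :=
  up (rp u) (+) \big[addb/false]_(v | (rp v == rp u) && (slope v < slope u)) C v.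

Definition strip u w := [&& (lp u).1 < w.1, w.1 < (rp u).1 & height u w.1 < w.2].

Lemma planarC u v x : u != v -> (lp u).1 <= x <= (rp u).1 ->
  (lp v).1 <= x <= (rp v).1 -> ((lp u).1 < x < (rp u).1) || ((lp v).1 < x < (rp v).1) ->
  height u x != height v x.
Proof.
move=> uv xu xv /orP[h|h]; last exact: planar.
by rewrite eq_sym; apply: planar; rewrite 1?eq_sym.
Qed.

(** The intermediate value theorem for two affine functions, with an explicit common point. *)
Lemma same_sign u v l m : u != v -> l < m ->
  (forall x, l <= x <= m -> height u x != height v x) ->
  (height u l < height v l) = (height u m < height v m).
Proof.
move=> uv lm nz; have nl : height u l != height v l by apply: nz; rewrite lexx ltW.
have nm : height u m != height v m by apply: nz; rewrite lexx ltW.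
apply/idP/idP => [hl|hm]; apply: contraT; rewrite -leNgt le_eqVlt eq_sym.
- rewrite (negPf nm) /= => hm.
  set D := height v l - height u l; set D' := height u m - height v m.
  have D0 : 0 < D by rewrite subr_gt0.
  have D'0 : 0 < D' by rewrite subr_gt0.
  have DD : 0 < D + D' by rewrite addr_gt0.
  (* The zero of the difference, which runs linearly from [D] at [l] to [- D'] at [m]. *)
  pose x := l + D / (D + D') * (m - l).
  have t0 : 0 <= D / (D + D') by rewrite divr_ge0 // ltW.
  have t1 : D / (D + D') <= 1 by rewrite ler_pdivrMr // mul1r lerDl ltW.
  have /nz/eqP : l <= x <= m by rewrite /x; apply/andP; split; nra.
  case; rewrite (height_slope u l) (height_slope v l).
  have e : (slope u - slope v) * (m - l) = D' + D.
    by rewrite /D /D' (height_slope u l) (height_slope v l); ring.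
  have -> : height v l = height u l + D by rewrite /D; ring.
  have -> : slope u * (x - l) = slope v * (x - l) + D / (D + D') * ((slope u - slope v) * (m - l)).
    by rewrite /x; ring.
  by rewrite e; field; rewrite gt_eqF.
- rewrite (negPf nl) /= => hl.
  set D := height u l - height v l; set D' := height v m - height u m.
  have D0 : 0 < D by rewrite subr_gt0.
  have D'0 : 0 < D' by rewrite subr_gt0.
  have DD : 0 < D + D' by rewrite addr_gt0.
  pose x := l + D / (D + D') * (m - l).
  have t0 : 0 <= D / (D + D') by rewrite divr_ge0 // ltW.
  have t1 : D / (D + D') <= 1 by rewrite ler_pdivrMr // mul1r lerDl ltW.
  have /nz/eqP : l <= x <= m by rewrite /x; apply/andP; split; nra.
  case; rewrite (height_slope u l) (height_slope v l).
  have e : (slope v - slope u) * (m - l) = D' + D.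
    by rewrite /D /D' (height_slope u l) (height_slope v l); ring.
  have -> : height u l = height v l + D by rewrite /D; ring.
  have -> : slope v * (x - l) = slope u * (x - l) + D / (D + D') * ((slope v - slope u) * (m - l)).
    by rewrite /x; ring.
  by rewrite e; field; rewrite gt_eqF.
Qed.

Definition lmid u v := (Num.max (lp u).1 (lp v).1 + Num.min (rp u).1 (rp v).1) / 2%:R.

Lemma lmid_bounds u v : (lp v).1 < (rp u).1 -> (lp u).1 < (rp v).1 -> let m := lmid u v in
  [/\ (lp u).1 < m, m < (rp u).1, (lp v).1 < m & m < (rp v).1].
Proof.
move=> h1 h2; have hu := lp_rp u; have hv := lp_rp v; rewrite /lmid.
case: (ltP (lp u).1 (lp v).1) => h3; case: (ltP (rp u).1 (rp v).1) => h4; split; lra.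
Qed.

(** The three terms exclude each other: the further left end decides, or the slopes if the left ends
    agree. From that end [same_sign] carries the order of the two segments to [lmid]. *)
Lemma left_end u v : u != v -> (lp v).1 < (rp u).1 -> (lp u).1 < (rp v).1 ->
  over v (lp u) (+) ((lp v == lp u) && (slope u < slope v)) (+) strip u (lp v)
  = (height u (lmid u v) < height v (lmid u v)).
Proof.
move=> uv h1 h2; have [m1 m2 m3 m4] := lmid_bounds h1 h2.
set m := lmid u v in m1 m2 m3 m4 *.
rewrite /over /strip; case: (ltgtP (lp v).1 (lp u).1) => [h|h|h].
- have -> : (lp v == lp u) = false by apply/eqP=> e; rewrite e ltxx in h.
  rewrite h2 /= !addbF -height_lp; apply: same_sign => // x /andP[x1 x2].
  apply: planarC; rewrite // ?x1 /=; first by apply/ltW/(le_lt_trans x2).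
    by rewrite (ltW (lt_le_trans h x1)) ltW // (le_lt_trans x2).
  by apply/orP; right; rewrite (lt_le_trans h x1) (le_lt_trans x2).
- have -> : (lp v == lp u) = false by apply/eqP=> e; rewrite e ltxx in h.
  rewrite h1 /= -[(lp v).2]height_lp; apply: same_sign => // x /andP[x1 x2].
  apply: planarC; rewrite // ?x1 /=.
  + by rewrite (ltW (lt_le_trans h x1)) ltW // (le_lt_trans x2).
  + by apply/ltW/(le_lt_trans x2).
  + by apply/orP; left; rewrite (lt_le_trans h x1) (le_lt_trans x2).
rewrite /= (ll_eq h) eqxx addbF /= (height_slope u (lp u).1) (height_slope v (lp u).1).
rewrite height_lp -[in X in _ = (_ < X + _)](ll_eq h) -{2}h height_lp (ll_eq h) ltrD2l.
by rewrite ltr_pM2r // subr_gt0.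
Qed.

Lemma right_end u v : u != v -> (lp v).1 < (rp u).1 -> (lp u).1 < (rp v).1 ->
  over v (rp u) (+) ((rp v == rp u) && (slope v < slope u)) (+) strip u (rp v)
  = (height u (lmid u v) < height v (lmid u v)).
Proof.
move=> uv h1 h2; have [m1 m2 m3 m4] := lmid_bounds h1 h2.
set m := lmid u v in m1 m2 m3 m4 *.
rewrite /over /strip; case: (ltgtP (rp u).1 (rp v).1) => [h|h|h].
- have -> : (rp v == rp u) = false by apply/eqP=> e; rewrite e ltxx in h.
  rewrite h1 /= andbF !addbF -height_rp; apply/esym; apply: same_sign => // x /andP[x1 x2].
  apply: planarC; rewrite // ?x2 ?andbT /=.
  + by apply/ltW/(lt_le_trans m1).
  + by rewrite (ltW (le_lt_trans x2 h)) ltW // (lt_le_trans m3).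
  + by apply/orP; right; rewrite (le_lt_trans x2 h) (lt_le_trans m3).
- have -> : (rp v == rp u) = false by apply/eqP=> e; rewrite e ltxx in h.
  rewrite h2 /= andbF -[(rp v).2]height_rp; apply/esym; apply: same_sign => // x /andP[x1 x2].
  apply: planarC; rewrite // ?x2 ?andbT /=.
  + by rewrite (ltW (le_lt_trans x2 h)) ltW // (lt_le_trans m1).
  + by apply/ltW/(lt_le_trans m3).
  + by apply/orP; left; rewrite (le_lt_trans x2 h) (lt_le_trans m1).
rewrite /= !andbF (rr_eq h) eqxx addbF /= (height_slope u (rp u).1) (height_slope v (rp u).1).
rewrite height_rp {2}h height_rp (rr_eq h) ltrD2l.
by rewrite ltr_nM2r // subr_lt0 -(rr_eq h).
Qed.

(** Between the two ends of [u], the segment [v] begins or ceases to count as lying above [u]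
    exactly at an end of [v] above [u]. If the ranges overlap, both ends of [u] are compared with
    the order at [lmid]; otherwise every term is false. *)
Lemma strip_ends u v : u != v ->
  over v (lp u) (+) ((lp v == lp u) && (slope u < slope v)) (+)
  (over v (rp u) (+) ((rp v == rp u) && (slope v < slope u)))
  = strip u (lp v) (+) strip u (rp v).
Proof.
move=> uv; case: (ltP (lp v).1 (rp u).1) => h1; last first.
  have hv := lp_rp v; have hu := lp_rp u.
  have hpp := lt_le_trans hu h1; have hqq := le_lt_trans h1 hv.
  rewrite /over /strip !(ltNge _ (lp u).1) (ltW hpp) /=.
  rewrite (ltNge (lp v).1 (rp u).1) h1 /= (ltNge (rp v).1) (ltW hqq) /= !andbF.
  have -> : (lp v == lp u) = false by apply/eqP=> e; rewrite e ltxx in hpp.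
  by have -> : (rp v == rp u) = false by apply/eqP=> e; rewrite e ltxx in hqq.
case: (ltP (lp u).1 (rp v).1) => h2; last first.
  have hv := lp_rp v; have hu := lp_rp u.
  have hpp := lt_le_trans hv h2; have hqq := le_lt_trans h2 hu.
  rewrite /over /strip (ltNge _ (lp v).1) (ltW hpp) /= (ltNge (lp u).1 (rp v).1) h2 /=.
  rewrite (ltNge (rp u).1 (rp v).1) (ltW hqq) /= !andbF.
  have -> : (lp v == lp u) = false by apply/eqP=> e; rewrite e ltxx in hpp.
  by have -> : (rp v == rp u) = false by apply/eqP=> e; rewrite e ltxx in hqq.
have := left_end uv h1 h2; rewrite -(right_end uv h1 h2).
by do 2!case: (over v _); do 2!case: (_ && _); do 2!case: (strip u _).
Qed.

Lemma sum_points (F : U -> R * R) (P : pred (R * R)) (s : seq (R * R)) : uniq s ->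
  (forall v, F v \in s) ->
  \big[addb/false]_(v | P (F v)) C v =
  \big[addb/false]_(w <- s | P w) \big[addb/false]_(v | F v == w) C v.
Proof.
move=> us Fs; rewrite (exchange_big_dep predT) //= big_mkcond; apply: eq_bigr => v _.
rewrite (eq_bigl (fun w => (w == F v) && P w)); last by move=> w; rewrite andbC eq_sym.
rewrite big_mkcond (bigD1_seq (F v)) //= eqxx /= big1 ?addbF // => w /negPf ->.
by [].
Qed.

(** After grouping by endpoints, [even] applies at each point of the strip. *)
Lemma strip_sum u : \big[addb/false]_(v | strip u (lp v)) C v =
  \big[addb/false]_(v | strip u (rp v)) C v.
Proof.
pose s := undup ([seq lp v | v <- enum U] ++ [seq rp v | v <- enum U]).
rewrite !(@sum_points _ _ s) ?undup_uniq //; first by apply: eq_bigr => w _; apply: even.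
  by move=> v; rewrite mem_undup mem_cat map_f ?orbT // mem_enum.
by move=> v; rewrite mem_undup mem_cat map_f // mem_enum.
Qed.

Lemma over_self u w : w = lp u \/ w = rp u -> over u w = false /\ strip u w = false.
Proof. by rewrite /over /strip; case=> ->; rewrite ltxx /= ?andbF. Qed.

(** The parity above [u] is constant along [u]: it changes only at ends of segments in the strip
    above [u], and these cancel by [strip_sum]. *)
Lemma above_eq u : above_lp u = above_rp u.
Proof.
suff : above_lp u (+) above_rp u = false by case: above_lp; case: above_rp.
rewrite /above_lp /above_rp /up !big_addb_pred.
rewrite (eq_bigl (fun v => strip u (lp v) (+) strip u (rp v))).
  by rewrite -big_addb_pred strip_sum addbb.
move=> v; case: (eqVneq u v) => [<-|uv]; last exact: strip_ends.
have [-> ->] := @over_self u (lp u) (or_introl (erefl _)).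
have [-> ->] := @over_self u (rp u) (or_intror (erefl _)).
by rewrite ltxx !andbF.
Qed.

(* Darts: [(u, true)] leaves [lp u], [(u, false)] leaves [rp u]; around a point the
   counterclockwise order from the downward direction is lexicographic in side and slope. *)
Definition tail (d : U * bool) := if d.2 then lp d.1 else rp d.1.
Definition angle_le (d' d : U * bool) :=
  if d'.2 == d.2 then slope d'.1 <= slope d.1 else d'.2.

(** The dart [(u, true)] runs to the right and has the upper side of [u] on its left; [(u, false)]
    has the lower side there. *)
Definition left_colour (d : U * bool) :=
  if d.2 then above_lp d.1 else above_rp d.1 (+) C d.1.

(** The parity just to the right of [w] and below all segments leaving it to the right, that is, in
    the downward direction where the angular order begins. *)
Definition right_parity w := up w (+) \big[addb/false]_(v | lp v == w) C v.

Lemma left_colour_flip d : left_colour d (+) left_colour (d.1, ~~ d.2) = C d.1.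
Proof.
case: d => u [] /=; rewrite /left_colour /= above_eq; first by rewrite addbA addbb.
by rewrite addbAC addbb.
Qed.

Lemma rp_slope_inj u v : rp v = rp u -> slope v = slope u -> v = u.
Proof.
move=> e es; apply/eqP; rewrite eq_sym; apply: contraT => uv.
have h1 : (lp v).1 < (rp u).1 by rewrite -e.
have h2 : (lp u).1 < (rp v).1 by rewrite e.
have [m1 m2 m3 m4] := lmid_bounds h1 h2.
have := @planar u v (lmid u v) uv; rewrite m3 m4 !ltW // => /(_ isT isT)/eqP[].
rewrite (height_slope u (rp u).1) (height_slope v (rp v).1) !height_rp.
by rewrite e es.
Qed.

(** Turning counterclockwise from the downward direction, the colour changes at each dart passed
    that belongs to [C], up to and including [d]. *)
Lemma left_colour_sum d : left_colour d = right_parity (tail d) (+)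
  \big[addb/false]_(d' | (tail d' == tail d) && angle_le d' d) C d'.1.
Proof.
rewrite big_addb_pair /angle_le /tail /left_colour /right_parity; case: d => u [] /=.
  rewrite [X in _ (+) (_ (+) X)]big1 => [|v]; last by rewrite andbF.
  rewrite addbF /above_lp -addbA; congr addb.
  rewrite (bigID (fun v => slope u < slope v) (fun v => lp v == lp u)) /= -addbA.
  rewrite [X in _ = _ (+) (X (+) _)](eq_bigl (fun v => (lp v == lp u) && (slope v <= slope u))).
    by rewrite addbb addbF.
  by move=> v; rewrite -leNgt.
rewrite [X in _ = _ (+) (X (+) _)](eq_bigl (fun v => lp v == rp u)) => [|v]; last by rewrite andbT.
rewrite -addbA [X in _ = _ (+) X]addbA addbb /= /above_rp -addbA; congr addb.
rewrite [RHS](bigD1 u) /= ?eqxx ?lexx // addbC; congr addb.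
apply: eq_bigl => v; rewrite lt_neqAle -andbA; case: eqP => //= e.
rewrite andbC; congr andb; congr negb; apply/eqP/eqP => [es|->] //.
exact: rp_slope_inj.
Qed.

End SegmentColouring.

End SegmentColouring.

(** * Rotations obtained from an order of the darts at each node *)

Module Rotations.

Section Rotation.
Variables (D : finType) (N : eqType) (src : D -> N) (le : rel D).
Hypothesis le_trans : transitive le.
Hypothesis le_total : total le.
Hypothesis le_anti : forall x y, src x = src y -> le x y -> le y x -> x = y.

Definition around x := sort le [seq y <- enum D | src y == src x].
Definition rot_next x := next (around x) x.
Local Notation sg := rot_next.

Lemma mem_around x y : (y \in around x) = (src y == src x).
Proof. by rewrite mem_sort mem_filter mem_enum andbT. Qed.

Lemma uniq_around x : uniq (around x).
Proof. by rewrite sort_uniq filter_uniq // enum_uniq. Qed.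

Lemma around_eq x y : src x = src y -> around x = around y.
Proof. by rewrite /around => ->. Qed.

Lemma src_rot x : src (sg x) = src x.
Proof. by apply/eqP; rewrite -mem_around mem_next mem_around. Qed.

Lemma rot_inj : injective sg.
Proof.
move=> x y e; have s : src x = src y by rewrite -src_rot e src_rot.
apply: (can_inj (prev_next (uniq_around x))).
by rewrite -/(sg x) e /sg (around_eq s).
Qed.

Lemma rot_cycle x : fcycle sg (around x).
Proof.
have E : {in around x &, frel (next (around x)) =2 frel sg}.
  move=> y z; rewrite !mem_around => /eqP sy _; rewrite /= /sg.
  by rewrite (around_eq sy).
by rewrite -(eq_in_cycle E) ?cycle_next ?uniq_around //; apply/allP.
Qed.

Lemma rot_connect x y : fconnect sg x y = (src x == src y).
Proof.
have xx : x \in around x by rewrite mem_around.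
by rewrite (fconnect_cycle (rot_cycle x) xx) mem_around eq_sym.
Qed.

Lemma around_sorted x : sorted le (around x).
Proof. exact: sort_sorted. Qed.

Lemma le_index x y z : y \in around x -> z \in around x ->
  le y z = (index y (around x) <= index z (around x)).
Proof.
move=> yx zx; have lt a b : a \in around x -> b \in around x ->
    index a (around x) <= index b (around x) -> le a b.
  move=> ax bx; rewrite leq_eqVlt => /orP[/eqP e|h].
    have -> : a = b by rewrite -(nth_index a ax) e nth_index.
    by have := le_total b b; rewrite orbb.
  have := sorted_ltn_nth le_trans a (around_sorted x).
  by move=> /(_ (index a (around x)) (index b (around x))); rewrite !inE !index_mem !nth_index //; apply.
apply/idP/idP; last exact: lt.
rewrite leqNgt => h; apply/negP => i.
have e : y = z.
  apply: le_anti => //; last by apply: lt => //; apply: ltnW.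
  by move: yx zx; rewrite !mem_around => /eqP -> /eqP ->.
by rewrite e ltnn in i.
Qed.

Lemma rot_nth x i x0 : i.+1 < size (around x) ->
  sg (nth x0 (around x) i) = nth x0 (around x) i.+1.
Proof.
move=> h; have hi := ltnW h; have mi := mem_nth x0 hi.
rewrite /sg (@around_eq _ x); last by apply/eqP; rewrite -mem_around.
rewrite next_nth mi; case E: (around x) h hi mi => [|a s] // h hi mi.
rewrite index_uniq //; last by rewrite -E uniq_around.
by rewrite /= (set_nth_default x0).
Qed.

Lemma rot_last x x0 : sg (nth x0 (around x) (size (around x)).-1) = nth x0 (around x) 0.
Proof.
have xx : x \in around x by rewrite mem_around.
have h0 : 0 < size (around x) by case: (around x) xx.
have hl : (size (around x)).-1 < size (around x) by rewrite prednK.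
have mi := mem_nth x0 hl.
rewrite /sg (@around_eq _ x); last by apply/eqP; rewrite -mem_around.
rewrite next_nth mi; case E: (around x) hl mi => [|a s] // hl mi.
rewrite index_uniq //; last by rewrite -E uniq_around.
by rewrite /= nth_default.
Qed.

Definition below (C : D -> bool) x :=
  \big[addb/false]_(y | (src y == src x) && le y x) C y.

Lemma around_sum (C : D -> bool) x :
  \big[addb/false]_(y | src y == src x) C y = \big[addb/false]_(y <- around x) C y.
Proof.
by rewrite [RHS]big_uniq ?uniq_around //; apply: eq_bigl => y; rewrite mem_around.
Qed.

Lemma below_take C x : below C x =
  \big[addb/false]_(y <- take (index x (around x)).+1 (around x)) C y.
Proof.
rewrite [RHS]big_uniq ?take_uniq ?uniq_around //; apply: eq_bigl => y.
have xx : x \in around x by rewrite mem_around.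
case yx: (src y == src x) => /=; last first.
  by apply/esym/negP=> /mem_take; rewrite mem_around yx.
have yx' : y \in around x by rewrite mem_around.
by rewrite in_take // (le_index yx' xx) ltnS.
Qed.

(** At the wrap-around the sum up to [x] is the whole sum, which vanishes, and the sum up to [sg x]
    is [C (sg x)] alone. *)
Lemma below_next C x : \big[addb/false]_(y | src y == src x) C y = false ->
  below C x (+) below C (sg x) = C (sg x).
Proof.
rewrite around_sum !below_take (around_eq (src_rot x)) => total.
set s := around x in total *; have xs : x \in s by rewrite mem_around.
have us : uniq s := uniq_around x.
have xE : x = nth x s (index x s) by rewrite nth_index.
have isz : index x s < size s by rewrite index_mem.
case: (ltnP (index x s).+1 (size s)) => h.
  have -> : sg x = nth x s (index x s).+1 by rewrite {1}xE rot_nth.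
  rewrite index_uniq // (take_nth x h) -cats1 big_cat big_seq1 /=.
  by rewrite addbA addbb.
have e : (size s).-1 = index x s by move: isz h; case: (size s) => // n; rewrite !ltnS => i1 i2; apply/eqP; rewrite eqn_leq i1 i2.
have -> : sg x = nth x s 0 by rewrite {1}xE -e rot_last.
rewrite take_oversize // total addFb.
case: s xs us {xE isz h e total} => [|a s] // _ _.
by rewrite /= eqxx take0 big_seq1.
Qed.

Lemma rot_succ x y : src y = src x -> y <> x -> le x y ->
  (forall z, src z = src x -> le x z -> z <> x -> le y z) -> sg x = y.
Proof.
move=> sy yx lxy h; have xs : x \in around x by rewrite mem_around.
have ys : y \in around x by rewrite mem_around sy.
have ixy : index x (around x) < index y (around x).
  rewrite ltn_neqAle -le_index // lxy andbT; apply/eqP=> e; apply: yx.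
  by rewrite -(nth_index x ys) -e nth_index.
have h1 : (index x (around x)).+1 < size (around x).
  by apply: leq_ltn_trans ixy _; rewrite index_mem.
have E : sg x = nth x (around x) (index x (around x)).+1.
  by rewrite -{1}(nth_index x xs) rot_nth.
have sz : src (sg x) = src x := src_rot x.
have ss : sg x \in around x by rewrite mem_around sz.
have ixs : index (sg x) (around x) = (index x (around x)).+1.
  by rewrite E index_uniq ?uniq_around.
apply: le_anti; rewrite ?sz ?sy //; first by rewrite (le_index ss ys) ixs.
apply: h => //; first by rewrite (le_index xs ss) ixs.
by move=> e; have := n_Sn (index x (around x)); rewrite -ixs e.
Qed.

Lemma rot_wrap x y : src y = src x -> (forall z, src z = src x -> le z x) ->
  (forall z, src z = src x -> le y z) -> sg x = y.
Proof.
move=> sy hx hy; have xs : x \in around x by rewrite mem_around.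
have ys : y \in around x by rewrite mem_around sy.
have h0 : 0 < size (around x) by case: (around x) xs.
have hl : (size (around x)).-1 < size (around x) by rewrite prednK.
have xE : x = nth x (around x) (size (around x)).-1.
  have m := mem_nth x hl; move: (m); rewrite mem_around => /eqP sm.
  apply: le_anti => //.
    by rewrite (le_index xs m) index_uniq ?uniq_around // -ltnS prednK // index_mem.
  exact: hx.
rewrite {1}xE rot_last; have m := mem_nth x h0; move: (m); rewrite mem_around => /eqP sm.
apply: le_anti; rewrite ?sm ?sy //; last by apply: hy.
by rewrite (le_index m ys) index_uniq ?uniq_around.
Qed.

Lemma rot_four x1 x2 x3 x4 : src x2 = src x1 -> src x3 = src x1 -> src x4 = src x1 ->
  uniq [:: x1; x2; x3; x4] -> le x1 x2 -> le x2 x3 -> le x3 x4 ->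
  (forall z, src z = src x1 -> z \in [:: x1; x2; x3; x4]) ->
  [/\ sg x1 = x2, sg x2 = x3, sg x3 = x4 & sg x4 = x1].
Proof.
move=> s2 s3 s4; rewrite /= !inE !negb_or => /and4P[/and3P[n12 n13 n14] /andP[n23 n24] n34 _].
move=> l12 l23 l34 all4; have l13 := le_trans l12 l23; have l24 := le_trans l23 l34.
have l14 := le_trans l12 l24; have lx x : le x x by have := le_total x x; rewrite orbb.
have anti x y : src x = src y -> x != y -> le x y -> ~~ le y x.
  by move=> sxy ne lxy; apply: contra ne => lyx; apply/eqP; apply: le_anti.
have all4' z : src z = src x1 -> [\/ z = x1, z = x2, z = x3 | z = x4].
  by move=> /all4; rewrite !inE => /or4P[]/eqP ->; [constructor 1|constructor 2|constructor 3|constructor 4].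
split.
- apply: rot_succ => //; first by apply/eqP; rewrite eq_sym.
  by move=> z sz _ nz; case: (all4' z sz) nz => -> //.
- apply: rot_succ; rewrite ?s2 ?s3 //; first by apply/eqP; rewrite eq_sym.
  move=> z sz lz nz; case: (all4' z sz) nz lz => -> // _ lz.
  by have := anti x1 x2 (esym s2) n12 l12; rewrite lz.
- apply: rot_succ; rewrite ?s3 ?s4 //; first by apply/eqP; rewrite eq_sym.
  move=> z sz lz nz; case: (all4' z sz) nz lz => -> // _ lz.
    by have := anti x1 x3 (esym s3) n13 l13; rewrite lz.
  by have := anti x2 x3 (etrans s2 (esym s3)) n23 l23; rewrite lz.
- by apply: rot_wrap; rewrite ?s4 // => z sz; case: (all4' z sz) => ->.
Qed.

End Rotation.

End Rotations.

(** * The edge bound for polygonal drawings *)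

Module PolygonalBound.
Import Discharging EulerInequality SegmentColouring Rotations.
Import Order.TTheory GRing.Theory Num.Theory.
Local Open Scope ring_scope.

Section Cells.
Variables (I : finType) (n : I -> nat).
(** The pairs [(e, i)] with [i < n e], made into a finite type; [mkcell] returns [u0] outside the
    range. *)
Definition cells : seq (I * nat) := [seq (e, i) | e <- enum I, i <- iota 0 (n e)].
Definition cell := seq_sub cells.

Lemma mem_cells e i : ((e, i) \in cells) = (i < n e)%N.
Proof.
apply/allpairsPdep/idP => [[e' [j [_ jn [-> ->]]]]|h].
  by rewrite mem_iota in jn.
by exists e, i; rewrite mem_enum mem_iota.
Qed.

Lemma cell_lt (u : cell) : (((val u).2 : nat) < n (val u).1)%N.
Proof. by rewrite -mem_cells -surjective_pairing; apply: valP. Qed.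

Variable u0 : cell.
Definition mkcell e i : cell := insubd u0 (e, i).
Lemma val_mkcell e i : (i < n e)%N -> val (mkcell e i) = (e, i).
Proof. by move=> h; rewrite insubdK // mem_cells. Qed.
End Cells.

(** Here [c] counts the darts at crossings, so X = c / 4 and S = m + c / 2; the weight 5 makes [c]
    cancel. [o] is the number of faces on which all colourings vanish. *)
Lemma euler_count (m n X F S c V o : nat) :
  (2 * S = 2 * m + c -> X * 4 = c -> V = X + n -> S + 1 + o <= F + V ->
   20 * F <= 5 * c + 8 * (2 * m) -> 4 * m + 20 + 20 * o <= 20 * n)%N.
Proof. lia. Qed.

Lemma euler_count_strict (m n X F S c V : nat) :
  (2 * S = 2 * m + c -> X * 4 = c -> V = X + n -> S + 1 + 1 <= F + V ->
   20 * F + 4 <= 5 * c + 8 * (2 * m) -> 4 * m + 44 <= 20 * n)%N.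
Proof. lia. Qed.

Section PlanePaths.
Variables (R : realFieldType) (T Ed : finType) (ea eb : Ed -> T) (pos : T -> R * R).
Variable L : Ed -> seq (R * R).
Definition pnt e i := nth (0, 0) (L e) i.
Definition nL e := (size (L e)).-1.
Definition inseg (P Q z : R * R) := exists2 t, 0 <= t <= 1 &
  z = ((1 - t) * P.1 + t * Q.1, (1 - t) * P.2 + t * Q.2).
Definition ends e := [set ea e; eb e].
Definition isv z := [exists v, z == pos v].

Hypothesis pos_inj : injective pos.
Hypothesis ends_neq : forall e, ea e != eb e.
Hypothesis ends_inj : injective ends.
Hypothesis L_size : forall e, (1 < size (L e))%N.
Hypothesis L_first : forall e, pnt e 0 = pos (ea e).
Hypothesis L_last : forall e, pnt e (nL e) = pos (eb e).
Hypothesis L_uniq : forall e, uniq (L e).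
Hypothesis L_inner : forall e i, (0 < i < nL e)%N -> ~~ isv (pnt e i).
Hypothesis L_plane : forall e i e' j z, (i < nL e)%N -> (j < nL e')%N ->
  (e, i) <> (e', j) -> inseg (pnt e i) (pnt e i.+1) z ->
  inseg (pnt e' j) (pnt e' j.+1) z -> z = pnt e i \/ z = pnt e i.+1.
(** Going straight through crossings makes the four darts there alternate between the two edges. *)
Hypothesis L_straight : forall e e' i, e != e' -> (0 < i < nL e)%N -> pnt e i \in L e' ->
  exists2 t, 0 < t < 1 & pnt e i =
   ((1 - t) * (pnt e i.-1).1 + t * (pnt e i.+1).1,
    (1 - t) * (pnt e i.-1).2 + t * (pnt e i.+1).2).
Hypothesis L_disj : forall e e' z, e != e' -> z \in L e -> z \in L e' -> ~~ isv z ->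
  [disjoint ends e & ends e'].
Hypothesis L_third : forall e e' e'' z, e != e' -> z \in L e -> z \in L e' -> z \in L e'' ->
  ~~ isv z -> e'' = e \/ e'' = e'.
Hypothesis L_once : forall e e' z z', e != e' -> z \in L e -> z \in L e' ->
  z' \in L e -> z' \in L e' -> z = z'.
Hypothesis L_fan : forall e e1 e2 z1 z2, e1 != e -> e2 != e -> z1 \in L e -> z1 \in L e1 ->
  z2 \in L e -> z2 \in L e2 -> ~~ isv z1 -> ~~ isv z2 -> ~~ [disjoint ends e1 & ends e2].
(** No segment is vertical, so slopes order the darts at a point; a shear will provide this. *)
Hypothesis L_generic : forall e e' z z', z \in L e -> z' \in L e' -> z.1 = z'.1 -> z = z'.

Variable e0 : Ed.

Lemma nL_gt0 e : (0 < nL e)%N. Proof. by rewrite /nL -subn1 subn_gt0. Qed.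
Lemma sizeL e : size (L e) = (nL e).+1.
Proof. by rewrite /nL prednK // ltnW. Qed.

Lemma pnt_mem e i : (i <= nL e)%N -> pnt e i \in L e.
Proof. by move=> h; rewrite mem_nth // sizeL. Qed.

Lemma pnt_inj e i j : (i <= nL e)%N -> (j <= nL e)%N -> pnt e i = pnt e j -> i = j.
Proof. move=> hi hj h; apply/eqP.
rewrite -(@nth_uniq _ (0,0) (L e)) ?sizeL ?ltnS //; exact/eqP.
Qed.

Lemma mem_pnt e z : z \in L e -> exists2 i, (i <= nL e)%N & z = pnt e i.
Proof.
move=> h; exists (index z (L e)); first by rewrite -ltnS -sizeL index_mem.
by rewrite /pnt nth_index.
Qed.

Lemma isv_pos v : isv (pos v). Proof. by apply/existsP; exists v. Qed.

Lemma isv_pnt e i : (i <= nL e)%N -> isv (pnt e i) = (i == 0) || (i == nL e).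
Proof.
move=> h; apply/idP/idP => [v|/orP[/eqP->|/eqP->]]; last 2 first.
- by rewrite L_first isv_pos.
- by rewrite L_last isv_pos.
apply: contraLR v; rewrite negb_or -lt0n => /andP[i0 il].
by apply: L_inner; rewrite i0 ltn_neqAle il.
Qed.

Local Notation U := (cell nL).
Definition u0 : U := SeqSub (etrans (mem_cells nL e0 0) (nL_gt0 e0)).
Definition ue (u : U) := (val u).1.
Definition ui (u : U) : nat := (val u).2.
Definition mkU e i : U := mkcell u0 e i.
Definition uP u := pnt (ue u) (ui u).
Definition uQ u := pnt (ue u) (ui u).+1.
Definition orient u := (uP u).1 < (uQ u).1.
Definition lp u := if orient u then uP u else uQ u.
Definition rp u := if orient u then uQ u else uP u.

Lemma ui_lt u : (ui u < nL (ue u))%N. Proof. exact: cell_lt. Qed.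
Lemma ue_mkU e i : (i < nL e)%N -> ue (mkU e i) = e.
Proof. by move=> h; rewrite /ue /mkU val_mkcell. Qed.
Lemma ui_mkU e i : (i < nL e)%N -> ui (mkU e i) = i.
Proof. by move=> h; rewrite /ui /mkU val_mkcell. Qed.
Lemma mkUK u : mkU (ue u) (ui u) = u.
Proof. by apply: val_inj; rewrite val_mkcell ?ui_lt // -surjective_pairing. Qed.

Lemma uP_mem u : uP u \in L (ue u). Proof. by rewrite pnt_mem // ltnW // ui_lt. Qed.
Lemma uQ_mem u : uQ u \in L (ue u). Proof. by rewrite pnt_mem // ui_lt. Qed.

Lemma uPQ u : (uP u).1 != (uQ u).1.
Proof.
apply/eqP=> /(L_generic (uP_mem u) (uQ_mem u)) /pnt_inj h; apply: (@n_Sn (ui u)).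
by apply: h; [apply/ltnW/ui_lt | apply: ui_lt].
Qed.

Lemma lp_rp u : (lp u).1 < (rp u).1.
Proof.
rewrite /lp /rp; case: ifP => //; rewrite /orient => /negbT; rewrite -leNgt le_eqVlt.
by rewrite eq_sym (negPf (uPQ u)).
Qed.

Lemma lp_mem u : lp u \in L (ue u).
Proof. by rewrite /lp; case: ifP => _; rewrite ?uP_mem ?uQ_mem. Qed.
Lemma rp_mem u : rp u \in L (ue u).
Proof. by rewrite /rp; case: ifP => _; rewrite ?uP_mem ?uQ_mem. Qed.

Lemma height_inseg u x : (lp u).1 <= x <= (rp u).1 ->
  inseg (uP u) (uQ u) (x, height lp rp u x).
Proof.
move=> /andP[x1 x2]; have h := lp_rp u.
have h0 : 0 < (rp u).1 - (lp u).1 by rewrite subr_gt0.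
have key : inseg (lp u) (rp u) (x, height lp rp u x).
  exists ((x - (lp u).1) / ((rp u).1 - (lp u).1)).
    by rewrite divr_ge0 ?ler_pdivrMr ?subr_ge0 ?mul1r ?lerB // ltW.
  by congr pair; rewrite /height /slope; field; rewrite gt_eqF.
move: key; rewrite {1 2}/lp {1 2}/rp; case: ifP => // _ [t /andP[t0 t1] ->].
exists (1 - t); first by rewrite subr_ge0 t1 lerBlDr lerDl.
by rewrite subKr; congr pair; rewrite addrC.
Qed.

Lemma U_planar u v x : u != v -> (lp u).1 <= x <= (rp u).1 ->
  (lp v).1 < x < (rp v).1 -> height lp rp u x != height lp rp v x.
Proof.
move=> uv xu xv; apply/eqP=> e.
have iu := height_inseg xu; have xv' : (lp v).1 <= x <= (rp v).1.
  by case/andP: xv => h1 h2; rewrite !ltW.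
have iv := height_inseg xv'; rewrite e in iu.
have ne : (ue v, ui v) <> (ue u, ui u).
  by case=> e1 e2; case/eqP: uv; rewrite -(mkUK u) -(mkUK v) e1 e2.
have := L_plane (ui_lt v) (ui_lt u) ne iv iu; rewrite -/(uP v) -/(uQ v) => h.
have : x = (lp v).1 \/ x = (rp v).1.
  by rewrite /lp /rp; case: ifP => _; case: h => <-; auto.
by case/andP: xv => h1 h2; case=> xE; rewrite xE ltxx in h1 h2.
Qed.

Lemma ll_eq u v : (lp u).1 = (lp v).1 -> lp u = lp v.
Proof. exact: L_generic (lp_mem u) (lp_mem v). Qed.
Lemma rr_eq u v : (rp u).1 = (rp v).1 -> rp u = rp v.
Proof. exact: L_generic (rp_mem u) (rp_mem v). Qed.

(* The dart leaving [uP u] along [u] when [c], the one leaving [uQ u] otherwise. *)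
Definition arm u (c : bool) : U * bool := (u, c == orient u).
Local Notation gtail := (tail lp rp).

Lemma tail_arm u c : gtail (arm u c) = if c then uP u else uQ u.
Proof. by rewrite /tail /arm /lp /rp /=; case: c; case: (orient u). Qed.

Lemma arm_surj (d : U * bool) : d = arm d.1 (d.2 == orient d.1).
Proof. by case: d => u b; rewrite /arm /=; case: b; case: orient. Qed.

Lemma arm_inj u v c c' : arm u c = arm v c' -> u = v /\ c = c'.
Proof. by rewrite /arm => -[-> ]; case: c; case: c'; case: orient. Qed.

Definition out e j := arm (mkU e j) true.
Definition back e j := arm (mkU e j.-1) false.

Lemma tail_out e j : (j < nL e)%N -> gtail (out e j) = pnt e j.
Proof. by move=> h; rewrite tail_arm /uP ue_mkU ?ui_mkU. Qed.

Lemma tail_back e j : (0 < j <= nL e)%N -> gtail (back e j) = pnt e j.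
Proof.
case/andP=> j0 h; have h' : (j.-1 < nL e)%N by rewrite prednK.
by rewrite tail_arm /uQ ue_mkU ?ui_mkU // prednK.
Qed.

Lemma armP d : exists e j, pnt e j = gtail d /\
  (((j < nL e)%N /\ d = out e j) \/ ((0 < j <= nL e)%N /\ d = back e j)).
Proof.
case: d => u b; rewrite [(u, b)]arm_surj /=; set c := b == _.
case: c; rewrite tail_arm.
  exists (ue u), (ui u); split=> //; left; split; first exact: ui_lt.
  by rewrite /out mkUK.
exists (ue u), (ui u).+1; split=> //; right; split; first exact: ui_lt.
by rewrite /back mkUK.
Qed.

(* Marked points are the vertices and the crossings; the other points are bends. *)
Definition marked z :=
  isv z || [exists e1, exists e2, [&& e1 != e2, z \in L e1 & z \in L e2]].
Definition marks e := [seq j <- iota 0 (nL e).+1 | marked (pnt e j)].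
Definition nM e := (size (marks e)).-1.
Definition jx e k := nth 0%N (marks e) k.

Lemma mem_marks e j : (j \in marks e) = (j <= nL e)%N && marked (pnt e j).
Proof. by rewrite mem_filter mem_iota /= add0n ltnS andbC. Qed.

Lemma marks_sorted e : sorted ltn (marks e).
Proof. by apply: sorted_filter; [exact: ltn_trans | apply: iota_ltn_sorted]. Qed.

Lemma marks0 e : 0%N \in marks e.
Proof. by rewrite mem_marks /= /marked L_first isv_pos. Qed.

Lemma marks_last e : nL e \in marks e.
Proof. by rewrite mem_marks leqnn /marked L_last isv_pos. Qed.

Lemma size_marks e : size (marks e) = (nM e).+1.
Proof. by rewrite /nM prednK //; have := marks0 e; case: (marks e). Qed.

Lemma jx_mem e k : (k <= nM e)%N -> jx e k \in marks e.
Proof. by move=> h; rewrite mem_nth // size_marks. Qed.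

Lemma jx_le e k : (k <= nM e)%N -> (jx e k <= nL e)%N.
Proof. by move=> /jx_mem; rewrite mem_marks => /andP[]. Qed.

Lemma jx_marked e k : (k <= nM e)%N -> marked (pnt e (jx e k)).
Proof. by move=> /jx_mem; rewrite mem_marks => /andP[]. Qed.

Lemma jx_lt e k k' : (k < k')%N -> (k' <= nM e)%N -> (jx e k < jx e k')%N.
Proof.
move=> h h'; apply: (sorted_ltn_nth ltn_trans 0%N (marks_sorted e)); rewrite ?inE ?size_marks //.
by rewrite ltnS (leq_trans (ltnW h)).
Qed.

Lemma jx_leq e k k' : (k <= k')%N -> (k' <= nM e)%N -> (jx e k <= jx e k')%N.
Proof. by rewrite leq_eqVlt => /orP[/eqP ->//|h h']; apply/ltnW/jx_lt. Qed.

Lemma jxP e j : j \in marks e -> exists2 k, (k <= nM e)%N & j = jx e k.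
Proof.
move=> h; exists (index j (marks e)); first by rewrite -ltnS -size_marks index_mem.
by rewrite /jx nth_index.
Qed.

Lemma jx_inj e k k' : (k <= nM e)%N -> (k' <= nM e)%N -> jx e k = jx e k' -> k = k'.
Proof.
move=> h h' E; case: (ltngtP k k') => // l.
  by have := jx_lt l h'; rewrite E ltnn.
by have := jx_lt l h; rewrite E ltnn.
Qed.

Lemma jx0 e : jx e 0 = 0%N.
Proof.
have [k h E] := jxP (marks0 e).
by apply/eqP; rewrite -leqn0 [X in (_ <= X)%N]E jx_leq.
Qed.

Lemma jx_last e : jx e (nM e) = nL e.
Proof.
have [k h E] := jxP (marks_last e).
by apply/eqP; rewrite eqn_leq jx_le // {1}E jx_leq.
Qed.

Lemma nM_gt0 e : (0 < nM e)%N.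
Proof.
rewrite lt0n; apply/eqP=> h; have := jx_last e; rewrite h jx0 => E.
by have := nL_gt0 e; rewrite -E.
Qed.

(** The piece that contains segment [i] begins one mark before the first mark beyond [i]. *)
Definition pk e i := (find (fun j => (i < j)%N) (marks e)).-1.

Lemma pkP e i : (i < nL e)%N ->
  [/\ (pk e i < nM e)%N, (jx e (pk e i) <= i)%N & (i < jx e (pk e i).+1)%N].
Proof.
move=> h; have hs : has (fun j => (i < j)%N) (marks e).
  by apply/hasP; exists (nL e); rewrite ?marks_last.
have n1 := nth_find 0%N hs; have n2 := hs; rewrite has_find size_marks in n2.
have n3 : (0 < find (fun j => (i < j)%N) (marks e))%N.
  by rewrite lt0n; apply/eqP=> E; move: n1; rewrite E -/(jx e 0) jx0.
rewrite /pk; case E: find n1 n2 n3 => [|k] // n1 n2 _; split=> //.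
rewrite leqNgt; apply/negP=> h'; have := @before_find _ 0%N (fun j => (i < j)%N) (marks e) k.
by rewrite E ltnSn -/(jx e k) h' => /(_ isT).
Qed.

Lemma pk_uniq e i k : (k < nM e)%N -> (jx e k <= i)%N -> (i < jx e k.+1)%N -> pk e i = k.
Proof.
move=> h1 h2 h3; have h : (i < nL e)%N by apply: leq_trans h3 (jx_le h1).
have [p1 p2 p3] := pkP h; case: (ltngtP (pk e i) k) => // l.
  by have := leq_trans p3 (leq_trans (jx_leq l (ltnW h1)) h2); rewrite ltnn.
by have := leq_trans h3 (leq_trans (jx_leq l (ltnW p1)) p2); rewrite ltnn.
Qed.

Lemma unmarked_between e k j : (k < nM e)%N -> (jx e k < j < jx e k.+1)%N -> ~~ marked (pnt e j).
Proof.
move=> h /andP[j1 j2]; apply/negP=> m.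
have : j \in marks e by rewrite mem_marks m andbT (leq_trans (ltnW j2)) // jx_le.
case/jxP=> k' hk' E; rewrite E in j1 j2.
case: (ltnP k k') => l; last by have := leq_trans j1 (jx_leq l (ltnW h)); rewrite ltnn.
by have := leq_trans j2 (jx_leq l hk'); rewrite ltnn.
Qed.

Local Notation S := (cell nM).
Local Notation D := (S * bool)%type.
Definition s0 : S := SeqSub (etrans (mem_cells nM e0 0) (nM_gt0 e0)).
Definition mkS e k : S := mkcell s0 e k.
Definition de (d : D) := (val d.1).1.
Definition dk (d : D) : nat := (val d.1).2.
Definition mkD e k b : D := (mkS e k, b).

Lemma dk_lt d : (dk d < nM (de d))%N. Proof. exact: cell_lt. Qed.
Lemma de_mkD e k b : (k < nM e)%N -> de (mkD e k b) = e.
Proof. by move=> h; rewrite /de val_mkcell. Qed.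
Lemma dk_mkD e k b : (k < nM e)%N -> dk (mkD e k b) = k.
Proof. by move=> h; rewrite /dk val_mkcell. Qed.
Lemma mkDK d : mkD (de d) (dk d) d.2 = d.
Proof.
case: d => s b; congr pair; apply: val_inj.
by rewrite val_mkcell ?dk_lt // -surjective_pairing.
Qed.

(** The dart of the first segment by which [d] leaves its source; it links the coarse map to the
    segments. *)
Definition delta (d : D) :=
  if d.2 then out (de d) (jx (de d) (dk d)) else back (de d) (jx (de d) (dk d).+1).
Definition dpos (d : D) : nat := jx (de d) (if d.2 then dk d else (dk d).+1).
Definition src d := pnt (de d) (dpos d).

Lemma dpos_le d : (dpos d <= nL (de d))%N.
Proof. by rewrite jx_le //; case: (d.2); rewrite ?dk_lt // ltnW // dk_lt. Qed.

Lemma tail_delta d : gtail (delta d) = src d.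
Proof.
rewrite /delta /src /dpos; have h := dk_lt d; case: (d.2).
  by rewrite tail_out // (leq_trans _ (jx_le h)) // jx_lt.
by rewrite tail_back // jx_le // (leq_ltn_trans _ (jx_lt (ltnSn _) h)).
Qed.

Lemma src_marked d : marked (src d).
Proof. by rewrite jx_marked //; case: (d.2); rewrite ?dk_lt // ltnW // dk_lt. Qed.

Lemma src_mem d : src d \in L (de d).
Proof. by rewrite pnt_mem // dpos_le. Qed.

Lemma delta_inj : injective delta.
Proof.
move=> d d' E; have hd := dk_lt d; have hd' := dk_lt d'.
have j1 : (jx (de d) (dk d) < nL (de d))%N by rewrite (leq_trans _ (jx_le hd)) // jx_lt.
have j1' : (jx (de d') (dk d') < nL (de d'))%N by rewrite (leq_trans _ (jx_le hd')) // jx_lt.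
have j2 : (0 < jx (de d) (dk d).+1)%N by apply: (leq_ltn_trans _ (jx_lt (ltnSn _) hd)).
have j2' : (0 < jx (de d') (dk d').+1)%N by apply: (leq_ltn_trans _ (jx_lt (ltnSn _) hd')).
have j3 : ((jx (de d) (dk d).+1).-1 < nL (de d))%N by rewrite prednK // jx_le.
have j3' : ((jx (de d') (dk d').+1).-1 < nL (de d'))%N by rewrite prednK // jx_le.
move: E; rewrite -[X in _ -> X = _]mkDK -[X in _ -> _ = X]mkDK /delta.
case: (d.2); case: (d'.2); rewrite /out /back => /arm_inj[] // Eu _.
  have Ee : de d = de d' by rewrite -(ue_mkU j1) Eu ue_mkU.
  have := ui_mkU j1; rewrite Eu ui_mkU // => Ei; rewrite Ee in hd Ei *.
  by rewrite (@jx_inj (de d') (dk d) (dk d')) // ltnW.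
have Ee : de d = de d' by rewrite -(ue_mkU j3) Eu ue_mkU.
have := ui_mkU j3; rewrite Eu ui_mkU // => Ei; rewrite Ee in hd j2 Ei *.
have := @jx_inj (de d') (dk d).+1 (dk d').+1 hd hd'.
by rewrite -(prednK j2) -(prednK j2') -Ei => /(_ (erefl _)) [->].
Qed.

Lemma delta_surj t : marked (gtail t) -> exists d, delta d = t.
Proof.
have [e [j [<- H]]] := armP t => m.
have : j \in marks e.
  by rewrite mem_marks m andbT; case: H => -[]; [move/ltnW | case/andP].
case/jxP=> k hk jE; case: H => -[hj ->].
  have hk' : (k < nM e)%N.
    by rewrite ltn_neqAle hk andbT; apply: contraTneq hj => kE; rewrite jE kE jx_last ltnn.
  by exists (mkD e k true); rewrite /delta de_mkD // dk_mkD // -jE.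
case: k hk jE => [|k] hk jE; first by move: hj; rewrite jE jx0.
by exists (mkD e k false); rewrite /delta de_mkD // dk_mkD // -jE.
Qed.

Local Notation ale := (angle_le lp rp).

Lemma ale_trans : transitive ale.
Proof.
move=> [v b] [u a] [w c]; rewrite /angle_le /=.
by case: a; case: b; case: c => //=; apply: le_trans.
Qed.

Lemma ale_total : total ale.
Proof. by move=> [v b] [u a]; rewrite /angle_le /=; case: a; case: b => //=; apply: le_total. Qed.

Lemma ale_anti t t' : gtail t = gtail t' -> ale t t' -> ale t' t -> t = t'.
Proof.
case: t t' => [u a] [v b]; rewrite /angle_le /tail /=; case: a; case: b => //= E h1 h2.
  have es : slope lp rp u = slope lp rp v by apply/eqP; rewrite eq_le h1 h2.
  suff -> : u = v by [].
  apply/eqP; apply: contraT => uv.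
  have k1 : (lp v).1 < (rp u).1 by rewrite -E; apply: lp_rp.
  have k2 : (lp u).1 < (rp v).1 by rewrite E; apply: lp_rp.
  have [m1 m2 m3 m4] := lmid_bounds lp_rp k1 k2.
  have := @U_planar u v (lmid lp rp u v) uv; rewrite (ltW m1) (ltW m2) m3 m4 => /(_ isT isT)/eqP[].
  rewrite (height_slope lp rp u (lp u).1) (height_slope lp rp v (lp v).1) !height_lp.
  by rewrite E es.
have es : slope lp rp u = slope lp rp v by apply/eqP; rewrite eq_le h1 h2.
by rewrite (rp_slope_inj lp_rp U_planar E es).
Qed.

Definition dle d d' := ale (delta d) (delta d').

Lemma dle_trans : transitive dle. Proof. by move=> a b c; apply: ale_trans. Qed.
Lemma dle_total : total dle. Proof. by move=> a b; apply: ale_total. Qed.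
Lemma dle_anti d d' : src d = src d' -> dle d d' -> dle d' d -> d = d'.
Proof. by rewrite -!tail_delta => E h1 h2; apply: delta_inj; apply: ale_anti. Qed.

Definition sg : D -> D := rot_next src dle.

Lemma sg_inj : injective sg. Proof. exact: rot_inj. Qed.
Lemma src_sg d : src (sg d) = src d. Proof. exact: src_rot. Qed.
Lemma sg_connect d d' : fconnect sg d d' = (src d == src d').
Proof. exact: rot_connect. Qed.

(** * Cycles of the map colour its faces *)

Section Colouring.
Variable C : S -> bool.
Hypothesis C_cycle : forall d, parity sg C d = false.

Definition CU (u : U) := C (mkS (ue u) (pk (ue u) (ui u))).

Lemma CU_delta d : CU (delta d).1 = C d.1.
Proof.
have h := dk_lt d; have jl := jx_lt (ltnSn _) h.
have E : d.1 = mkS (de d) (dk d) by rewrite -{1}(mkDK d).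
rewrite [in RHS]E /CU /delta; case: (d.2); rewrite /out /back /arm /=.
  have j1 : (jx (de d) (dk d) < nL (de d))%N by rewrite (leq_trans jl) // jx_le.
  by rewrite ue_mkU // ui_mkU // (pk_uniq h).
have j2 : (0 < jx (de d) (dk d).+1)%N by apply: (leq_ltn_trans _ jl).
have j3 : ((jx (de d) (dk d).+1).-1 < nL (de d))%N by rewrite prednK // jx_le.
rewrite ue_mkU // ui_mkU // (pk_uniq h) //; first by rewrite -ltnS prednK.
by rewrite prednK.
Qed.

Lemma bend_arms w : ~~ marked w -> forall t, gtail t = w ->
  exists e j, [/\ (0 < j < nL e)%N, pnt e j = w &
    forall t', (gtail t' == w) = (t' == out e j) || (t' == back e j)].
Proof.
move=> nm t tw; have [e [j [jw H]]] := armP t; rewrite tw in jw.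
have jle : (j <= nL e)%N by case: H => -[]; [move/ltnW|case/andP].
have j0l : (0 < j < nL e)%N.
  move: nm; rewrite /marked negb_or -jw isv_pnt // negb_or -lt0n => /andP[/andP[-> jn] _].
  by rewrite ltn_neqAle jn.
have /andP[j0 jl] := j0l.
exists e, j; split=> // t'; apply/eqP/orP => [t'w|[/eqP->|/eqP->]]; last 2 first.
- by rewrite tail_out.
- by rewrite tail_back ?j0.
have [e' [j' [jw' H']]] := armP t'; rewrite t'w in jw'.
have jle' : (j' <= nL e')%N by case: H' => -[]; [move/ltnW|case/andP].
have ee : e' = e.
  apply/eqP; apply: contraNT nm => ne; apply/orP; right; apply/existsP; exists e'.
  by apply/existsP; exists e; rewrite ne -{1}jw' -{1}jw !pnt_mem.
rewrite ee in jw' jle' H'; have jj : j' = j by apply: (pnt_inj jle' jle); rewrite jw' jw.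
by rewrite jj in H'; case: H' => -[_ ->]; [left|right]; rewrite eqxx.
Qed.

Lemma out_neq_back e j e' j' : out e j <> back e' j'.
Proof. by rewrite /out /back => /arm_inj[]. Qed.

Lemma bend_CU e j : (0 < j < nL e)%N -> ~~ marked (pnt e j) -> CU (back e j).1 = CU (out e j).1.
Proof.
case/andP=> j0 jl nm; have j1 : (j.-1 < nL e)%N by rewrite prednK // ltnW.
rewrite /CU /back /out /arm /= !ue_mkU // !ui_mkU //; congr (C (mkS _ _)).
have [p1 p2 p3] := pkP j1; rewrite prednK // in p3.
apply/esym; apply: pk_uniq => //; first by apply: leq_trans p2 (leq_pred _).
rewrite ltn_neqAle p3 andbT; apply: contraNneq nm => ->; exact: jx_marked.
Qed.

(** At a marked point this is the cycle condition; at a bend the two segments belong to one piece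
    and cancel. *)
Lemma even_total w : \big[addb/false]_(t | gtail t == w) CU t.1 = false.
Proof.
case m: (marked w).
  case: (pickP (fun t => gtail t == w)) => [t /eqP tw|n0]; last by rewrite big1 // => t; rewrite n0.
  have [d dE] : exists d, delta d = t by apply: delta_surj; rewrite tw.
  have := C_cycle d; rewrite /parity => h; rewrite -[RHS]h; apply/esym.
  pose h' t := odflt d [pick d' | delta d' == t].
  have h'K d' : h' (delta d') = d'.
    rewrite /h'; case: pickP => [d'' /eqP/delta_inj //|/(_ d')]; by rewrite eqxx.
  rewrite [RHS](reindex_onto delta h') /=; last first.
    move=> t' /eqP t'w; have [d' <-] : exists d', delta d' = t' by apply: delta_surj; rewrite t'w.
    by rewrite h'K.
  apply: eq_big => [d'|d' _]; last by rewrite CU_delta.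
  by rewrite sg_connect h'K eqxx andbT tail_delta -tw -dE tail_delta eq_sym.
case: (pickP (fun t => gtail t == w)) => [t /eqP tw|n0]; last by rewrite big1 // => t; rewrite n0.
have [e [j [jl jw tE]]] := bend_arms (negbT m) tw.
rewrite (eq_bigl _ _ tE) (bigD1 (out e j)) ?eqxx //= (bigD1 (back e j)) /=; last first.
  by rewrite eqxx orbT /=; apply/eqP => /esym/out_neq_back.
rewrite big1 => [|t']; last by case: eqP => //=; case: eqP.
by rewrite bend_CU // ?jw ?m // addbF addbb.
Qed.

Lemma even_LR w :
  \big[addb/false]_(u | lp u == w) CU u = \big[addb/false]_(u | rp u == w) CU u.
Proof.
have := even_total w; rewrite big_addb_pair /tail /=.
by case: (\big[_/_]_(_ | lp _ == w) _); case: (\big[_/_]_(_ | rp _ == w) _).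
Qed.

Local Notation lcol := (left_colour lp rp CU).

Lemma lcol_sum t : lcol t = right_parity lp rp CU (gtail t) (+)
  \big[addb/false]_(t' | (gtail t' == gtail t) && ale t' t) CU t'.1.
Proof. exact: (left_colour_sum lp_rp U_planar). Qed.

Lemma lcol_arm u : lcol (arm u true) (+) lcol (arm u false) = CU u.
Proof.
have := left_colour_flip lp_rp ll_eq rr_eq U_planar even_LR (arm u true).
by rewrite /arm /= -/(arm u false); case: orient.
Qed.

(** Only two darts leave a bend, with the same value of [CU], so their left colours differ by it; so
    do the left colours of the two darts of the segment before the bend. *)
Lemma lcol_bend e j : (0 < j < nL e)%N -> ~~ marked (pnt e j) ->
  lcol (out e j) = lcol (out e j.-1).
Proof.
move=> jl nm; have /andP[j0 jn] := jl.
have tb : gtail (back e j) = pnt e j by rewrite tail_back // j0 ltnW.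
have to : gtail (out e j) = pnt e j by rewrite tail_out.
have [e' [j' [jl' jw tE]]] := bend_arms nm to.
have E : lcol (out e j) (+) lcol (back e j) = CU (out e j).1.
  rewrite !lcol_sum to tb.
  have tE' t : (gtail t == pnt e j) = (t == out e j) || (t == back e j).
    have o1 : (out e j == out e' j') || (out e j == back e' j') by rewrite -tE to eqxx.
    have o2 : (back e j == out e' j') || (back e j == back e' j') by rewrite -tE tb eqxx.
    case/orP: o1 => /eqP o1; last by case: (out_neq_back o1).
    case/orP: o2 => /eqP o2; first by case: (out_neq_back (esym o2)).
    by rewrite tE o1 o2.
  have ob : (out e j == back e j) = false by apply/eqP/out_neq_back.
  have sumE t0 : t0 = out e j \/ t0 = back e j ->
     \big[addb/false]_(t' | (gtail t' == pnt e j) && ale t' t0) CU t'.1 =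
     (ale (out e j) t0 && CU (out e j).1) (+) (ale (back e j) t0 && CU (back e j).1).
    move=> _; rewrite big_mkcondr (eq_bigl _ _ tE') (bigD1 (out e j)) ?eqxx //=.
    rewrite (bigD1 (back e j)) /=; last by rewrite eqxx orbT eq_sym ob.
    rewrite big1 ?addbF => [|t']; last by case: eqP => //=; case: eqP.
    by case: ale; case: ale.
  rewrite !sumE; try by [left|right].
  have := bend_CU jl nm => ->.
  have lxx x : ale x x by have := ale_total x x; rewrite orbb.
  rewrite !lxx; have := ale_total (out e j) (back e j).
  have := @ale_anti (out e j) (back e j); rewrite to tb => /(_ (erefl _)).
  case: (ale (out e j) _); case: (ale (back e j) _) => h //= _;
    first (by case: (out_neq_back (h isT isT)));
    by case: right_parity; case: CU.
have := lcol_arm (mkU e j.-1); rewrite -/(out e j.-1) -/(back e j).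
rewrite -[mkU e j.-1]/(back e j).1 bend_CU //; move: E.
by case: lcol; case: lcol; case: lcol; case: CU.
Qed.

(** [eface] turns at the target to the next dart counterclockwise, so the face of [d] lies on its
    right, which is the left of [flip d]. *)
Definition psi d := lcol (delta (flip d)).

Lemma lcol_piece e k j : (k < nM e)%N -> (jx e k <= j)%N -> (j < jx e k.+1)%N ->
  lcol (out e j) = lcol (out e (jx e k)).
Proof.
move=> hk; elim: j => [|j IH] h1 h2.
  by congr (lcol (out e _)); apply/esym/eqP; rewrite -leqn0.
move: h1; rewrite leq_eqVlt => /orP[/eqP <- //|h1].
rewrite -IH ?(ltnW h2) //.
have nm := unmarked_between (e := e) hk (j := j.+1); rewrite h1 h2 in nm.
rewrite (@lcol_bend e j.+1) ?nm //=.
by rewrite (leq_trans h2) // jx_le.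
Qed.

Lemma lcol_delta_flip d : lcol (delta d) (+) lcol (delta (flip d)) = C d.1.
Proof.
wlog: d / d.2 = true.
  move=> H; case b: (d.2); first exact: H.
  have := H (flip d); rewrite /= b => /(_ (erefl _)) <-.
  by rewrite addbC /flip /= negbK; case: d {b H}.
move=> b; have h := dk_lt d; have jl := jx_lt (ltnSn _) h.
have j2 : (0 < jx (de d) (dk d).+1)%N by apply: (leq_ltn_trans _ jl).
have dE : delta d = out (de d) (jx (de d) (dk d)) by rewrite /delta b.
have fE : delta (flip d) = back (de d) (jx (de d) (dk d).+1).
  by rewrite /delta /flip /= b.
rewrite dE fE -(@lcol_piece _ _ (jx (de d) (dk d).+1).-1 h); last 2 first.
- by rewrite -ltnS prednK.
- by rewrite prednK.
have := lcol_arm (mkU (de d) (jx (de d) (dk d).+1).-1).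
rewrite -/(out _ _) -/(back _ _) => ->.
by rewrite -[d.1]/(flip d).1 -(CU_delta (flip d)) fE.
Qed.

Lemma psi_flip d : psi d (+) psi (flip d) = C d.1.
Proof. exact: (lcol_delta_flip (flip d)). Qed.

Lemma lcol_below d : lcol (delta d) = right_parity lp rp CU (src d) (+)
  below src dle (fun d' => C d'.1) d.
Proof.
rewrite lcol_sum tail_delta; congr addb; rewrite /below.
pose h' t := odflt d [pick d' | delta d' == t].
have h'K d' : h' (delta d') = d'.
  rewrite /h'; case: pickP => [d'' /eqP/delta_inj //|/(_ d')]; by rewrite eqxx.
rewrite (reindex_onto delta h') /=; last first.
  move=> t' /andP[/eqP t'w _].
  have [d' <-] : exists d', delta d' = t' by apply: delta_surj; rewrite t'w src_marked.
  by rewrite h'K.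
apply: eq_big => [d'|d' _]; last by rewrite CU_delta.
by rewrite h'K eqxx andbT tail_delta.
Qed.

(** From [flip d] to its successor around the node the left colour changes by the value of [C] at
    the successor, and reversing the successor changes it back. *)
Lemma psi_face d : psi (eface sg d) = psi d.
Proof.
rewrite /psi /eface; set d1 := flip d; set d2 := sg d1.
have E1 := lcol_delta_flip d2.
have tot : \big[addb/false]_(y | src y == src d1) C y.1 = false.
  rewrite -[RHS](C_cycle d1) /parity; apply: eq_bigl => y.
  by rewrite sg_connect eq_sym.
have := below_next dle_trans dle_total dle_anti tot; rewrite -/(sg d1) -/d2.
move=> E2; have L1 := lcol_below d1; have := lcol_below d2; rewrite src_sg => L2.
move: E1 E2; rewrite L1 L2 => <-.
by case: right_parity; case: below; case: below; case: (lcol _).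
Qed.

End Colouring.

(** * The map around its crossings *)

Definition fin (d : D) := if d.2 then eb (de d) else ea (de d).
Definition crs (d : D) := ~~ isv (src d).
Definition ix (d : D) : nat := if d.2 then dk d else (nM (de d) - dk d)%N.
(** At a crossing, the dart of the same edge that leaves in the opposite direction. *)
Definition opp (d : D) := if d.2 then mkD (de d) (dk d).-1 false else mkD (de d) (dk d).+1 true.

Lemma de_flip d : de (flip d) = de d. Proof. by []. Qed.
Lemma dk_flip d : dk (flip d) = dk d. Proof. by []. Qed.
Lemma flipK : involutive (@flip S). Proof. by case=> s b; rewrite /flip /= negbK. Qed.

Lemma crs_pos d : crs d -> (0 < dpos d < nL (de d))%N.
Proof.
rewrite /crs /src isv_pnt ?dpos_le // negb_or -lt0n => /andP[-> h] /=.
by rewrite ltn_neqAle h dpos_le.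
Qed.

Lemma crs_true d : crs d -> d.2 -> (0 < dk d)%N.
Proof.
move=> /crs_pos/andP[h _] b; rewrite lt0n; apply: contraTneq h => k0.
by rewrite /dpos b k0 jx0.
Qed.

Lemma crs_false d : crs d -> ~~ d.2 -> ((dk d).+1 < nM (de d))%N.
Proof.
move=> /crs_pos/andP[_ h] /negPf b; rewrite ltn_neqAle dk_lt andbT.
by apply: contraTneq h => E; rewrite /dpos b E jx_last ltnn.
Qed.

Lemma opp_facts d : crs d -> [/\ de (opp d) = de d, src (opp d) = src d,
  (opp d).2 = ~~ d.2, fin (opp d) = fin (flip d) & opp (opp d) = d].
Proof.
move=> c; rewrite /opp; case b: (d.2).
  have k0 := crs_true c b; have h : ((dk d).-1 < nM (de d))%N.
    by rewrite prednK // ltnW // dk_lt.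
  rewrite /src /dpos /fin /= !de_mkD // !dk_mkD // prednK // b /=; split=> //.
  by have := mkDK d; rewrite b.
have h : ((dk d).+1 < nM (de d))%N by apply: crs_false; rewrite ?b.
rewrite /src /dpos /fin /= !de_mkD // !dk_mkD // b /=; split=> //.
by have := mkDK d; rewrite b.
Qed.

Lemma same_place d d' : de d = de d' -> src d = src d' -> d' = d \/ (d' = opp d /\ crs d).
Proof.
move=> E s; have p : dpos d = dpos d'.
  apply: (@pnt_inj (de d)); rewrite ?dpos_le //; first by rewrite E dpos_le.
  by rewrite -/(src d) s /src -E.
have hd := dk_lt d; have hd' := dk_lt d'; rewrite -E in hd'.
move: p; rewrite /dpos -E; case b: (d.2); case b': (d'.2) => p.
- left; rewrite -(mkDK d) -(mkDK d') b b' -E.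
  by rewrite (@jx_inj (de d) (dk d) (dk d')) // ltnW.
- right; have kE := jx_inj (ltnW hd) hd' p; split.
    by rewrite /opp b -(mkDK d') b' -E kE.
  rewrite /crs /src isv_pnt ?dpos_le // /dpos b; apply/norP; split.
    by rewrite -lt0n kE; apply: leq_ltn_trans (jx_lt (ltnSn _) hd').
  by apply/eqP=> h; have := jx_lt hd (leqnn _); rewrite h jx_last ltnn.
- right; have kE := jx_inj hd (ltnW hd') p; split.
    by rewrite /opp b -(mkDK d') b' -E kE.
  rewrite /crs /src isv_pnt ?dpos_le // /dpos b; apply/norP; split.
    by rewrite -lt0n; apply: leq_ltn_trans (jx_lt (ltnSn _) hd).
  by rewrite kE; apply/eqP=> h; have := jx_lt hd' (leqnn _); rewrite h jx_last ltnn.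
left; rewrite -(mkDK d) -(mkDK d') b b' -E.
by have [->] := jx_inj hd hd' p.
Qed.

Lemma crs_other d : crs d -> exists2 e', e' != de d & src d \in L e'.
Proof.
move=> c; have := src_marked d; rewrite /marked (negPf c) /=.
case/existsP=> e1 /existsP[e2 /and3P[ne z1 z2]].
case: (eqVneq e1 (de d)) => [E|]; last by exists e1.
by exists e2; rewrite // -E eq_sym.
Qed.

Lemma dart_at e z : z \in L e -> marked z -> exists d, de d = e /\ src d = z.
Proof.
case/mem_pnt=> j jl -> m.
have /jxP[k hk jE] : j \in marks e by rewrite mem_marks jl m.
case: (ltnP k (nM e)) => h.
  by exists (mkD e k true); rewrite /src /dpos de_mkD ?dk_mkD //= -jE.
have kE : k = (nM e).-1.+1 by rewrite (prednK (nM_gt0 e)); apply/eqP; rewrite eqn_leq hk.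
have h' : ((nM e).-1 < nM e)%N by rewrite prednK ?nM_gt0.
by exists (mkD e (nM e).-1 false); rewrite /src /dpos de_mkD ?dk_mkD //= -kE -jE.
Qed.

Lemma slope_arm u c : slope lp rp (arm u c).1 = ((uQ u).2 - (uP u).2) / ((uQ u).1 - (uP u).1).
Proof.
rewrite /slope /lp /rp /arm /=; case: orient => //.
by rewrite -[in RHS](opprB (uP u).2) -[in RHS](opprB (uP u).1) invrN mulrNN.
Qed.

Lemma straight_arms e j : (0 < j < nL e)%N ->
  (exists2 t, 0 < t < 1 & pnt e j =
   ((1 - t) * (pnt e j.-1).1 + t * (pnt e j.+1).1,
    (1 - t) * (pnt e j.-1).2 + t * (pnt e j.+1).2)) ->
  (out e j).2 = ~~ (back e j).2 /\
  slope lp rp (out e j).1 = slope lp rp (back e j).1.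
Proof.
case/andP=> j0 jn [t /andP[t0 t1] E].
have jn' : (j.-1 < nL e)%N by rewrite prednK // ltnW.
rewrite !slope_arm /out /back /arm /= /orient /uP /uQ !ue_mkU // !ui_mkU // prednK //.
set A := pnt e j.-1 in E *; set B := pnt e j.+1 in E *; set Z := pnt e j in E *.
have AB : A.1 != B.1.
  apply/eqP=> h; have := L_generic (pnt_mem (ltnW jn')) (pnt_mem jn) h.
  move/(pnt_inj (ltnW jn') jn) => k; have := ltnW (leqnn j.+1).
  by rewrite -k leqNgt prednK // leqnn.
have ZB : B.1 - Z.1 = (1 - t) * (B.1 - A.1) by rewrite E /=; ring.
have AZ : Z.1 - A.1 = t * (B.1 - A.1) by rewrite E /=; ring.
have t1' : 0 < 1 - t by rewrite subr_gt0.
split.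
  have -> : (Z.1 < B.1) = (A.1 < B.1) by rewrite -subr_gt0 ZB pmulr_rgt0 // subr_gt0.
  have -> : (A.1 < Z.1) = (A.1 < B.1) by rewrite -subr_gt0 AZ pmulr_rgt0 // subr_gt0.
  by case: (A.1 < B.1).
have BA : B.1 - A.1 != 0 by rewrite subr_eq0 eq_sym.
rewrite ZB AZ E /=; field.
by rewrite BA gt_eqF //= gt_eqF.
Qed.

Lemma delta_dpos d : delta d = if d.2 then out (de d) (dpos d) else back (de d) (dpos d).
Proof. by rewrite /delta /dpos; case: (d.2). Qed.

Lemma opp_delta d : crs d -> (delta (opp d)).2 = ~~ (delta d).2 /\
  slope lp rp (delta (opp d)).1 = slope lp rp (delta d).1.
Proof.
move=> c; have [o1 o2 o3 _ _] := opp_facts c; have [e' ne z] := crs_other c.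
have jb := crs_pos c.
have st := L_straight (_ : de d != e') jb z; rewrite eq_sym in st.
have [s1 s2] := straight_arms jb (st ne).
have co : crs (opp d) by rewrite /crs o2.
have po : dpos (opp d) = dpos d.
  by apply: (@pnt_inj (de d)); rewrite ?dpos_le // -?o1 ?dpos_le // -/(src _) o2 o1.
have [[-> ->]|[-> ->]] : (delta (opp d) = back (de d) (dpos d) /\ delta d = out (de d) (dpos d))
    \/ (delta (opp d) = out (de d) (dpos d) /\ delta d = back (de d) (dpos d)).
  by rewrite !delta_dpos po o1 o3; case: (d.2); [left | right].
- by rewrite s1 s2 negbK.
- by rewrite s1 s2.
Qed.

(** By [L_third] only two edges pass through the crossing; of the two darts of the other edge, [y]
    is the one that points to the right. *)
Lemma crs_neighbours d : crs d -> exists y, [/\ de y != de d, src y = src d, crs y,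
  (delta y).2 & forall z, src z = src d -> z \in [:: d; y; opp d; opp y]].
Proof.
move=> c; have [e' ne z] := crs_other c; have [y [ye ys]] := dart_at z (src_marked d).
have cy : crs y by rewrite /crs ys.
wlog by' : y ye ys cy / (delta y).2.
  move=> H; case b: (delta y).2; first exact: (H y).
  have [o1 o2 _ _ _] := opp_facts cy; have [o3 _] := opp_delta cy.
  apply: (H (opp y)); rewrite ?o1 ?o2 ?o3 ?b //; first by rewrite /crs o2.
exists y; split; rewrite ?ye // => x xs.
have : de x = de d \/ de x = e'.
  have nz : ~~ isv (src d) by [].
  have dx : src d \in L (de x) by rewrite -xs src_mem.
  have nde : de d != e' by rewrite eq_sym.
  exact: (L_third nde (src_mem d) z dx nz).
case=> [E|E]; rewrite !inE.
  case: (same_place (esym E) (esym xs)) => [->|[-> _]]; first by rewrite eqxx.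
  by rewrite eqxx !orbT.
have E' : de y = de x by rewrite E.
case: (same_place E' (etrans ys (esym xs))) => [->|[-> _]]; first by rewrite eqxx orbT.
by rewrite eqxx !orbT.
Qed.

(** Opposite darts have the same slope on opposite sides, so the left darts [opp d] and [opp y] come
    in the same order as the right darts [d] and [y], and the two edges alternate. *)
Lemma sg2_right d : crs d -> (delta d).2 -> sg (sg d) = opp d /\ sg (sg (opp d)) = d
  /\ de (sg d) != de d /\ de (sg (opp d)) != de d.
Proof.
move=> c b; have [y [ye ys cy yb all4]] := crs_neighbours c.
have [o1 o2 o3 o4 o5] := opp_facts c; have [b1 b2] := opp_delta c.
have [p1 p2 p3 p4 p5] := opp_facts cy; have [c1 c2] := opp_delta cy.
rewrite b /= in b1; rewrite yb /= in c1.
have ne1 : d != y by apply: contraNneq ye => ->.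
have ne2 : d != opp d by apply/eqP=> E; move: b1; rewrite -E b.
have ne3 : d != opp y by apply/eqP=> E; move: c1; rewrite -E b.
have ne4 : y != opp d by apply/eqP=> E; move: b1; rewrite -E yb.
have ne5 : y != opp y by apply/eqP=> E; move: c1; rewrite -E yb.
have ne6 : opp d != opp y by apply: contraNneq ye => E; rewrite -p1 -E o1.
have l1 : dle d y = (slope lp rp (delta d).1 <= slope lp rp (delta y).1).
  by rewrite /dle /angle_le b yb.
have l2 : dle y d = (slope lp rp (delta y).1 <= slope lp rp (delta d).1).
  by rewrite /dle /angle_le b yb.
have l3 : dle y (opp d) by rewrite /dle /angle_le b1 yb.
have l3' : dle d (opp y) by rewrite /dle /angle_le c1 b.
have l4 : dle (opp d) (opp y) = dle d y by rewrite l1 /dle /angle_le b1 c1 eqxx b2 c2.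
have l5 : dle (opp y) (opp d) = dle y d by rewrite l2 /dle /angle_le b1 c1 eqxx b2 c2.
case: (orP (dle_total d y)) => [h|h].
  have un : uniq [:: d; y; opp d; opp y].
    by rewrite /= !inE !negb_or ne1 ne2 ne3 ne4 ne5 ne6.
  rewrite -l4 in h; have h' := h; rewrite l4 in h'.
  have [r1 r2 r3 r4] := rot_four dle_trans dle_total dle_anti ys o2 (etrans p2 ys) un h' l3 h all4.
  by rewrite /sg r1 r2 r3 r4 p1 ye.
have all4' z : src z = src y -> z \in [:: y; d; opp y; opp d].
  rewrite ys => /all4; rewrite !inE => /or4P[] -> ; rewrite ?orbT //.
have un : uniq [:: y; d; opp y; opp d].
  by rewrite /= !inE !negb_or eq_sym ne1 ne5 ne4 ne3 ne2 eq_sym ne6.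
rewrite -l5 in h; have h' := h; rewrite l5 in h'.
have [r1 r2 r3 r4] :=
  rot_four dle_trans dle_total dle_anti (esym ys) p2 (etrans o2 (esym ys)) un h' l3' h all4'.
by rewrite /sg r2 r3 r4 r1 p1 ye.
Qed.

Lemma sg2 d : crs d -> sg (sg d) = opp d /\ de (sg d) != de d.
Proof.
move=> c; case b: (delta d).2; first by have [-> [_ [-> _]]] := sg2_right c b.
have [o1 o2 o3 o4 o5] := opp_facts c; have [b1 _] := opp_delta c.
have co : crs (opp d) by rewrite /crs o2.
have [|_ [h [_ n]]] := @sg2_right (opp d) co; first by rewrite b1 b.
by rewrite o5 o1 in h n.
Qed.

Lemma crs_sg d : crs (sg d) = crs d. Proof. by rewrite /crs src_sg. Qed.

Lemma sg4 d : crs d -> sg (sg (sg (sg d))) = d.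
Proof.
move=> c; have [-> _] := sg2 c; have [o1 o2 o3 o4 o5] := opp_facts c.
by have [|-> _] := @sg2 (opp d); rewrite /crs ?o2.
Qed.

Lemma real_src d : ~~ crs d -> src d = pos (fin (flip d)).
Proof.
rewrite negbK /src isv_pnt ?dpos_le // /dpos /fin /= => h.
have hk := dk_lt d; case b: (d.2) h => /= /orP[]/eqP h.
- by rewrite h L_first.
- by have := jx_lt hk (leqnn _); rewrite h jx_last ltnn.
- by have := jx_lt (ltnSn _) hk; rewrite h.
- by rewrite h L_last.
Qed.

Lemma real_sg d : ~~ crs d -> fin (flip (sg d)) = fin (flip d).
Proof.
move=> c; have cs : ~~ crs (sg d) by rewrite crs_sg.
by apply: pos_inj; rewrite -!real_src // src_sg.
Qed.

Lemma ends_de d : ends (de d) = [set fin d; fin (flip d)].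
Proof. by rewrite /ends /fin /= de_flip; case: (d.2) => //=; rewrite setUC. Qed.

Lemma real_inj d d' : ~~ crs d -> ~~ crs d' ->
  fin (flip d) = fin (flip d') -> fin d = fin d' -> d = d'.
Proof.
move=> c c' e1 e2; have E : de d = de d' by apply: ends_inj; rewrite !ends_de e1 e2.
have s : src d' = src d by rewrite !real_src // e1.
by case: (same_place (esym E) s) => // -[_]; rewrite (negPf c').
Qed.

Lemma crs_disj d : crs d -> [disjoint ends (de d) & ends (de (sg d))].
Proof.
move=> c; have [_ ne] := sg2 c.
apply: (L_disj (z := src d)); rewrite 1?eq_sym ?src_mem //.
by rewrite -src_sg src_mem.
Qed.

Lemma crs_simple d d' : crs d -> crs d' -> de d = de d' ->
  de (sg d) = de (sg d') -> d' = d \/ d' = sg (sg d).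
Proof.
move=> c c' E E'; have [-> ne] := sg2 c.
have s : src d = src d'.
  apply: (L_once ne); rewrite ?src_mem -1?(src_sg d) -1?(src_sg d') ?src_mem //.
  - by rewrite E' src_mem.
  - by rewrite src_sg E src_mem.
by case: (same_place E s) => [->|[->]]; [left|right].
Qed.

Lemma crs_fan d d' : crs d -> crs d' -> de d = de d' ->
  ~~ [disjoint ends (de (sg d)) & ends (de (sg d'))].
Proof.
move=> c c' E; have [_ ne] := sg2 c; have [_ ne'] := sg2 c'; rewrite -E in ne'.
apply: (L_fan ne ne' (src_mem d) _ _ _ c c').
- by rewrite -src_sg src_mem.
- by rewrite E src_mem.
- by rewrite -src_sg src_mem.
Qed.

Lemma ix_next d : crs (flip d) -> ix (sg (sg (flip d))) = (ix d).+1.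
Proof.
move=> c; have [-> _] := sg2 c; rewrite /opp /= de_flip dk_flip.
case b: (d.2) => /=.
  have h : ((dk d).+1 < nM (de d))%N by apply: (crs_false c); rewrite /= b.
  by rewrite /ix /= b dk_mkD.
have h : (0 < dk d)%N by apply: (crs_true c); rewrite /= b.
have h' : ((dk d).-1 < nM (de d))%N by rewrite prednK // ltnW // dk_lt.
rewrite /ix /= b dk_mkD // de_mkD // -subSn; last by rewrite ltnW // dk_lt.
by case: (dk d) h => // k _; rewrite subSS.
Qed.

(** * Counting darts, nodes and faces *)

Definition touched := [set v | [exists e, v \in ends e]].
Hypothesis degree4 : forall v, v \in touched -> (4 <= #|[set e | v \in ends e]|)%N.

Lemma pos_mem v e : v \in ends e -> pos v \in L e.
Proof.
rewrite !inE => /orP[]/eqP ->; first by rewrite -L_first pnt_mem.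
by rewrite -L_last pnt_mem.
Qed.

Lemma marked_pos v : marked (pos v). Proof. by rewrite /marked isv_pos. Qed.

Lemma fin_touched d : fin d \in touched.
Proof. by rewrite inE; apply/existsP; exists (de d); rewrite ends_de !inE eqxx. Qed.

Lemma order_real d : ~~ crs d -> (4 <= order sg d)%N.
Proof.
move=> c; have := degree4 (fin_touched (flip d)); set v := fin (flip d) => h.
apply: leq_trans h _.
have /fin_all_exists[g gP] : forall e, exists d' : D, v \in ends e -> de d' = e /\ src d' = pos v.
  move=> e; case ve: (v \in ends e); last by exists d.
  by have [d' h] := dart_at (pos_mem ve) (marked_pos v); exists d'.
rewrite -(card_in_imset (f := g)) => [|e e']; last first.
  rewrite inE => ve; rewrite inE => ve' E; have [E1 _] := gP e ve; have [E2 _] := gP e' ve'.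
  by rewrite -[LHS]E1 -[RHS]E2 E.
apply: subset_leq_card; apply/subsetP=> _ /imsetP[e ve ->]; rewrite inE in ve.
have [_ h] := gP e ve; rewrite -[_ \in _]/(fconnect sg d (g e)) sg_connect h.
by rewrite real_src.
Qed.

Lemma iter_order_le (i : nat) d : iter i.+1 sg d = d -> (order sg d <= i.+1)%N.
Proof.
move=> e; have lp0 : looping sg d i.+1 by rewrite /looping e /= inE eqxx.
have /loopingP h := lp0.
have sub : fconnect sg d \subset traject sg d i.+1.
  apply/subsetP=> y dy; have {}dy : fconnect sg d y by [].
  by rewrite -(iter_findex dy) h.
have := leq_trans (subset_leq_card sub) (card_size _); rewrite size_traject.
exact.
Qed.

Lemma deg_iter (i : nat) d : (i < 3)%N -> ~~ crs d -> iter i.+1 sg d <> d.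
Proof.
move=> i3 c e.
have o4 := order_real c.
by have := leq_trans o4 (iter_order_le e); rewrite ltnS leqNgt i3.
Qed.

Lemma deg1 d : ~~ crs d -> sg d <> d. Proof. exact: (@deg_iter 0). Qed.
Lemma deg2 d : ~~ crs d -> sg (sg d) <> d. Proof. exact: (@deg_iter 1). Qed.
Lemma deg3 d : ~~ crs d -> sg (sg (sg d)) <> d. Proof. exact: (@deg_iter 2). Qed.

Lemma order_crs d : crs d -> order sg d = 4.
Proof.
move=> c; have [s2 n1] := sg2 c; have [o1 o2 o3 o4 o5] := opp_facts c.
have co : crs (opp d) by rewrite /crs o2.
have [s2' n2] := sg2 co; rewrite o1 in n2.
have no : opp d != d by apply/eqP=> E; move: o3; rewrite E; case: (d.2).
apply: (@order_cycle _ sg [:: d; sg d; sg (sg d); sg (sg (sg d))]); rewrite ?mem_head //.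
  by rewrite /= sg4 // !eqxx.
rewrite /= !inE !negb_or s2 ![d == _]eq_sym no /=.
have -> : sg d != d by apply: contraNneq n1 => ->.
have -> : sg (opp d) != d by apply: contraNneq n2 => ->.
have -> : sg d != opp d by apply: contraNneq n1 => ->; rewrite o1.
have -> : opp d != sg (opp d) by apply: contraNneq n2 => <-; rewrite o1.
by rewrite (inj_eq sg_inj) eq_sym no.
Qed.

Lemma card_real : #|[pred d | ~~ crs d]| = (2 * #|Ed|)%N.
Proof.
pose g (x : Ed * bool) := if x.2 then mkD x.1 0 true else mkD x.1 (nM x.1).-1 false.
have h e : ((nM e).-1 < nM e)%N by rewrite prednK ?nM_gt0.
have de_g x : de (g x) = x.1 by rewrite /g; case: (x.2); rewrite de_mkD ?nM_gt0.
have g2 x : (g x).2 = x.2 by rewrite /g; case: (x.2).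
have g_inj : injective g.
  move=> x y E; have := de_g y; have := g2 y; rewrite -E de_g g2.
  by case: x y {E} => [a b] [c d] /= -> ->.
rewrite mulnC -card_bool -card_prod -(card_image g_inj); apply: eq_card => d.
rewrite !inE; apply/idP/imageP => [c|[x _ ->]].
  exists (de d, d.2) => //; rewrite /g /= -{1}(mkDK d).
  move: c; rewrite negbK /src isv_pnt ?dpos_le // /dpos.
  have hk := dk_lt d; case b: (d.2) => /orP[]/eqP E.
  - by rewrite (@jx_inj (de d) (dk d) 0) ?jx0 // ltnW.
  - by have := jx_lt hk (leqnn _); rewrite E jx_last ltnn.
  - by have := jx_lt (ltnSn _) hk; rewrite E.
  - by rewrite -(@jx_inj (de d) (dk d).+1 (nM (de d))) // jx_last.
rewrite negbK /src isv_pnt ?dpos_le // /dpos de_g g2 /g.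
case: (x.2); rewrite dk_mkD ?nM_gt0 // ?jx0 // prednK ?nM_gt0 // jx_last eqxx orbT //.
Qed.

Lemma card_froots_crs : (#|[pred d in froots sg | crs d]| * 4)%N = #|[pred d | crs d]|.
Proof.
rewrite -(@fcard_order_set _ sg sg_inj 4 [pred d | crs d]).
- by congr (_ * _)%N; apply: eq_card => d; rewrite !inE.
- by apply/subsetP=> d; rewrite !inE => /order_crs ->.
- by move=> d d' /eqP <-; rewrite !inE crs_sg.
Qed.

Lemma card_froots_real : #|[pred d in froots sg | ~~ crs d]| = #|touched|.
Proof.
rewrite -(card_in_image (f := fun d => fin (flip d))) => [|d d']; last first.
  rewrite !inE => /andP[r c] /andP[r' c'] E.
  have : src d = src d' by rewrite !real_src // E.
  move/eqP; rewrite -sg_connect -(root_connect (fconnect_sym sg_inj)) => /eqP.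
  by rewrite (eqP r) (eqP r').
apply: eq_card => v; apply/imageP/idP => [[d _ ->]|]; first exact: fin_touched.
rewrite inE => /existsP[e ve].
have [d [_ ds]] := dart_at (pos_mem ve) (marked_pos v).
have s : src (froot sg d) = pos v.
  by rewrite -ds; apply/eqP; rewrite eq_sym -sg_connect connect_root.
have c : ~~ crs (froot sg d) by rewrite /crs s isv_pos.
exists (froot sg d); first by rewrite !inE c andbT; apply: roots_root; apply: fconnect_sym sg_inj.
by apply: pos_inj; rewrite -real_src.
Qed.

Lemma card_froots : #|froots sg| = (#|[pred d in froots sg | crs d]| + #|touched|)%N.
Proof.
rewrite -card_froots_real -(cardID [pred d | crs d] (froots sg)); congr addn;
  by apply: eq_card => d; rewrite !inE // andbC.
Qed.

Lemma card_darts : (2 * #|{: S}|)%N = (2 * #|Ed| + #|[pred d | crs d]|)%N.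
Proof.
rewrite -card_real mulnC -card_bool -card_prod -(cardC [pred d : D | crs d]) addnC.
by congr addn; apply: eq_card => d; rewrite !inE.
Qed.

Lemma sum_weights : \sum_(d : D) Discharging.weight crs d =
  (5 * #|[pred d | crs d]| + 8 * (2 * #|Ed|))%N.
Proof.
rewrite -card_real (bigID crs) /=; congr addn.
  rewrite (eq_bigr (fun=> 5)) => [|d]; last by rewrite /weight => ->.
  by rewrite sum_nat_const mulnC.
rewrite (eq_bigr (fun=> 8)) => [|d]; last by rewrite /weight => /negPf ->.
by rewrite sum_nat_const mulnC.
Qed.

(** A dart of largest slope among those to the right has on its left the side above [w], where
    nothing lies. If all darts run to the left, the last one in angular order collects the whole sum
    at [w], which is even. *)
Lemma lcol_top (w : R * R) : (forall u, ~~ over lp rp u w) -> (exists t, gtail t = w) ->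
  exists t, gtail t = w /\ forall C, (forall d, parity sg C d = false) ->
    left_colour lp rp (CU C) t = false.
Proof.
move=> nab [t0 t0w].
have up0 C : up lp rp (CU C) w = false.
  by rewrite /up big_pred0 // => u; apply: negbTE.
have step (P : pred (U * bool)) : P t0 \/ (exists t, P t) -> exists2 t, P t &
    forall t', P t' -> slope lp rp t'.1 <= slope lp rp t.1.
  move=> h; have [t Pt] : exists t, P t by case: h => //; exists t0.
  by case: (arg_maxP (fun t => slope lp rp t.1) Pt) => i Pi im; exists i.
case: (pickP (fun t => (gtail t == w) && t.2)) => [t1 t1P|nr].
  have [|t /andP[/eqP tw tb] tmax] := step (fun t => (gtail t == w) && t.2); first by right; exists t1.
  exists t; split=> // C hC; rewrite lcol_sum // tw /right_parity up0 addFb.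
  rewrite big_addb_pair /angle_le tb /tail /=.
  rewrite [X in _ (+) (_ (+) X)]big1 => [|v]; last by rewrite andbF.
  rewrite addbF [X in _ (+) X](eq_bigl (fun v => lp v == w)) ?addbb // => v.
  apply: andb_idr => vw; apply: (tmax (v, true)).
  by rewrite /tail /= vw.
have [|t /eqP tw tmax] := step (fun t => gtail t == w); first by left; apply/eqP.
exists t; split=> // C hC; rewrite lcol_sum // tw /right_parity up0 addFb big_pred0; last first.
  by move=> v; have := nr (v, true); rewrite /tail /= andbT.
rewrite addFb -[RHS](even_total hC w); apply: eq_bigl => t'.
apply: andb_idr => t'w; rewrite /angle_le.
have t2 : t.2 = false by have := nr t; rewrite tw eqxx.
have t2' : t'.2 = false by have := nr t'; rewrite t'w.
by rewrite t2 t2' /=; apply: tmax.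
Qed.

Lemma lcol_dart t : exists d, forall C, (forall d, parity sg C d = false) ->
  left_colour lp rp (CU C) t = left_colour lp rp (CU C) (delta d).
Proof.
have [e [j [_ H]]] := armP t; case: H => -[hj ->].
  have [p1 p2 p3] := pkP hj; exists (mkD e (pk e j) true) => C hC.
  by rewrite /delta /= de_mkD // dk_mkD //; apply: lcol_piece.
case/andP: hj => j0 jl; have hj : (j.-1 < nL e)%N by rewrite prednK.
have [p1 p2 p3] := pkP hj; exists (mkD e (pk e j.-1) false) => C hC.
have := lcol_delta_flip hC (mkD e (pk e j.-1) true).
have -> : flip (mkD e (pk e j.-1) true) = mkD e (pk e j.-1) false by [].
have -> : delta (mkD e (pk e j.-1) true) = out e (jx e (pk e j.-1)).
  by rewrite /delta /= de_mkD // dk_mkD.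
rewrite -(lcol_piece hC p1 p2 p3).
have := lcol_arm hC (mkU e j.-1); rewrite -/(out e j.-1) -/(back e j).
have -> : CU C (mkU e j.-1) = C (mkD e (pk e j.-1) true).1.
  by rewrite /CU ue_mkU // ui_mkU.
move=> <-.
by case: left_colour; case: left_colour; case: left_colour.
Qed.

Lemma leftmost : exists t, forall u, ~~ over lp rp u (gtail t).
Proof.
have [t _ tm] : exists2 t, true & forall t' : U * bool, (gtail t).1 <= (gtail t').1.
  case: (arg_minP (fun t : U * bool => (gtail t).1) (isT : xpredT (u0, true))) => t _ tm.
  by exists t => // t'; apply: tm.
exists t => u; rewrite /over negb_and -leNgt.
by have := tm (u, true); rewrite {2}/tail /= => ->.
Qed.

Local Notation faces := (froots (eface sg)).

Lemma eface_inj : injective (eface sg).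
Proof. by move=> x y /sg_inj /(can_inj flipK). Qed.

Lemma euler_faces (A : {set D}) : A != set0 ->
  (forall d, d \in A -> forall C, (forall d, parity sg C d = false) ->
     left_colour lp rp (CU C) (delta (flip d)) = false) ->
  (#|{: S}| + 1 + #|[set froot (eface sg) d | d in A]| <= #|faces| + #|froots sg|)%N.
Proof.
case/set0Pn=> v0 _ hA.
apply: (@euler_colourings _ sg sg_inj) => //.
  apply/subsetP=> _ /imsetP[d _ ->]; apply: roots_root; apply: fconnect_sym eface_inj.
move=> C hC; exists (psi C); split; [exact: psi_face | exact: psi_flip|].
move=> _ /imsetP[d dA ->]; rewrite -[RHS](hA d dA C hC) -/(psi C d).
have /iter_findex <- : fconnect (eface sg) d (froot (eface sg) d) := connect_root _ d.
by elim: findex => //= n; rewrite psi_face.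
Qed.

Lemma fin_flip_neq d : fin d != fin (flip d).
Proof. by rewrite /fin /= de_flip; case: (d.2); rewrite ?ends_neq // eq_sym ends_neq. Qed.

Lemma de_sg2 d : crs d -> de (sg (sg d)) = de d.
Proof. by move=> c; have [-> _] := sg2 c; have [] := opp_facts c. Qed.

Lemma fin_sg2 d : crs d -> fin (sg (sg d)) = fin (flip d).
Proof. by move=> c; have [-> _] := sg2 c; have [] := opp_facts c. Qed.

Lemma faces_bound : (20 * #|faces| <= 5 * #|[pred d | crs d]| + 8 * (2 * #|Ed|))%N.
Proof.
rewrite -sum_weights.
exact: (@faces_weight D T Ed (@flip S) sg crs fin de ends ix flipK sg_inj (fun=> erefl)
  fin_flip_neq ends_de ends_inj crs_sg sg4 de_sg2 fin_sg2 real_sg real_inj deg1 deg2 deg3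
  crs_disj crs_simple crs_fan ix_next).
Qed.

Lemma faces_bound_strict x y z : uniq [:: x; y; z] -> ~~ crs x -> ~~ crs y -> ~~ crs z ->
  fconnect (eface sg) x y -> fconnect (eface sg) x z ->
  (20 * #|faces| + 4 <= 5 * #|[pred d | crs d]| + 8 * (2 * #|Ed|))%N.
Proof.
rewrite -sum_weights.
exact: (@faces_weight_strict D T Ed (@flip S) sg crs fin de ends ix flipK sg_inj (fun=> erefl)
  fin_flip_neq ends_de ends_inj crs_sg sg4 de_sg2 fin_sg2 real_sg real_inj deg1 deg2 deg3
  crs_disj crs_simple crs_fan ix_next).
Qed.

Theorem paths_bound : (4 * #|Ed| + 40 <= 20 * #|touched|)%N.
Proof.
have [t nab] := leftmost.
have [|t' [t'w tC]] := lcol_top nab; first by exists t.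
have [d dC] := lcol_dart t'.
have A0 : [set flip d] != set0 by apply/set0Pn; exists (flip d); rewrite inE.
have := @euler_faces [set flip d] A0; rewrite imset_set1 cards1.
have h : forall d0, d0 \in [set flip d] -> forall C, (forall d1, parity sg C d1 = false) ->
    left_colour lp rp (CU C) (delta (flip d0)) = false.
  by move=> d0 /set1P -> C hC; rewrite flipK -dC // tC.
move=> /(_ h) E.
have := euler_count card_darts card_froots_crs card_froots E faces_bound.
by rewrite muln1 -addnA.
Qed.

Lemma top_dart v : v \in touched -> (forall u, ~~ over lp rp u (pos v)) ->
  exists d, src d = pos v /\ forall C, (forall d, parity sg C d = false) ->
    left_colour lp rp (CU C) (delta d) = false.
Proof.
rewrite inE => /existsP[e ve] nab.
have [d [_ ds]] := dart_at (pos_mem ve) (marked_pos v).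
have [|t [tw tC]] := lcol_top nab; first by exists (delta d); rewrite tail_delta.
have [d' dE] : exists d', delta d' = t by apply: delta_surj; rewrite tw marked_pos.
by exists d'; rewrite -tail_delta dE.
Qed.

(* Three vertices with nothing above them lie on the outer face, or there are two faces
   on which all colourings vanish; both improve the bound. *)
Theorem paths_bound_strict v1 v2 v3 : uniq [:: v1; v2; v3] ->
  v1 \in touched -> v2 \in touched -> v3 \in touched ->
  (forall v, v \in [:: v1; v2; v3] -> forall u, ~~ over lp rp u (pos v)) ->
  (4 * #|Ed| + 44 <= 20 * #|touched|)%N.
Proof.
move=> un t1 t2 t3 nab.
have [|d1 [s1 C1]] := @top_dart v1 t1; first by apply: nab; rewrite inE eqxx.
have [|d2 [s2 C2]] := @top_dart v2 t2; first by apply: nab; rewrite !inE eqxx orbT.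
have [|d3 [s3 C3]] := @top_dart v3 t3; first by apply: nab; rewrite !inE eqxx !orbT.
pose A := [set flip d1; flip d2; flip d3].
have A0 : A != set0 by apply/set0Pn; exists (flip d1); rewrite !inE eqxx.
have hA d : d \in A -> forall C, (forall d, parity sg C d = false) ->
    left_colour lp rp (CU C) (delta (flip d)) = false.
  by rewrite !inE -orbA => /or3P[] /eqP -> C hC; rewrite flipK ?C1 ?C2 ?C3.
have := euler_faces A0 hA; set B := [set froot _ _ | _ in _] => E.
have r1 : froot (eface sg) (flip d1) \in B by apply/imsetP; exists (flip d1); rewrite // !inE eqxx.
have r2 : froot (eface sg) (flip d2) \in B.
  by apply/imsetP; exists (flip d2); rewrite // !inE eqxx orbT.
have r3 : froot (eface sg) (flip d3) \in B.
  by apply/imsetP; exists (flip d3); rewrite // !inE eqxx orbT.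
case: (ltnP 1 #|B|) => cB.
  have E2 : (#|{: S}| + 1 + 2 <= #|faces| + #|froots sg|)%N.
    by apply: leq_trans E; rewrite leq_add2l.
  have := euler_count card_darts card_froots_crs card_froots E2 faces_bound.
  by rewrite -addnA; apply: leq_trans; rewrite leq_add2l.
have /cards1P[r rB] : #|B| == 1%N.
  by rewrite eqn_leq cB card_gt0; apply/set0Pn; exists (froot (eface sg) (flip d1)).
rewrite rB !inE in r1 r2 r3; rewrite rB cards1 in E.
have sgE d : eface sg (flip d) = sg d by rewrite /eface flipK.
have con d d' : froot (eface sg) (flip d) == r -> froot (eface sg) (flip d') == r ->
    fconnect (eface sg) (sg d) (sg d').
  move=> /eqP e1 /eqP e2; rewrite -!sgE.
  have sy := fconnect_sym eface_inj.
  rewrite -(root_connect sy); apply/eqP.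
  have h x : froot (eface sg) (eface sg x) = froot (eface sg) x.
    by apply/eqP; rewrite (root_connect sy) sy fconnect1.
  by rewrite !h e1 e2.
have real d v : src d = pos v -> ~~ crs (sg d) by move=> s; rewrite crs_sg /crs s isv_pos.
have us : uniq [:: sg d1; sg d2; sg d3].
  apply: (@map_uniq _ _ src).
  have -> : map src [:: sg d1; sg d2; sg d3] = map pos [:: v1; v2; v3].
    by rewrite /= !src_sg s1 s2 s3.
  by rewrite map_inj_uniq.
have FB := faces_bound_strict us (real _ _ s1) (real _ _ s2) (real _ _ s3)
  (con _ _ r1 r2) (con _ _ r1 r3).
exact: euler_count_strict card_darts card_froots_crs card_froots E FB.
Qed.

(** * The outer face of a straight-line drawing *)

Section StraightEdges.
Hypothesis L_seg : forall e z, z \in L e -> inseg (pos (ea e)) (pos (eb e)) z.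
Variables a b : T.
Hypothesis a_min : forall v, v \in touched -> (pos a).1 <= (pos v).1.
Hypothesis b_max : forall v, v \in touched -> (pos v).1 <= (pos b).1.

(* A positive multiple of the height of [z] above the line through [a] and [b]. *)
Definition rise (z : R * R) := (z.2 - (pos a).2) * ((pos b).1 - (pos a).1)
  - ((pos b).2 - (pos a).2) * (z.1 - (pos a).1).

Lemma touched_ends e : ea e \in touched /\ eb e \in touched.
Proof. by rewrite !inE; split; apply/existsP; exists e; rewrite !inE eqxx ?orbT. Qed.

Lemma convex_bound (f : R * R -> R) M : (forall P Q t, f ((1 - t) * P.1 + t * Q.1,
    (1 - t) * P.2 + t * Q.2) = (1 - t) * f P + t * f Q) ->
  (forall v, v \in touched -> f (pos v) <= M) -> forall e z, z \in L e -> f z <= M.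
Proof.
move=> fc fM e z /L_seg[t /andP[t0 t1] ->]; rewrite fc.
have [/fM h1 /fM h2] := touched_ends e; nra.
Qed.

Lemma rise_convex P Q t : rise ((1 - t) * P.1 + t * Q.1, (1 - t) * P.2 + t * Q.2) =
  (1 - t) * rise P + t * rise Q.
Proof. rewrite /rise /=; ring. Qed.

Lemma pnt_right e z : z \in L e -> (pos a).1 <= z.1.
Proof.
move=> ze; rewrite -lerN2; apply: (@convex_bound (fun z => - z.1) _ _ _ e z ze) => [P Q t|v tv].
  by rewrite /=; ring.
by rewrite lerN2 a_min.
Qed.

Lemma pnt_left e z : z \in L e -> z.1 <= (pos b).1.
Proof. by move=> ze; apply: (@convex_bound (fun z => z.1) _ _ _ e z ze). Qed.

Hypothesis a_touched : a \in touched.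
Hypothesis b_touched : b \in touched.

(** Otherwise all vertices with edges have one abscissa and coincide by [L_generic]. *)
Lemma ab_lt : (pos a).1 < (pos b).1.
Proof.
rewrite lt_neqAle a_min // andbT; apply/eqP => h.
have eq v : v \in touched -> v = a.
  move=> tv; apply: pos_inj.
  have [e ve] : exists e, v \in ends e by apply/existsP; rewrite inE in tv.
  have [e' ae] : exists e, a \in ends e by apply/existsP; have := a_touched; rewrite inE.
  apply: (L_generic (pos_mem ve) (pos_mem ae)).
  by apply/eqP; rewrite eq_le a_min // h b_max.
have [t1 t2] := touched_ends e0; have := ends_neq e0.
by rewrite (eq _ t1) (eq _ t2) eqxx.
Qed.

(** A segment passing over [w] would contain a point of greater [rise] than any vertex, although
    [rise] is affine along the edges. *)
Lemma over_rise u (w : R * R) M : (forall v, v \in touched -> rise (pos v) <= M) ->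
  rise w = M -> ~~ over lp rp u w.
Proof.
move=> rM wM; apply/and3P=> -[h1 h2 h3].
have hu : (lp u).1 <= w.1 <= (rp u).1 by rewrite !ltW.
have [t /andP[t0 t1] zE] := height_inseg hu.
have rP := convex_bound rise_convex rM (uP_mem u).
have rQ := convex_bound rise_convex rM (uQ_mem u).
have : rise (w.1, height lp rp u w.1) <= M by rewrite zE rise_convex; nra.
rewrite -wM /rise /= lerD2r ler_pM2r ?subr_gt0 ?ab_lt // lerD2r.
by rewrite leNgt h3.
Qed.

Theorem paths_bound_above : (exists2 v, v \in touched & 0 < rise (pos v)) ->
  (4 * #|Ed| + 44 <= 20 * #|touched|)%N.
Proof.
case=> v0 tv0 r0.
have [w tw wmax] : exists2 w, w \in touched & forall v, v \in touched -> rise (pos v) <= rise (pos w).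
  by case: (arg_maxP (fun v => rise (pos v)) tv0) => w tw wm; exists w.
have rw : 0 < rise (pos w) by apply: lt_le_trans r0 (wmax _ tv0).
have ra : rise (pos a) = 0 by rewrite /rise; ring.
have rb : rise (pos b) = 0 by rewrite /rise; ring.
apply: (@paths_bound_strict a b w) => //.
  rewrite /= !inE !negb_or andbT; apply/andP; split; last by apply/eqP=> E; rewrite -E rb ltxx in rw.
  apply/andP; split; apply/eqP=> E; last by rewrite -E ra ltxx in rw.
  by have := ab_lt; rewrite E ltxx.
move=> v; rewrite !inE => /or3P[]/eqP -> u.
- by rewrite /over ltNge (pnt_right (lp_mem u)).
- by rewrite /over andbA andbC [_ < (rp u).1]ltNge (pnt_left (rp_mem u)) !andbF.
- exact: over_rise wmax (erefl _).
Qed.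

(** All edges at the leftmost vertex [a] would leave it to the right with the slope of the line,
    hence be one edge, against [degree4]. *)
Theorem paths_not_collinear : ~ (forall v, v \in touched -> rise (pos v) = 0).
Proof.
move=> r0; have rL e z : z \in L e -> rise z = 0.
  move=> /L_seg[t _ ->]; rewrite rise_convex; have [t1 t2] := touched_ends e.
  by rewrite !r0 // !mulr0 addr0.
have := degree4 a_touched; rewrite leqNgt => /negP; apply.
apply: (@leq_ltn_trans 1) => //; apply/card_le1P => e; rewrite inE => ae e'.
rewrite !inE; apply/idP/eqP => [ae'|-> //]; last by rewrite !inE in ae.
have {}ae' : a \in ends e' by rewrite !inE.
have [d [de1 ds]] := dart_at (pos_mem ae) (marked_pos a).
have [d' [de2 ds']] := dart_at (pos_mem ae') (marked_pos a).
rewrite -de1 -de2; congr de; apply: delta_inj.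
have right t : gtail t = pos a -> t.2 /\
   slope lp rp t.1 = ((pos b).2 - (pos a).2) / ((pos b).1 - (pos a).1).
  case: t => u c; rewrite /tail /=; case: c => tE; last first.
    by have := lp_rp u; rewrite tE ltNge (pnt_right (lp_mem u)).
  split=> //; have := rL _ _ (rp_mem u); rewrite /rise /slope /= tE.
  have h1 : 0 < (rp u).1 - (pos a).1 by rewrite subr_gt0 -tE lp_rp.
  have h2 : 0 < (pos b).1 - (pos a).1 by rewrite subr_gt0 ab_lt.
  move/eqP; rewrite subr_eq0 => /eqP E.
  by apply/eqP; rewrite eqr_div ?(gt_eqF h1) ?(gt_eqF h2) // E.
have [t1 s1] := right _ (etrans (tail_delta d) ds).
have [t2 s2] := right _ (etrans (tail_delta d') ds').
apply: ale_anti; first by rewrite !tail_delta ds ds'.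
  by rewrite /angle_le t1 t2 eqxx s1 s2.
by rewrite /angle_le t1 t2 eqxx s1 s2.
Qed.

End StraightEdges.

End PlanePaths.

End PolygonalBound.

(** * Generic position by a shear *)

Module PlanePathsBound.
Import PolygonalBound.
Import Order.TTheory GRing.Theory Num.Theory.
Local Open Scope ring_scope.

Section PlanePathsRecord.
Variables (R : realFieldType) (T Ed : finType) (ea eb : Ed -> T).
Implicit Types (pos : T -> R * R) (L : Ed -> seq (R * R)).
Local Notation ends := (ends ea eb).

Record plane_paths pos L : Prop := PlanePaths {
  pp_pos_inj : injective pos;
  pp_size : forall e, (1 < size (L e))%N;
  pp_first : forall e, pnt L e 0 = pos (ea e);
  pp_last : forall e, pnt L e (nL L e) = pos (eb e);
  pp_uniq : forall e, uniq (L e);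
  pp_inner : forall e i, (0 < i < nL L e)%N -> ~~ isv pos (pnt L e i);
  pp_plane : forall e i e' j z, (i < nL L e)%N -> (j < nL L e')%N ->
    (e, i) <> (e', j) -> inseg (pnt L e i) (pnt L e i.+1) z ->
    inseg (pnt L e' j) (pnt L e' j.+1) z -> z = pnt L e i \/ z = pnt L e i.+1;
  pp_straight : forall e e' i, e != e' -> (0 < i < nL L e)%N -> pnt L e i \in L e' ->
    exists2 t, 0 < t < 1 & pnt L e i =
     ((1 - t) * (pnt L e i.-1).1 + t * (pnt L e i.+1).1,
      (1 - t) * (pnt L e i.-1).2 + t * (pnt L e i.+1).2);
  pp_disj : forall e e' z, e != e' -> z \in L e -> z \in L e' -> ~~ isv pos z ->
    [disjoint ends e & ends e'];
  pp_third : forall e e' e'' z, e != e' -> z \in L e -> z \in L e' -> z \in L e'' ->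
    ~~ isv pos z -> e'' = e \/ e'' = e';
  pp_once : forall e e' z z', e != e' -> z \in L e -> z \in L e' ->
    z' \in L e -> z' \in L e' -> z = z';
  pp_fan : forall e e1 e2 z1 z2, e1 != e -> e2 != e -> z1 \in L e -> z1 \in L e1 ->
    z2 \in L e -> z2 \in L e2 -> ~~ isv pos z1 -> ~~ isv pos z2 ->
    ~~ [disjoint ends e1 & ends e2]
}.

Section Image.
Variable c d : R.
Hypothesis d0 : d != 0.
(** Used with [d] equal to 1 or -1: the negative sign reflects the drawing, so that a vertex below
    the line joining the extreme vertices comes to lie above it. *)
Definition shear (p : R * R) : R * R := (p.1 + c * p.2, d * p.2).

Lemma shear_inj : injective shear.
Proof.
move=> [x y] [x' y'] [] /= h1 /(mulfI d0) h2; rewrite h2 in h1 *.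
by rewrite (addIr _ h1).
Qed.

Lemma shear_mix t P Q : shear ((1 - t) * P.1 + t * Q.1, (1 - t) * P.2 + t * Q.2) =
  ((1 - t) * (shear P).1 + t * (shear Q).1, (1 - t) * (shear P).2 + t * (shear Q).2).
Proof. by rewrite /shear /=; congr pair; ring. Qed.

Lemma inseg_shear P Q z : inseg P Q z -> inseg (shear P) (shear Q) (shear z).
Proof. by case=> t t01 ->; exists t; rewrite // shear_mix. Qed.

Lemma shear_inseg P Q z : inseg (shear P) (shear Q) z -> exists2 z', z = shear z' & inseg P Q z'.
Proof.
case=> t t01 ->; exists ((1 - t) * P.1 + t * Q.1, (1 - t) * P.2 + t * Q.2).
  by rewrite shear_mix.
by exists t.
Qed.

Lemma pnt_shear L e i : pnt (fun e => map shear (L e)) e i = shear (pnt L e i).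
Proof.
rewrite /pnt; case: (ltnP i (size (L e))) => h; first by rewrite (nth_map (0, 0)).
by rewrite !nth_default ?size_map // /shear /= !mulr0 addr0.
Qed.

Lemma nL_shear L e : nL (fun e => map shear (L e)) e = nL L e.
Proof. by rewrite /nL size_map. Qed.

Lemma isv_shear pos z : isv (shear \o pos) (shear z) = isv pos z.
Proof. by apply: eq_existsb => v; rewrite /= (inj_eq shear_inj). Qed.

Lemma plane_paths_shear pos L : plane_paths pos L ->
  plane_paths (shear \o pos) (fun e => map shear (L e)).
Proof.
case=> h1 h2 h3 h4 h5 h6 h7 h8 h9 h10 h11 h12.
have mem e z : z \in map shear (L e) -> exists2 z', z = shear z' & z' \in L e.
  by case/mapP=> z' ? ->; exists z'.
have mm e z : (shear z \in map shear (L e)) = (z \in L e) by rewrite mem_map //; exact: shear_inj.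
split.
- by move=> x y /shear_inj/h1.
- by move=> e; rewrite size_map.
- by move=> e; rewrite pnt_shear h3.
- by move=> e; rewrite nL_shear pnt_shear h4.
- by move=> e; rewrite map_inj_uniq //; exact: shear_inj.
- by move=> e i; rewrite nL_shear pnt_shear isv_shear; apply: h6.
- move=> e i e' j z; rewrite !nL_shear !pnt_shear => hi hj ne /shear_inseg[z' -> s] /shear_inseg[z''].
  move/shear_inj=> <- s'.
  by case: (h7 _ _ _ _ z' hi hj ne s s') => ->; [left|right].
- move=> e e' i ne; rewrite nL_shear !pnt_shear mm => hi m.
  by have [t t01 E] := h8 _ _ _ ne hi m; exists t; rewrite // {1}E shear_mix.
- by move=> e e' _ ne /mem[z -> ze]; rewrite mm isv_shear; apply: h9.
- by move=> e e' e'' _ ne /mem[z -> ze]; rewrite !mm isv_shear; apply: h10.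
- move=> e e' y y' ne /mem[z -> ze]; rewrite mm => ze' /mem[z' -> z'e]; rewrite mm => z'e'.
  by congr shear; apply: h11 ne ze ze' z'e z'e'.
- move=> e e1 e2 y1 y2 n1 n2 /mem[z1 -> a1]; rewrite mm => a2 /mem[z2 -> b1]; rewrite mm => b2.
  by rewrite !isv_shear; apply: h12 n1 n2 a1 a2 b1 b2.
Qed.
End Image.

Lemma avoid (s : seq R) : exists c, c \notin s.
Proof.
exists (1 + \sum_(x <- s) `|x|); apply/negP=> h.
have : 1 + \sum_(x <- s) `|x| <= \sum_(x <- s) `|x|.
  rewrite [X in _ <= X](big_rem _ h) /=; apply: le_trans (ler_norm _) _.
  by rewrite lerDl sumr_ge0.
by rewrite gerDr ler10.
Qed.

Definition generic L := forall e e' z z', z \in L e -> z' \in L e' -> z.1 = z'.1 -> z = z'.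

(** Two points at different heights get the same abscissa for one value of [c] only, so finitely
    many values have to be avoided. *)
Lemma generic_shear pos L : plane_paths pos L ->
  exists c, forall d, d != 0 -> generic (fun e => map (shear c d) (L e)).
Proof.
move=> pp; pose pts := flatten [seq L e | e <- enum Ed].
pose slopes := [seq (z'.1 - z.1) / (z.2 - z'.2) | z <- pts, z' <- pts].
have [c cn] := avoid slopes; exists c => d d0 e e' _ _ /mapP[z ze ->] /mapP[z' ze' ->] /= E.
congr shear; case: (eqVneq z.2 z'.2) => [E2|n].
  by move: E; rewrite E2 => /addIr E1; case: z z' E1 E2 {ze ze'} => [? ?] [? ?] /= -> ->.
case/negP: cn; apply/allpairsP; exists (z, z') => /=; split.
- by apply/flattenP; exists (L e) => //; apply/mapP; exists e; rewrite ?mem_enum.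
- by apply/flattenP; exists (L e') => //; apply/mapP; exists e'; rewrite ?mem_enum.
apply: (mulIf (x := z.2 - z'.2)); first by rewrite subr_eq0.
rewrite divfK ?subr_eq0 // mulrBr; lra.
Qed.

Hypothesis ends_neq : forall e, ea e != eb e.
Hypothesis ends_inj : injective ends.
Variable e0 : Ed.
Hypothesis degree4 : forall v, v \in touched ea eb -> (4 <= #|[set e | v \in ends e]|)%N.

Theorem plane_paths_bound pos L : plane_paths pos L ->
  (4 * #|Ed| + 40 <= 20 * #|touched ea eb|)%N.
Proof.
move=> pp; have [c /(_ 1 (oner_neq0 R)) g] := generic_shear pp.
have [] := plane_paths_shear c (oner_neq0 R) pp => *.
exact: (@paths_bound _ _ _ ea eb (shear c 1 \o pos) (fun e => map (shear c 1) (L e))).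
Qed.

Theorem plane_paths_bound_straight pos L : plane_paths pos L ->
  (forall e z, z \in L e -> inseg (pos (ea e)) (pos (eb e)) z) ->
  (4 * #|Ed| + 44 <= 20 * #|touched ea eb|)%N.
Proof.
move=> pp sg; have [c g] := generic_shear pp.
have n1 : (-1 : R) != 0 by rewrite oppr_eq0 oner_neq0.
have [e1 e2] : ea e0 \in touched ea eb /\ eb e0 \in touched ea eb.
  by rewrite !inE; split; apply/existsP; exists e0; rewrite !inE eqxx ?orbT.
(* The sheared abscissa does not depend on [d], so the same [a] and [b] serve for both signs. *)
pose X v := (pos v).1 + c * (pos v).2.
have [a ta am] : exists2 a, a \in touched ea eb & forall v, v \in touched ea eb -> X a <= X v.
  by case: (arg_minP X e1) => a ta am; exists a.
have [b tb bm] : exists2 b, b \in touched ea eb & forall v, v \in touched ea eb -> X v <= X b.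
  by case: (arg_maxP X e1) => b tb bm; exists b.
have sg' d e z : z \in map (shear c d) (L e) ->
    inseg ((shear c d \o pos) (ea e)) ((shear c d \o pos) (eb e)) z.
  by case/mapP=> z' /sg h ->; apply: inseg_shear.
pose r d v := rise (shear c d \o pos) a b ((shear c d \o pos) v).
have rN v : r (-1) v = - r 1 v by rewrite /r /rise /shear /=; ring.
case: (boolP [exists v in touched ea eb, 0 < r 1 v]) => [/exists_inP[v tv rv]|].
  have gd := g 1 (oner_neq0 R).
  have [] := plane_paths_shear c (oner_neq0 R) pp => *.
  apply: (@paths_bound_above _ _ _ ea eb (shear c 1 \o pos) (fun e => map (shear c 1) (L e))
     _ _ _ _ _ _ _ _ _ _ _ _ _ _ _ e0 _ _ a b) => //; last by exists v.
  exact: sg'.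
case: (boolP [exists v in touched ea eb, 0 < r (-1) v]) => [/exists_inP[v tv rv] _|].
  have gd := g (-1) n1.
  have [] := plane_paths_shear c n1 pp => *.
  apply: (@paths_bound_above _ _ _ ea eb (shear c (-1) \o pos) (fun e => map (shear c (-1)) (L e))
     _ _ _ _ _ _ _ _ _ _ _ _ _ _ _ e0 _ _ a b) => //; last by exists v.
  exact: sg'.
(* No vertex lies above or below the line through [a] and [b], so all lie on it. *)
move=> /exists_inPn h1 /exists_inPn h2.
have gd := g 1 (oner_neq0 R).
have [] := plane_paths_shear c (oner_neq0 R) pp => *.
suff : False by [].
apply: (@paths_not_collinear _ _ _ ea eb (shear c 1 \o pos) (fun e => map (shear c 1) (L e))
    _ _ _ _ _ _ _ _ e0 _ _ a b) => //.
  exact: sg'.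
move=> v tv; apply/eqP; rewrite eq_le -/(r 1 v).
have := h1 v tv; have := h2 v tv; rewrite rN -!leNgt oppr_le0 => -> ->.
by [].
Qed.

End PlanePathsRecord.

End PlanePathsBound.

From mathcomp Require Import classical_sets.

(** * Arcs cut at their crossings *)

Module Arcs.
Import PolygonalBound PlanePathsBound.
Import Order.TTheory GRing.Theory Num.Theory.
Local Open Scope ring_scope.

Section PlaneArcs.
Variables (R : realFieldType) (T Ed : finType) (ea eb : Ed -> T).
Variables (pos : T -> R * R) (arc : Ed -> R -> R * R).
Local Notation ends := (ends ea eb).

Record plane_arcs : Prop := PlaneArcs {
  pa_pos_inj : injective pos;
  pa_inj : forall e t t', 0 <= t <= 1 -> 0 <= t' <= 1 -> arc e t = arc e t' -> t = t';
  pa_first : forall e, arc e 0 = pos (ea e);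
  pa_last : forall e, arc e 1 = pos (eb e);
  pa_inner : forall e t v, 0 < t < 1 -> arc e t <> pos v;
  pa_once : forall e e' t t' u u', e != e' -> 0 <= t <= 1 -> 0 <= t' <= 1 ->
    0 <= u <= 1 -> 0 <= u' <= 1 -> arc e t = arc e' t' -> arc e u = arc e' u' -> t = u;
  pa_disj : forall e e' t t', e != e' -> 0 < t < 1 -> 0 <= t' <= 1 -> arc e t = arc e' t' ->
    [disjoint ends e & ends e'];
  pa_third : forall e e' e'' t t' t'', e != e' -> 0 < t < 1 -> 0 <= t' <= 1 -> 0 <= t'' <= 1 ->
    arc e t = arc e' t' -> arc e t = arc e'' t'' -> e'' = e \/ e'' = e';
  pa_fan : forall e e1 e2 t1 t2 u1 u2, e1 != e -> e2 != e -> 0 < t1 < 1 -> 0 < t2 < 1 ->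
    0 <= u1 <= 1 -> 0 <= u2 <= 1 -> arc e t1 = arc e1 u1 -> arc e t2 = arc e2 u2 ->
    ~~ [disjoint ends e1 & ends e2]
}.

Hypothesis pa : plane_arcs.

Let lt01_le (t : R) : 0 < t < 1 -> 0 <= t <= 1.
Proof. by case/andP=> a b; rewrite !ltW. Qed.
Hint Resolve lt01_le : core.

Lemma arc_inner e t : 0 <= t <= 1 -> ~~ isv pos (arc e t) -> 0 < t < 1.
Proof.
case/andP; rewrite !le_eqVlt => /orP[/eqP<-|->].
  by move=> _ /existsP[]; exists (ea e); rewrite (pa_first pa).
by case/orP=> [/eqP->|-> //] /existsP[]; exists (eb e); rewrite (pa_last pa).
Qed.

Lemma arc_isv e t : 0 < t < 1 -> ~~ isv pos (arc e t).
Proof. by move=> h; apply/existsP=> -[v /eqP/(pa_inner pa h)]. Qed.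

Definition meets e e' t := 0 < t < 1 /\ exists2 t', 0 <= t' <= 1 & arc e t = arc e' t'.
Definition crosses e e' := (e != e') && `[< exists t, meets e e' t >].
(** The parameter on [e] of its crossing with [e'], unique by [pa_once]; the default 0 stands for no
    crossing. *)
Definition xt e e' : R := xget 0 [set t | meets e e' t]%classic.

Lemma xtP e e' : crosses e e' -> meets e e' (xt e e').
Proof. by case/andP=> _ /asboolP[t h]; rewrite /xt; case: xgetP => [//|/(_ t)/(_ h)]. Qed.

Definition times e := 0 :: rcons (sort <=%R [seq xt e e' | e' <- enum Ed & crosses e e']) 1.

Lemma times_mid e t : t \in sort <=%R [seq xt e e' | e' <- enum Ed & crosses e e'] ->
  exists e', e != e' /\ meets e e' t.
Proof.
rewrite mem_sort => /mapP[e']; rewrite mem_filter => /andP[c _] ->.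
by exists e'; split; [case/andP: c | apply: xtP].
Qed.

(** Different edges cross [e] at different parameters, because [pa_third] excludes three edges
    through one inner point. *)
Lemma times_sorted e : sorted <%R (times e).
Proof.
rewrite /times; set s := sort _ _.
have s_s : sorted <%R s.
  rewrite lt_sorted_uniq_le sort_le_sorted andbT sort_uniq map_inj_in_uniq.
    by apply: filter_uniq; apply: enum_uniq.
  move=> e1 e2; rewrite !mem_filter => /andP[c1 _] /andP[c2 _].
  have [h1 [t1 b1 a1]] := xtP c1; have [h2 [t2 b2 a2]] := xtP c2 => E.
  rewrite -E in a2; case: (eqVneq e1 e2) => // n.
  have [n1 n2] : e != e1 /\ e != e2 by case/andP: c1; case/andP: c2.
  have [/eqP|] := pa_third pa n1 h1 b1 b2 a1 a2; first by rewrite eq_sym (negPf n2).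
  by move=> ->.
have hs x : x \in s -> 0 < x < 1 by case/times_mid=> e' [_ []].
rewrite /= rcons_path; apply/andP; split.
  rewrite lt_path_sortedE s_s andbT; apply/allP=> x /hs/andP[] //.
case: (lastP s) hs => [|s' x] hs /=; first exact: ltr01.
by rewrite last_rcons; have /andP[] : 0 < x < 1 by apply: hs; rewrite mem_rcons mem_head.
Qed.

Lemma times_uniq e : uniq (times e).
Proof. exact: lt_sorted_uniq (times_sorted e). Qed.

Lemma size_times e : (1 < size (times e))%N.
Proof. by rewrite /= size_rcons. Qed.

Lemma times_first e : nth 0 (times e) 0 = 0.
Proof. by []. Qed.

Lemma times_last e : nth 0 (times e) (size (times e)).-1 = 1.
Proof. by rewrite nth_last /= last_rcons. Qed.

Lemma mem_timesP e t : t \in times e ->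
  [\/ t = 0, t = 1 | 0 < t < 1 /\ exists e' t', [/\ e != e', 0 < t' < 1 & arc e t = arc e' t']].
Proof.
rewrite inE mem_rcons inE => /or3P[/eqP->|/eqP->|/times_mid[e' [n [t01 [t' t'01 E]]]]].
- by constructor 1.
- by constructor 2.
constructor 3; split => //; exists e', t'; split=> //.
by apply: (arc_inner (e := e')) => //; rewrite -E; apply: arc_isv.
Qed.

Lemma times_01 e t : t \in times e -> 0 <= t <= 1.
Proof. by case/mem_timesP=> [->|->|[/lt01_le]] //; rewrite ?lexx ler01. Qed.

Lemma crossing_time e e' t t' : e != e' -> 0 <= t <= 1 -> 0 <= t' <= 1 ->
  arc e t = arc e' t' -> t \in times e.
Proof.
move=> n /andP[t0 t1] h' E; move: t0 t1; rewrite !le_eqVlt => /orP[/eqP<- _|t0].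
  by rewrite inE eqxx.
case/orP=> [/eqP->|t1]; first by rewrite inE mem_rcons mem_head orbT.
rewrite inE mem_rcons inE mem_sort; apply/or3P; constructor 3.
have c : crosses e e'.
  by rewrite /crosses n; apply/asboolP; exists t; split; [rewrite t0 t1 | exists t'].
apply/mapP; exists e'; first by rewrite mem_filter c mem_enum.
have [hx [t'' h'' E']] := xtP c.
by apply: (pa_once pa n _ h' _ h'' E E'); apply: lt01_le; rewrite ?t0.
Qed.

Definition nT e := (size (times e)).-1.
Definition tm e i := nth 0 (times e) i.

Lemma nT_gt0 e : (0 < nT e)%N.
Proof. by rewrite /nT; have := size_times e; case: (times e) => [|? []]. Qed.

Lemma size_timesE e : size (times e) = (nT e).+1.
Proof. by []. Qed.

Lemma tm_mem e i : (i <= nT e)%N -> tm e i \in times e.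
Proof. by move=> h; apply: mem_nth; rewrite size_timesE. Qed.

Lemma ltr_tm e i j : (i <= nT e)%N -> (j <= nT e)%N -> (tm e i < tm e j) = (i < j)%N.
Proof. by move=> hi hj; apply: (lt_sorted_ltn_nth 0 (times_sorted e)); rewrite inE size_timesE. Qed.

Lemma ler_tm e i j : (i <= nT e)%N -> (j <= nT e)%N -> (tm e i <= tm e j) = (i <= j)%N.
Proof. by move=> hi hj; rewrite leNgt ltr_tm // -leqNgt. Qed.

Lemma tm_inj e i j : (i <= nT e)%N -> (j <= nT e)%N -> tm e i = tm e j -> i = j.
Proof.
by move=> hi hj /eqP; rewrite nth_uniq ?size_timesE ?times_uniq // => /eqP.
Qed.

Lemma tm_inner e i : (0 < i < nT e)%N -> 0 < tm e i < 1.
Proof.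
case/andP=> i0 iN; have := ltr_tm (leq0n (nT e)) (ltnW iN); rewrite i0 => ->.
by have := ltr_tm (ltnW iN) (leqnn (nT e)); rewrite iN [tm e (nT e)]times_last => ->.
Qed.

Lemma tm_between e i t : (i < nT e)%N -> tm e i <= t <= tm e i.+1 -> t \in times e ->
  t = tm e i \/ t = tm e i.+1.
Proof.
move=> iN /andP[h1 h2] /(nthP 0)[j]; rewrite size_timesE ltnS => jN E; subst t.
rewrite -[nth _ _ _]/(tm e j) in h1 h2; rewrite -/(tm e j).
rewrite !ler_tm // in h1 h2; last exact: ltnW.
by case: ltngtP h1 => // [h _|->]; [right; congr tm; apply/eqP; rewrite eqn_leq h2 | left].
Qed.

Lemma tm_01 e i t : (i < nT e)%N -> tm e i <= t <= tm e i.+1 -> 0 <= t <= 1.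
Proof.
move=> h /andP[h1 h2]; have /andP[a1 _] := times_01 (tm_mem (ltnW h)).
by have /andP[_ a2] := times_01 (tm_mem h); rewrite (le_trans a1) // (le_trans h2).
Qed.

End PlaneArcs.

Section StraightArcs.
Variables (R : realFieldType) (T Ed : finType) (ea eb : Ed -> T) (pos : T -> R * R).
Definition linear_arc e (t : R) : R * R :=
  ((1 - t) * (pos (ea e)).1 + t * (pos (eb e)).1, (1 - t) * (pos (ea e)).2 + t * (pos (eb e)).2).
Hypothesis pa : plane_arcs ea eb pos linear_arc.
Local Notation times := (times linear_arc).
Local Notation tm := (tm linear_arc).
Local Notation nT := (nT linear_arc).
Definition straight_path e := map (linear_arc e) (times e).
Local Notation L := straight_path.

Lemma pnt_straight e i : (i <= nT e)%N -> pnt L e i = linear_arc e (tm e i).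
Proof. by move=> h; rewrite /pnt (nth_map 0) // size_timesE. Qed.

Lemma nL_straight e : nL L e = nT e.
Proof. by rewrite /nL size_map. Qed.

Lemma linear_arc_mix e s t u :
  linear_arc e ((1 - s) * t + s * u) =
  ((1 - s) * (linear_arc e t).1 + s * (linear_arc e u).1,
   (1 - s) * (linear_arc e t).2 + s * (linear_arc e u).2).
Proof. by rewrite /linear_arc /=; congr pair; ring. Qed.

Lemma mem_straight e z : z \in L e -> exists2 t, t \in times e & z = linear_arc e t.
Proof. by case/mapP=> t ? ->; exists t. Qed.

Lemma straight_seg e i z : (i < nT e)%N -> inseg (pnt L e i) (pnt L e i.+1) z ->
  exists2 t, tm e i <= t <= tm e i.+1 & z = linear_arc e t.
Proof.
move=> h; rewrite !pnt_straight //; last exact: ltnW.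
case=> s s01 ->; rewrite -linear_arc_mix; exists ((1 - s) * tm e i + s * tm e i.+1) => //.
have : tm e i < tm e i.+1 by rewrite (ltr_tm pa) //; exact: ltnW.
by move=> lt; apply/andP; split; nra.
Qed.

Lemma straight_path_inseg e z : z \in L e -> inseg (pos (ea e)) (pos (eb e)) z.
Proof. by case/mem_straight=> t /(times_01 pa) t01 ->; exists t. Qed.

(** The polygon of a straight edge is the edge itself, subdivided at its crossings, so it stays on
    the segment joining its ends. *)
Lemma straight_plane_paths : plane_paths ea eb pos L.
Proof.
have inn e t : t \in times e -> ~~ isv pos (linear_arc e t) -> 0 < t < 1.
  by move=> /(times_01 pa) h; apply: (arc_inner pa).
split.
- exact: pa_pos_inj pa.
- by move=> e; rewrite size_map size_times.
- by move=> e; rewrite pnt_straight // -(pa_first pa).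
- by move=> e; rewrite nL_straight pnt_straight // [tm _ _]times_last (pa_last pa).
- move=> e; rewrite map_inj_in_uniq ?(times_uniq pa) // => t t' h h'.
  by apply: (pa_inj pa); apply: (times_01 pa); eassumption.
- move=> e i; rewrite nL_straight => hi; rewrite pnt_straight; last by case/andP: hi => _ /ltnW.
  by apply: (arc_isv pa); apply: (tm_inner pa).
- move=> e i e' j z; rewrite !nL_straight => hi hj ne /(straight_seg hi)[t ht zt] /(straight_seg hj)[t' ht' zt'].
  have t01 := tm_01 pa hi ht; have t'01 := tm_01 pa hj ht'.
  suff : t \in times e.
    case/(tm_between pa hi ht) => E; [left|right]; rewrite zt E pnt_straight //; exact: ltnW.
  rewrite zt in zt'; case: (eqVneq e e') => [E|n]; last exact: (crossing_time pa n t01 t'01).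
  subst e'; have E := pa_inj pa t01 t'01 zt'; subst t'.
  case/andP: ht => h1 h2; case/andP: ht' => h3 h4.
  case: (ltngtP i j) => [lt|lt|E]; last by rewrite E in ne.
    suff -> : t = tm e i.+1 by apply: tm_mem.
    by apply/le_anti; rewrite h2 (le_trans _ h3) // (ler_tm pa) // ltnW.
  suff -> : t = tm e i by apply: tm_mem; rewrite ltnW.
  by apply/le_anti; rewrite h1 (le_trans h4) // (ler_tm pa) // ltnW.
- move=> e e' i ne; rewrite nL_straight => /andP[i0 iN] _.
  have i1 : (i.-1 < i)%N by rewrite prednK.
  have h1 : tm e i.-1 < tm e i by rewrite (ltr_tm pa) //; [rewrite ltnW // (ltn_trans i1) | rewrite ltnW].
  have h2 : tm e i < tm e i.+1 by rewrite (ltr_tm pa) // ltnW.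
  set s := (tm e i - tm e i.-1) / (tm e i.+1 - tm e i.-1).
  have d0 : 0 < tm e i.+1 - tm e i.-1 by lra.
  have sE : s * (tm e i.+1 - tm e i.-1) = tm e i - tm e i.-1 by rewrite divfK // gt_eqF.
  exists s; last first.
    rewrite !pnt_straight //; first by rewrite -linear_arc_mix; congr linear_arc; lra.
      by rewrite ltnW // (ltn_trans i1).
    exact: ltnW.
  by apply/andP; split; [apply: divr_gt0; lra | rewrite /s ltr_pdivrMr ?mul1r; lra].
- move=> e e' z ne /mem_straight[t ht ->] /mem_straight[t' ht' E] nv.
  by apply: (pa_disj pa ne (inn _ _ ht nv) (times_01 pa ht') E).
- move=> e e' e'' z ne /mem_straight[t ht ->] /mem_straight[t' ht' E] /mem_straight[t'' ht'' E'] nv.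
  exact: (pa_third pa ne (inn _ _ ht nv) (times_01 pa ht') (times_01 pa ht'') E E').
- move=> e e' z z' ne /mem_straight[t ht ->] /mem_straight[t' ht' E] /mem_straight[u hu ->] /mem_straight[u' hu' E'].
  by congr linear_arc; apply: (pa_once pa ne _ _ _ _ E E'); apply: (times_01 pa); eassumption.
move=> e e1 e2 _ _ n1 n2 /mem_straight[t1 ht1 ->] /mem_straight[u1 hu1 E1]
  /mem_straight[t2 ht2 ->] /mem_straight[u2 hu2 E2] v1 v2.
by apply: (pa_fan pa n1 n2 (inn _ _ ht1 v1) (inn _ _ ht2 v2) _ _ E1 E2); apply: (times_01 pa); eassumption.
Qed.

End StraightArcs.

End Arcs.

(** * Squared distances *)

Module Distances.
Import PolygonalBound.
Import Order.TTheory GRing.Theory Num.Theory.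
Local Open Scope ring_scope.

Section Distance.
Variable R : rcfType.
Implicit Types (P Q z w c : R * R) (t r : R).

Definition dsq z w : R := (z.1 - w.1) ^+ 2 + (z.2 - w.2) ^+ 2.
Definition mix t P Q : R * R := ((1 - t) * P.1 + t * Q.1, (1 - t) * P.2 + t * Q.2).

Lemma dsqC z w : dsq z w = dsq w z.
Proof. by rewrite /dsq; ring. Qed.

Lemma dsq_ge0 z w : 0 <= dsq z w.
Proof. by rewrite addr_ge0 // sqr_ge0. Qed.

Lemma dsqxx z : dsq z z = 0.
Proof. by rewrite /dsq !subrr expr0n /= addr0. Qed.

Lemma dsq_eq0 z w : (dsq z w == 0) = (z == w).
Proof.
rewrite /dsq paddr_eq0 ?sqr_ge0 // !sqrf_eq0 !subr_eq0.
by case: z w => [? ?] [? ?]; rewrite xpair_eqE.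
Qed.

Lemma dsq_gt0 z w : (0 < dsq z w) = (z != w).
Proof. by rewrite lt_neqAle dsq_ge0 andbT eq_sym dsq_eq0. Qed.

(** From the parallelogram identity. With squared distances the triangle inequality costs a factor
    2, hence the recurring [4 * r]. *)
Lemma dsq_triangle z w w' : dsq w w' <= 2 * dsq z w + 2 * dsq z w'.
Proof.
rewrite -subr_ge0 /dsq.
have -> : 2 * ((z.1 - w.1) ^+ 2 + (z.2 - w.2) ^+ 2) + 2 * ((z.1 - w'.1) ^+ 2 + (z.2 - w'.2) ^+ 2)
  - ((w.1 - w'.1) ^+ 2 + (w.2 - w'.2) ^+ 2)
  = (2 * z.1 - w.1 - w'.1) ^+ 2 + (2 * z.2 - w.2 - w'.2) ^+ 2 by ring.
by rewrite addr_ge0 // sqr_ge0.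
Qed.

(** Stewart's theorem; the last term gives the convexity of discs. *)
Lemma dsq_mix t P Q c :
  dsq (mix t P Q) c = (1 - t) * dsq P c + t * dsq Q c - t * (1 - t) * dsq P Q.
Proof. by rewrite /dsq /mix /=; ring. Qed.

Lemma mix0 P Q : mix 0 P Q = P.
Proof. by case: P => x y; rewrite /mix /=; congr pair; ring. Qed.

Lemma mix1 P Q : mix 1 P Q = Q.
Proof. by case: Q => x y; rewrite /mix /=; congr pair; ring. Qed.

Lemma mixx t P : mix t P P = P.
Proof. by case: P => x y; rewrite /mix /=; congr pair; ring. Qed.

Lemma mixC t P Q : mix t P Q = mix (1 - t) Q P.
Proof. by rewrite /mix /=; congr pair; ring. Qed.

Lemma mix_mix u s t P Q : mix u (mix s P Q) (mix t P Q) = mix ((1 - u) * s + u * t) P Q.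
Proof. by rewrite /mix /=; congr pair; ring. Qed.

Lemma inseg_l P Q : inseg P Q P.
Proof. by exists 0; rewrite ?lexx ?ler01 // -/(mix _ _ _) mix0. Qed.

Lemma inseg_r P Q : inseg P Q Q.
Proof. by exists 1; rewrite ?lexx ?ler01 // -/(mix _ _ _) mix1. Qed.

Lemma insegC P Q z : inseg P Q z -> inseg Q P z.
Proof.
by case=> t t01 ->; exists (1 - t); last exact: mixC; apply/andP; split; lra.
Qed.

Lemma inseg_trans P Q z z' w : inseg P Q z -> inseg P Q z' -> inseg z z' w -> inseg P Q w.
Proof.
case=> s s01 -> [t t01 ->] [u u01 ->]; exists ((1 - u) * s + u * t); last exact: mix_mix.
by move/andP: s01 => [? ?]; move/andP: t01 => [? ?]; move/andP: u01 => [? ?]; apply/andP; split; nra.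
Qed.

Lemma disc_convex P Q z c r : dsq P c <= r -> dsq Q c <= r -> inseg P Q z -> dsq z c <= r.
Proof.
move=> hP hQ [t /andP[t0 t1] ->]; rewrite dsq_mix.
have h : 0 <= t * (1 - t) * dsq P Q by rewrite !mulr_ge0 ?dsq_ge0 ?subr_ge0.
by nra.
Qed.

Lemma ball_convex P Q z c r : dsq P c < r -> dsq Q c < r -> inseg P Q z -> dsq z c < r.
Proof.
move=> hP hQ [t /andP[t0 t1] ->]; rewrite dsq_mix.
have h : 0 <= t * (1 - t) * dsq P Q by rewrite !mulr_ge0 ?dsq_ge0 ?subr_ge0.
have [le|/ltW le] := lerP (dsq P c) (dsq Q c).
  have : 0 <= (1 - t) * (dsq Q c - dsq P c) by rewrite mulr_ge0 ?subr_ge0.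
  by lra.
have : 0 <= t * (dsq P c - dsq Q c) by rewrite mulr_ge0 ?subr_ge0.
by lra.
Qed.

Lemma disc_strict P Q z c r : dsq P c <= r -> dsq Q c <= r -> inseg P Q z -> dsq z c = r ->
  z = P \/ z = Q.
Proof.
move=> hP hQ [t /andP[t0 t1] ->]; rewrite dsq_mix => E.
have h : t * (1 - t) * dsq P Q <= 0 by nra.
case: (eqVneq P Q) => [<-|n]; first by left; rewrite -/(mix _ _ _) mixx.
have d : 0 < dsq P Q by rewrite dsq_gt0.
have : t * (1 - t) <= 0 by rewrite -(pmulr_lle0 _ d).
have [-> _|tn] := eqVneq t 0; first by left; apply: mix0.
have tp : 0 < t by rewrite lt_neqAle eq_sym tn.
rewrite pmulr_rle0 // subr_le0 => t1'.
by right; have -> : t = 1; [apply/le_anti/andP; split | apply: mix1].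
Qed.

(** The point [q] is the last one of the segment in the disc: its parameter [t0] is the larger root
    of the quadratic giving the squared distance to [c]. *)
Lemma disc_exit x y c r : dsq x c <= r -> r < dsq y c ->
  exists q, [/\ inseg x y q, dsq q c = r & forall z, inseg q y z -> dsq z c <= r -> z = q].
Proof.
move=> hx hy; pose A := dsq x y; pose C := dsq x c.
pose B := 2 * ((x.1 - c.1) * (y.1 - x.1) + (x.2 - c.2) * (y.2 - x.2)).
have fE t : dsq (mix t x y) c = A * t ^+ 2 + B * t + C by rewrite /A /B /C /dsq /mix /=; ring.
have f1 : r < A + B + C.
  have := fE 1; rewrite mix1 expr1n !mulr1 => E; by rewrite -E.
have hC : C <= r by [].
have A0 : 0 < A by rewrite dsq_gt0; apply/eqP=> E; move: hx; rewrite E leNgt hy.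
pose D := B ^+ 2 - 4 * A * (C - r); pose s := Num.sqrt D.
have BD : B ^+ 2 <= D by rewrite /D; nra.
have s0 : 0 <= s by apply: sqrtr_ge0.
have sE : s ^+ 2 = D by rewrite sqr_sqrtr // (le_trans _ BD) // sqr_ge0.
have sB : B <= s by rewrite leNgt; apply/negP=> lt; nra.
pose t0 := (s - B) / (2 * A).
have t0E : 2 * A * t0 = s - B by rewrite /t0 mulrC divfK // gt_eqF //; lra.
have t0_ge0 : 0 <= t0 by rewrite divr_ge0 ?subr_ge0 //; lra.
have AB : 0 < 2 * A + B by lra.
have sA : s < 2 * A + B.
  rewrite ltNge; apply/negP=> le.
  have h1 : (2 * A + B) ^+ 2 <= s ^+ 2 by rewrite ler_sqr ?nnegrE // ltW.
  have h2 : 0 < A * (A + B + C - r) by rewrite mulr_gt0 // subr_gt0.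
  by rewrite sE /D in h1; nra.
have t0_lt1 : t0 < 1 by rewrite /t0 ltr_pdivrMr; lra.
have f0 : dsq (mix t0 x y) c = r.
  rewrite fE; have h : 4 * A * (A * t0 ^+ 2 + B * t0 + C - r) = 0.
    have -> : 4 * A * (A * t0 ^+ 2 + B * t0 + C - r)
      = (2 * A * t0 + B) ^+ 2 - (B ^+ 2 - 4 * A * (C - r)) by ring.
    by rewrite t0E subrK sE /D subrr.
  move/eqP: h; rewrite mulf_eq0 mulf_eq0 pnatr_eq0 /= (gt_eqF A0) /=.
  by rewrite subr_eq0 => /eqP.
exists (mix t0 x y); split=> //; first by exists t0; rewrite ?t0_ge0 ?ltW.
move=> z [v /andP[v0 v1] ->]; rewrite -/(mix _ _ _).
have -> : mix v (mix t0 x y) y = mix (t0 + v * (1 - t0)) x y by rewrite /mix /=; congr pair; ring.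
set t := t0 + _; move=> h; congr mix; apply/eqP; rewrite eq_le; apply/andP; split; last first.
  by rewrite /t lerDl mulr_ge0 // subr_ge0 ltW.
rewrite leNgt; apply/negP=> lt; move: h; rewrite leNgt => /negP; apply.
rewrite -f0 !fE -subr_gt0.
have -> : A * t ^+ 2 + B * t + C - (A * t0 ^+ 2 + B * t0 + C) = (t - t0) * (A * (t - t0) + (2 * A * t0 + B)) by ring.
rewrite t0E subrK; apply: mulr_gt0; first by rewrite subr_gt0.
by rewrite ltr_pwDl // mulr_gt0 // subr_gt0.
Qed.

End Distance.

End Distances.

(** * Polygons with fewest vertices *)

Module ShortestPolygons.
Import PolygonalBound Distances.
Import Order.TTheory GRing.Theory Num.Theory.
Local Open Scope ring_scope.

Section ShortestPolygon.
Variable R : rcfType.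
Local Notation pt := (R * R)%type.
Variables (U : pt -> Prop) (A B : pt) (r : R).
Local Notation o := ((0 : R), (0 : R)).
Implicit Types (s : seq pt) (P Q z : pt).

Definition seg_in P Q := `[< forall z, inseg P Q z -> U z >].
Definition polygon s :=
  [/\ (0 < size s)%N, sorted seg_in s, dsq (head o s) A <= r & dsq (last o s) B <= r].
(** Length is the number of vertices, so a minimum exists because [nat] is well ordered. *)
Definition shortest s := polygon s /\ forall s', polygon s' -> (size s <= size s')%N.

Hypothesis AB_far : 4 * r < dsq A B.

Lemma disc_disj z : dsq z A <= r -> dsq z B <= r -> False.
Proof. by move=> h1 h2; have := dsq_triangle z A B; have := AB_far; lra. Qed.

Lemma seg_inP P Q z : seg_in P Q -> inseg P Q z -> U z.
Proof. by move/asboolP; apply. Qed.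

Lemma seg_in_sub P Q P' Q' : seg_in P Q -> inseg P Q P' -> inseg P Q Q' -> seg_in P' Q'.
Proof. by move/asboolP=> h hP hQ; apply/asboolP=> z /(inseg_trans hP hQ)/h. Qed.

Lemma polygon_split s i : polygon s -> (i < size s)%N ->
  sorted seg_in (rcons (take i s) (nth o s i)) /\ path seg_in (nth o s i) (drop i.+1 s).
Proof.
case=> _ h _ _ hi; move: h; rewrite -{1}(cat_take_drop i s) (drop_nth o hi) sorted_cat_cons.
by case/andP.
Qed.

Lemma polygon_seg s i : polygon s -> (i.+1 < size s)%N -> seg_in (nth o s i) (nth o s i.+1).
Proof. by case=> _ /(sortedP o) h _ _; apply: h. Qed.

Let last_drop s i : (i < size s)%N -> last (nth o s i) (drop i.+1 s) = last o s.
Proof. by move=> hi; rewrite -{3}(cat_take_drop i s) (drop_nth o hi) last_cat. Qed.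

Let head_take s i : (i < size s)%N -> head o (rcons (take i s) (nth o s i)) = head o s.
Proof.
move=> hi; rewrite -{3}(cat_take_drop i s) (drop_nth o hi).
by case: (take i s).
Qed.

Lemma polygon_bypass s i j t : polygon s -> (i < size s)%N -> (j < size s)%N ->
  path seg_in (nth o s i) (rcons t (nth o s j)) ->
  polygon (rcons (take i s) (nth o s i) ++ t ++ nth o s j :: drop j.+1 s).
Proof.
move=> p hi hj; have [p1 p2] := polygon_split p hi; have [q1 q2] := polygon_split p hj.
rewrite rcons_path => /andP[t1 t2]; case: p => _ _ hA hB; split.
- by rewrite size_cat size_rcons.
- rewrite cat_rcons sorted_cat_cons p1 cat_path t1 /=.
  by rewrite q2 t2.
- by rewrite -(head_take hi) in hA; move: hA; case: (take i s).
by rewrite !last_cat /= (last_drop hj).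
Qed.

Lemma shortest_bypass s i j t : shortest s -> (i < j)%N -> (j < size s)%N ->
  path seg_in (nth o s i) (rcons t (nth o s j)) -> (j <= i.+1 + size t)%N.
Proof.
move=> [p m] ij hj h; have := m _ (polygon_bypass p (ltn_trans ij hj) hj h).
rewrite !size_cat size_rcons /= size_drop size_takel; last by rewrite ltnW // (ltn_trans ij).
by lia.
Qed.

Lemma shortest_start s i z : shortest s -> (i < size s)%N -> dsq z A <= r ->
  seg_in z (nth o s i) -> (i <= 1)%N.
Proof.
move=> [p m] hi hz h; have [_ p2] := polygon_split p hi.
have /m : polygon (z :: nth o s i :: drop i.+1 s).
  by split=> //=; [rewrite h p2 | case: p => _ _ _; rewrite (last_drop hi)].
by rewrite /= size_drop; lia.
Qed.

Lemma shortest_end s i z : shortest s -> (i < size s)%N -> dsq z B <= r ->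
  seg_in (nth o s i) z -> (size s <= i.+2)%N.
Proof.
move=> [p m] hi hz h; have [p1 _] := polygon_split p hi.
have /m : polygon (rcons (rcons (take i s) (nth o s i)) z).
  split=> //; first by rewrite !size_rcons.
  - by rewrite -cats1 cat_rcons sorted_cat_cons p1 /= h.
  - case: p => _ _ hA _; rewrite -(head_take hi) in hA; move: hA.
    by case: (take i s).
  by rewrite last_rcons.
by rewrite !size_rcons size_takel // ltnW.
Qed.

Lemma seg_inxx s i z : polygon s -> (i.+1 < size s)%N -> inseg (nth o s i) (nth o s i.+1) z ->
  [/\ seg_in (nth o s i) z, seg_in z (nth o s i.+1) & seg_in z z].
Proof.
move=> p hi h; have g := polygon_seg p hi.
by split; apply: (seg_in_sub g) => //; [apply: inseg_l | apply: inseg_r].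
Qed.

Lemma shortest_size s : shortest s -> (1 < size s)%N.
Proof.
case=> -[h0 h1 h2 h3] _; move: h0 h2 h3; case: s {h1} => [|x [|]] //= _ h2 h3.
by case: (disc_disj h2 h3).
Qed.

(** At a repeated vertex the polygon can skip what lies between, or stop at the earlier occurrence
    if the later one is the last vertex. *)
Lemma polygon_uniq s : shortest s -> uniq s.
Proof.
move=> ss; apply/(uniqPn o) => -[i [j [ij hj E]]].
have p := ss.1; case: j ij hj E => // j ij hj E.
have hi : (i.+1 < size s)%N by apply: leq_ltn_trans hj.
case: (ltnP j.+2 (size s)) => h.
  suff : (j.+2 <= i.+1)%N by lia.
  have := @shortest_bypass s i j.+2 [::] ss _ h; rewrite addn0; apply; first lia.
  by rewrite /= E (polygon_seg p h).
have szE : size s = j.+2 by apply/eqP; rewrite eqn_leq h hj.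
have hB : dsq (nth o s j.+1) B <= r by rewrite -[j.+1]/(j.+2.-1) -szE nth_last; case: p.
case: i => [|i] in ij E hi *.
  apply: (@disc_disj (nth o s 0)); first by rewrite nth0; case: p.
  by rewrite E.
have := @shortest_end s i (nth o s j.+1) ss (ltn_trans (leqnn _) (ltnW hi)) hB.
rewrite -E (polygon_seg p (ltnW hi)) szE => /(_ isT); move: ij; clear; lia.
Qed.

Let coordE (u a t p q q' : R) : u != 0 -> u * a = 1 - t ->
  (1 - t) * p + t * q = (1 - u) * q + u * q' -> q' = (1 - (1 - a)) * p + (1 - a) * q.
Proof.
move=> u0 ua E; apply: (mulfI u0).
have -> : u * ((1 - (1 - a)) * p + (1 - a) * q) = (u * a) * p + (u - u * a) * q by ring.
by rewrite ua; lra.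
Qed.

Let inseg_ratio P Q Q' t u : 0 <= 1 - t <= u -> 0 < u -> mix t P Q = mix u Q Q' -> inseg P Q Q'.
Proof.
move=> /andP[t1 tu] u0 []; have ua : u * ((1 - t) / u) = 1 - t by rewrite mulrC divfK // gt_eqF.
move=> /(coordE (negbT (gt_eqF u0)) ua) E1 /(coordE (negbT (gt_eqF u0)) ua) E2.
exists (1 - (1 - t) / u); last by case: Q' E1 E2 => /= ? ? <- <-.
apply/andP; split; last by rewrite gerBl divr_ge0 // ltW.
by rewrite subr_ge0 ler_pdivrMr // mul1r.
Qed.

(** Consecutive segments that meet outside their common vertex overlap, so one contains the far end
    of the other. *)
Lemma collinear_cases P Q Q' z : inseg P Q z -> inseg Q Q' z -> z <> Q ->
  inseg P Q Q' \/ inseg Q Q' P.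
Proof.
move=> [t /andP[t0 t1] zE] [u /andP[u0 u1]]; rewrite zE => E n.
have t1' : 0 < 1 - t.
  rewrite subr_gt0 lt_neqAle t1 andbT; apply/eqP=> E1; apply: n; rewrite E1; exact: mix1.
have u0' : 0 < u.
  rewrite lt_neqAle u0 andbT eq_sym; apply/eqP=> E1; apply: n; rewrite E E1; exact: mix0.
case: (lerP (1 - t) u) => h.
  by left; apply: (inseg_ratio _ u0' E); rewrite h ltW.
right; apply: insegC; apply: (@inseg_ratio Q' Q P (1 - u) (1 - t)) => //.
  by rewrite subKr u0 ltW.
by rewrite -(mixC u) -(mixC t) -/(mix t P Q) in E *; symmetry.
Qed.

Lemma shortest_simple s i j z : shortest s -> (i < j)%N -> (j.+1 < size s)%N ->
  inseg (nth o s i) (nth o s i.+1) z -> inseg (nth o s j) (nth o s j.+1) z ->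
  j = i.+1 /\ z = nth o s j.
Proof.
move=> ss ij hj hz hz'; have p := ss.1.
have hi : (i.+1 < size s)%N by apply: leq_ltn_trans (ltnW hj).
have [a1 a2 a3] := seg_inxx p hi hz; have [b1 b2 b3] := seg_inxx p hj hz'.
have E : j = i.+1.
  have := @shortest_bypass s i j.+1 [:: z] ss (leqW ij) hj.
  rewrite /= a1 b2 => /(_ isT); lia.
split=> //; apply: contrapT => n; rewrite E in hz' n hj.
have /= bypass := @shortest_bypass s i i.+2 [::] ss (leqW (leqnn _)) hj.
suff : seg_in (nth o s i) (nth o s i.+2).
  by move=> h; have := bypass; rewrite h => /(_ isT); lia.
case: (collinear_cases hz hz' n) => h.
  by apply: (seg_in_sub (polygon_seg p hi)) => //; apply: inseg_l.
by apply: (seg_in_sub (polygon_seg p hj)) => //; apply: inseg_r.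
Qed.

Lemma shortest_hits_start s i z : shortest s -> (i.+1 < size s)%N ->
  inseg (nth o s i) (nth o s i.+1) z -> dsq z A <= r -> i = 0%N.
Proof.
move=> ss hi hz hr; have [_ h _] := seg_inxx ss.1 hi hz.
by have := shortest_start ss hi hr h; case: i {hi hz h}.
Qed.

Lemma shortest_hits_end s i z : shortest s -> (i.+1 < size s)%N ->
  inseg (nth o s i) (nth o s i.+1) z -> dsq z B <= r -> size s = i.+2.
Proof.
move=> ss hi hz hr; have [h _ _] := seg_inxx ss.1 hi hz.
by apply/eqP; rewrite eqn_leq hi andbT; apply: shortest_end h => //; apply: ltnW.
Qed.

(** The second vertex lies outside the first disc, or the first vertex could be dropped. So the
    first segment leaves the disc, and the polygon may start at its exit point; likewise at the
    other end. *)
Lemma shortest_trim s : shortest s -> exists s', shortest s' /\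
  [/\ dsq (head o s') A = r, dsq (last o s') B = r,
      forall z, inseg (nth o s' 0) (nth o s' 1) z -> dsq z A <= r -> z = head o s' &
      forall z, inseg (nth o s' (size s').-2) (nth o s' (size s').-1) z -> dsq z B <= r ->
        z = last o s'].
Proof.
move=> ss; have s2 := shortest_size ss.
have [x [m [v sE]]] : exists x m v, s = x :: rcons m v.
  case: s {ss} s2 => [|x [|y s]] // _; by exists x, (belast y s), (last y s); rewrite -lastI.
subst s; have [[_ /= pth hA hB] min] := ss; rewrite last_rcons in hB.
have rE : rcons m v = head v m :: behead (rcons m v) by case: (m).
have hy : r < dsq (head v m) A.
  rewrite ltNge; apply/negP=> h.
  have /min : polygon (rcons m v).
    split; rewrite ?last_rcons ?size_rcons //; rewrite rE //.
    by move: pth; rewrite rE /= => /andP[].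
  by rewrite /= ltnn.
have [q [q1 q2 q3]] := disc_exit hA hy.
have pth' : path seg_in q (rcons m v).
  move: pth; rewrite rE /= => /andP[p1 ->]; rewrite andbT.
  by apply: seg_in_sub p1 q1 (inseg_r _ _).
have /andP[pm pv] : path seg_in q m && seg_in (last q m) v by rewrite -rcons_path.
have hu : r < dsq (last q m) B.
  rewrite ltNge; apply/negP=> h.
  have /min : polygon (q :: m) by split=> //=; rewrite q2.
  by rewrite /= size_rcons ltnn.
have [q' [q'1 q'2 q'3]] := disc_exit hB hu.
exists (q :: rcons m q').
have p' : polygon (q :: rcons m q').
  split=> //=; rewrite ?last_rcons ?q2 ?q'2 // rcons_path pm.
  by apply: seg_in_sub pv (inseg_l _ _) _; apply: insegC.
split; first by split=> // s' /min; rewrite /= !size_rcons.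
split=> //=; rewrite ?last_rcons //.
  have hd : inseg q (head v m) (nth o (rcons m q') 0).
    by case: (m) q'1 => [/insegC|w m'] //= _; apply: inseg_r.
  by move=> z hz; apply: q3; apply: inseg_trans (inseg_l _ _) hd hz.
move=> z; rewrite size_rcons /= nth_rcons ltnn eqxx => hz; apply: q'3; apply: insegC.
suff <- : nth o (q :: rcons m q') (size m) = last q m by [].
rewrite (last_nth o); case: (m) => //= w m'.
by rewrite -rcons_cons nth_rcons ltnSn.
Qed.

End ShortestPolygon.

End ShortestPolygons.

(** * Chords and radii of a disc *)

Module Circles.
Import PolygonalBound PlanePathsBound Distances.
Import Order.TTheory GRing.Theory Num.Theory.
Local Open Scope ring_scope.

Section Adjacent.
Variables (X : eqType) (o : X).
Implicit Types (s : seq X) (P Q x y : X).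

Fixpoint adj s P Q : bool :=
  if s is x :: s' then
    (if s' is y :: _ then (P == x) && (Q == y) else false) || adj s' P Q
  else false.

Lemma adj_cat s1 x s2 P Q : adj (s1 ++ x :: s2) P Q = adj (rcons s1 x) P Q || adj (x :: s2) P Q.
Proof.
elim: s1 => [//|y s1 IH]; rewrite cat_cons rcons_cons /=.
rewrite IH -orbA; congr orb.
by case: s1 {IH}.
Qed.

Lemma adjP s P Q : reflect (exists2 i, (i.+1 < size s)%N & P = nth o s i /\ Q = nth o s i.+1) (adj s P Q).
Proof.
elim: s => [|x [|y s] IH]; [by right; case | by right; case |].
have -> : adj [:: x, y & s] P Q = (P == x) && (Q == y) || adj (y :: s) P Q by [].
apply: (iffP orP) => [[/andP[/eqP-> /eqP->]|h]|[[|i] hi [EP EQ]]].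
- by exists 0%N.
- by have [i hi h'] := elimT IH h; exists i.+1.
- by left; rewrite EP EQ !eqxx.
by right; apply: (introT IH); exists i.
Qed.

End Adjacent.

Lemma adj_mem (X : eqType) (s : seq X) P Q : adj s P Q -> P \in s /\ Q \in s.
Proof. by case/(adjP P)=> i hi [-> ->]; rewrite !mem_nth // ltnW. Qed.


Section Circle.
Variable R : rcfType.
Implicit Types (P Q z c n : R * R) (r t : R).

Lemma mix_inj P Q t u : P != Q -> mix t P Q = mix u P Q -> t = u.
Proof.
move=> ne []; case: P Q ne => [p1 p2] [q1 q2]; rewrite xpair_eqE negb_and => /orP[] n E1 E2 /=.
  by apply: (mulIf (x := q1 - p1)); [rewrite subr_eq0 eq_sym | rewrite /= in E1; lra].
by apply: (mulIf (x := q2 - p2)); [rewrite subr_eq0 eq_sym | rewrite /= in E2; lra].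
Qed.

Lemma line_circle P Q t n r : P != Q -> dsq P n = r -> dsq Q n = r ->
  dsq (mix t P Q) n = r -> mix t P Q = P \/ mix t P Q = Q.
Proof.
move=> ne hP hQ; rewrite dsq_mix hP hQ => E.
have : t * (1 - t) * dsq P Q == 0 by apply/eqP; lra.
rewrite mulf_eq0 dsq_eq0 (negPf ne) orbF mulf_eq0 subr_eq0 => /orP[/eqP->|/eqP<-].
  by left; apply: mix0.
by right; apply: mix1.
Qed.

Lemma chord_meet P Q P' Q' n r c c' : P != Q -> P' != P -> P' != Q ->
  dsq P n = r -> dsq Q n = r -> dsq P' n = r ->
  inseg P Q c -> inseg P' Q' c -> inseg P Q c' -> inseg P' Q' c' -> c = c'.
Proof.
move=> ne n1 n2 hP hQ hP' [t _ ->] [u _ E] [t' _ ->] [u' _ E'].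
rewrite -!/(mix _ _ _) in E E' *.
have [uu|nu] := eqVneq u u'; first by rewrite E E' uu.
have d : u' - u != 0 by rewrite subr_eq0 eq_sym.
(* [P'] has parameter 0 on its chord and is extrapolated from the points with parameters [u] and
   [u']. *)
pose l := u' / (u' - u); have lE : l * (u' - u) = u' by rewrite divfK.
have PE : P' = mix (l * t + (1 - l) * t') P Q.
  have -> : mix (l * t + (1 - l) * t') P Q = mix (1 - l) (mix t P Q) (mix t' P Q).
    by rewrite mix_mix subKr.
  rewrite E E' mix_mix subKr; have -> : l * u + (1 - l) * u' = 0 by lra.
  by rewrite mix0.
case/eqP: n1; rewrite PE in hP' n2 *.
by case: (line_circle ne hP hQ hP') => // h; rewrite h eqxx in n2.
Qed.

Lemma radii_meet n q q' r z : dsq q n = r -> dsq q' n = r -> q != q' ->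
  inseg n q z -> inseg n q' z -> z = n.
Proof.
move=> hq hq' ne [t /andP[t0 _] ->] [u /andP[u0 _] E]; rewrite -!/(mix _ _ _) in E *.
have dE v w : dsq (mix v n w) n = v ^+ 2 * dsq w n by rewrite /dsq /mix /=; ring.
have := dE t q; rewrite E dE hq hq' => E2.
have [r0|r0] := eqVneq r 0.
  have qn : q = n by apply/eqP; rewrite -dsq_eq0 hq r0.
  have qn' : q' = n by apply/eqP; rewrite -dsq_eq0 hq' r0.
  by rewrite ?qn ?qn' mixx.
have tu : t = u by apply/eqP; rewrite -(eqrXn2 (n := 2)) //; apply/eqP; apply: (mulIf r0).
rewrite -tu in E; have [t00|tn] := eqVneq t 0; first by rewrite -tu t00 mix0.
case/negP: ne; apply/eqP; case: E => E3 E4.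
case: q q' E3 E4 {hq hq'} => [a b] [a' b'] /= E3 E4.
by congr pair; apply: (mulfI tn); lra.
Qed.

Lemma dsq_gt0_inner P Q n r t : P != Q -> dsq P n = r -> dsq Q n = r -> 0 < t < 1 ->
  dsq (mix t P Q) n < r.
Proof.
move=> ne hP hQ /andP[t0 t1]; rewrite dsq_mix hP hQ.
have : 0 < t * (1 - t) * dsq P Q by rewrite !mulr_gt0 ?subr_gt0 ?dsq_gt0.
lra.
Qed.

Lemma meet_at P Q c z : P != Q -> (exists2 t, 0 < t < 1 & c = mix t P Q) ->
  inseg P c z -> inseg c Q z -> z = c.
Proof.
move=> ne [t /andP[t0 t1] ->] [u /andP[u0 u1] ->] [v /andP[v0 v1]]; rewrite -!/(mix _ _ _).
have -> : mix u P (mix t P Q) = mix (u * t) P Q by rewrite /mix /=; congr pair; ring.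
have -> : mix v (mix t P Q) Q = mix (t + v * (1 - t)) P Q by rewrite /mix /=; congr pair; ring.
move=> /(mix_inj ne) E; congr mix; rewrite E; nra.
Qed.

End Circle.

End Circles.

(** * Joining the polygons inside the discs *)

Module Assembly.
Import PolygonalBound PlanePathsBound Distances Circles.
Import Order.TTheory GRing.Theory Num.Theory.
Local Open Scope ring_scope.

Section Assembly.
Variables (R : rcfType) (T Ed : finType) (ea eb : Ed -> T) (pos : T -> R * R).
Variables (k : Ed -> nat) (node : Ed -> nat -> R * R) (pi : Ed -> nat -> seq (R * R)) (r : R).
Local Notation pt := (R * R)%type.
Local Notation o := ((0 : R), (0 : R)).
Local Notation ends := (ends ea eb).
Implicit Types (e : Ed) (i j : nat) (P Q z c n : pt).

Definition is_node n := (exists v, n = pos v) \/ (exists e i, (i <= k e)%N /\ n = node e i).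
Definition hd e i := head o (pi e i).
Definition tl e i := last o (pi e i).

Hypothesis pos_inj : injective pos.
Hypothesis r_gt0 : 0 < r.
Hypothesis k_gt0 : forall e, (0 < k e)%N.
Hypothesis node_first : forall e, node e 0 = pos (ea e).
Hypothesis node_last : forall e, node e (k e) = pos (eb e).
Hypothesis node_inner : forall e i v, (0 < i < k e)%N -> node e i <> pos v.
Hypothesis node_inj : forall e i j, (i <= k e)%N -> (j <= k e)%N -> node e i = node e j -> i = j.
Hypothesis node_far : forall n n' z, is_node n -> is_node n' -> dsq z n <= r -> dsq z n' <= r -> n = n'.
Hypothesis node_once : forall e e' i i' j j', e != e' -> (i <= k e)%N -> (i' <= k e')%N ->
  (j <= k e)%N -> (j' <= k e')%N -> node e i = node e' i' -> node e j = node e' j' -> i = j.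
Hypothesis node_disj : forall e e' i i', e != e' -> (0 < i < k e)%N -> (i' <= k e')%N ->
  node e i = node e' i' -> [disjoint ends e & ends e'].
Hypothesis node_third : forall e e' e'' i i' i'', e != e' -> (0 < i < k e)%N -> (i' <= k e')%N ->
  (i'' <= k e'')%N -> node e i = node e' i' -> node e i = node e'' i'' -> e'' = e \/ e'' = e'.
Hypothesis node_fan : forall e e1 e2 i1 i2 j1 j2, e1 != e -> e2 != e -> (0 < i1 < k e)%N ->
  (0 < i2 < k e)%N -> (j1 <= k e1)%N -> (j2 <= k e2)%N -> node e i1 = node e1 j1 ->
  node e i2 = node e2 j2 -> ~~ [disjoint ends e1 & ends e2].
Hypothesis pi_size : forall e i, (i < k e)%N -> (1 < size (pi e i))%N.
Hypothesis pi_uniq : forall e i, (i < k e)%N -> uniq (pi e i).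
Hypothesis pi_hd : forall e i, (i < k e)%N -> dsq (hd e i) (node e i) = r.
Hypothesis pi_tl : forall e i, (i < k e)%N -> dsq (tl e i) (node e i.+1) = r.
Hypothesis pi_hit : forall e i P Q z n, (i < k e)%N -> adj (pi e i) P Q -> inseg P Q z ->
  is_node n -> dsq z n <= r ->
  [/\ n = node e i, z = hd e i & z = P] \/ [/\ n = node e i.+1, z = tl e i & z = Q].
Hypothesis pi_simple : forall e i P Q P' Q' z, (i < k e)%N -> adj (pi e i) P Q ->
  adj (pi e i) P' Q' -> P != P' -> inseg P Q z -> inseg P' Q' z -> z = P \/ z = Q.
Hypothesis pi_disj : forall e i e' i' P Q P' Q' z, (i < k e)%N -> (i' < k e')%N ->
  (e, i) != (e', i') -> adj (pi e i) P Q -> adj (pi e' i') P' Q' ->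
  inseg P Q z -> inseg P' Q' z -> False.

Lemma node_pos v : is_node (pos v). Proof. by left; exists v. Qed.
Lemma node_node e i : (i <= k e)%N -> is_node (node e i).
Proof. by right; exists e, i. Qed.

Lemma pi_mem_adj e i z : (i < k e)%N -> z \in pi e i ->
  exists P Q, adj (pi e i) P Q /\ inseg P Q z.
Proof.
move=> hi; have := pi_size hi; case: (pi e i) => [|x s] // hs /(nthP o)[j hj <-].
case: (ltnP j.+1 (size (x :: s))) => h.
  exists (nth o (x :: s) j), (nth o (x :: s) j.+1); split; last exact: inseg_l.
  by apply/(adjP o); exists j.
case: j h hj => [|j] h hj; first by rewrite /= in hs h hj; lia.
exists (nth o (x :: s) j), (nth o (x :: s) j.+1); split; last exact: inseg_r.
by apply/(adjP o); exists j.
Qed.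

Lemma pi_mem_hit e i z n : (i < k e)%N -> z \in pi e i -> is_node n -> dsq z n <= r ->
  (n = node e i /\ z = hd e i) \/ (n = node e i.+1 /\ z = tl e i).
Proof.
move=> hi /(pi_mem_adj hi)[P [Q [a s]]] nn hr.
by case: (pi_hit hi a s nn hr) => -[]; [left | right].
Qed.

Lemma pi_mem_circle e i z n : (i < k e)%N -> z \in pi e i -> is_node n -> dsq z n <= r ->
  dsq z n = r.
Proof.
by move=> hi zi nn hr; case: (pi_mem_hit hi zi nn hr) => -[-> ->]; [apply: pi_hd | apply: pi_tl].
Qed.

Lemma pi_mem_disj e i e' i' z : (i < k e)%N -> (i' < k e')%N -> z \in pi e i -> z \in pi e' i' ->
  e = e' /\ i = i'.
Proof.
move=> hi hi' /(pi_mem_adj hi)[P [Q [a s]]] /(pi_mem_adj hi')[P' [Q' [a' s']]].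
case: (eqVneq (e, i) (e', i')) => [[-> ->] //|ne].
by case: (pi_disj hi hi' ne a a' s s').
Qed.

Lemma hd_mem e i : (i < k e)%N -> hd e i \in pi e i.
Proof. by move=> /pi_size; rewrite /hd; case: (pi e i) => // x s _; rewrite mem_head. Qed.

Lemma tl_mem e i : (i < k e)%N -> tl e i \in pi e i.
Proof. by move=> /pi_size; rewrite /tl; case: (pi e i) => // x s _; exact: (mem_last x s). Qed.

Let pred_lt e i : (0 < i < k e)%N -> (i.-1 < k e)%N.
Proof. by lia. Qed.
Let inner_lt e i : (0 < i < k e)%N -> (i < k e)%N. Proof. by case/andP. Qed.
Let inner_le e i : (0 < i < k e)%N -> (i <= k e)%N. Proof. by case/andP=> _ /ltnW. Qed.
Hint Resolve inner_lt inner_le pred_lt : core.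

Lemma pi_tl_pred e i : (0 < i < k e)%N -> dsq (tl e i.-1) (node e i) = r.
Proof. by move=> h; have := pi_tl (pred_lt h); rewrite prednK //; case/andP: h. Qed.

Lemma tl_neq_hd e i : (0 < i < k e)%N -> tl e i.-1 != hd e i.
Proof.
move=> h; apply/eqP=> E; have := hd_mem (inner_lt h); rewrite -E => m.
by have [_] := pi_mem_disj (pred_lt h) (inner_lt h) (tl_mem (pred_lt h)) m; lia.
Qed.

(* The chords of [e] and of the other edge through its [i]-th node meet in [c]. *)
Definition meeting e i c := (0 < i < k e)%N /\ exists e' i', [/\ e != e', (0 < i' < k e')%N,
  node e i = node e' i', inseg (tl e i.-1) (hd e i) c & inseg (tl e' i'.-1) (hd e' i') c].

Lemma chord_ends e i e' i' z : (0 < i < k e)%N -> (0 < i' < k e')%N -> e != e' ->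
  z \in [:: tl e' i'.-1; hd e' i'] -> (z != tl e i.-1) /\ (z != hd e i).
Proof.
move=> hi hi' ne m.
have [j hj zj] : exists2 j, (j < k e')%N & z \in pi e' j.
  move: m; rewrite !inE => /orP[]/eqP->; first by exists i'.-1; [apply: pred_lt | apply: tl_mem; apply: pred_lt].
  by exists i'; [apply: inner_lt | apply: hd_mem; apply: inner_lt].
split; apply/eqP=> E; rewrite E in zj.
  by have [E' _] := pi_mem_disj (pred_lt hi) hj (tl_mem (pred_lt hi)) zj; rewrite E' eqxx in ne.
by have [E' _] := pi_mem_disj (inner_lt hi) hj (hd_mem (inner_lt hi)) zj; rewrite E' eqxx in ne.
Qed.

Lemma meeting_uniq e i c c' : meeting e i c -> meeting e i c' -> c = c'.
Proof.
case=> hi [e1 [i1 [n1 h1 E1 s1 t1]]] [_ [e2 [i2 [n2 h2 E2 s2 t2]]]].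
have E : e2 = e1.
  have [E|//] := node_third n1 hi (inner_le h1) (inner_le h2) E1 E2.
  by rewrite E eqxx in n2.
subst e2; have E : i2 = i1 by exact: (node_inj (inner_le h2) (inner_le h1) (etrans (esym E2) E1)).
subst i2.
have [a1 a2] : tl e1 i1.-1 != tl e i.-1 /\ tl e1 i1.-1 != hd e i.
  by apply: (chord_ends hi h1 n1); rewrite mem_head.
apply: (chord_meet (tl_neq_hd hi) a1 a2 (pi_tl_pred hi) (pi_hd (inner_lt hi)) _ s1 t1 s2 t2).
by rewrite E1 pi_tl_pred.
Qed.

(** If an end of the chord of [e] lay on the other chord, it would be one of its ends, being on the
    circle; but polygons of different edges are disjoint. *)
Lemma meeting_inner e i c : meeting e i c -> exists2 t, 0 < t < 1 & c = mix t (tl e i.-1) (hd e i).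
Proof.
case=> hi [e' [i' [ne h' E [t /andP[t0 t1] cE] s']]]; rewrite -/(mix _ _ _) in cE.
have no z : z \in [:: tl e i.-1; hd e i] -> c <> z.
  move=> m cz; have ne' : e' != e by rewrite eq_sym.
  have [n1 n2] := chord_ends h' hi ne' m.
  have zr : dsq z (node e i) = r.
    by move: m; rewrite !inE => /orP[]/eqP->; [apply: pi_tl_pred | apply/pi_hd/inner_lt].
  have b1 : dsq (tl e' i'.-1) (node e i) <= r by rewrite E pi_tl_pred.
  have b2 : dsq (hd e' i') (node e i) <= r by rewrite E (pi_hd (inner_lt h')).
  rewrite -cz in zr n1 n2; case: (disc_strict b1 b2 s' zr) => h.
    by rewrite h eqxx in n1.
  by rewrite h eqxx in n2.
exists t => //; rewrite !lt_neqAle t0 t1 !andbT; apply/andP; split; apply/eqP=> E'.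
  by apply: (no (tl e i.-1)); rewrite ?mem_head // cE -E' mix0.
by apply: (no (hd e i)); rewrite ?inE ?eqxx ?orbT // cE E' mix1.
Qed.

Lemma meeting_dsq e i c : meeting e i c -> dsq c (node e i) < r.
Proof.
move=> m; have [hi _] := m; have [t t01 ->] := meeting_inner m.
by apply: dsq_gt0_inner (tl_neq_hd hi) (pi_tl_pred hi) (pi_hd (inner_lt hi)) t01.
Qed.

(* The point to be inserted on [e] in the disc around its [i]-th node: none when the two chords
   in this disc miss each other, in which case the two polygons no longer cross. *)
Definition X e i : seq pt :=
  if `[< exists c, meeting e i c >] then [:: xget o [set c | meeting e i c]%classic] else [::].

Lemma X_spec e i c : meeting e i c -> X e i = [:: c].
Proof.
move=> m; rewrite /X; case: asboolP => [_|[]]; last by exists c.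
by case: xgetP => [x _ hx|/(_ c)/(_ m)//]; rewrite (meeting_uniq hx m).
Qed.

Lemma X_cases e i : X e i = [::] \/ exists2 c, meeting e i c & X e i = [:: c].
Proof.
by rewrite {1}/X; case: asboolP => [[c m]|_]; [right; exists c; rewrite ?(X_spec m) | left].
Qed.

Lemma mem_X e i z : z \in X e i -> meeting e i z.
Proof. by case: (X_cases e i) => [->|[c m ->]] //; rewrite inE => /eqP->. Qed.

Lemma X_out e i : ~~ (0 < i < k e)%N -> X e i = [::].
Proof. by move=> h; case: (X_cases e i) => // -[c [hi]]; rewrite hi in h. Qed.

(** Node [i] comes before the polygon [pi e i]; at the first node [X e 0] is empty. *)
Definition pieces e j m := flatten [seq X e i ++ pi e i | i <- iota j m].
Definition path_of e := pos (ea e) :: rcons (pieces e 0 (k e)) (pos (eb e)).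
Local Notation L := path_of.

Lemma mem_pieces e j m z : z \in pieces e j m ->
  exists2 i, (j <= i < j + m)%N & (z \in X e i) || (z \in pi e i).
Proof. by case/flattenP=> s /mapP[i]; rewrite mem_iota => hi ->; rewrite mem_cat; exists i. Qed.

Lemma mem_path e z : z \in L e -> [\/ exists2 v, v \in ends e & z = pos v,
  exists2 i, (0 < i < k e)%N & meeting e i z | exists2 i, (i < k e)%N & z \in pi e i].
Proof.
rewrite inE mem_rcons inE => /or3P[/eqP->|/eqP->|/mem_pieces[i /andP[_ hi] /orP[/mem_X m|zi]]].
- by constructor 1; exists (ea e); rewrite // !inE eqxx.
- by constructor 1; exists (eb e); rewrite // !inE eqxx orbT.
- by constructor 2; exists i => //; case: m.
by constructor 3; exists i.
Qed.

Lemma node_end e v : v \in ends e -> exists2 i, (i <= k e)%N & node e i = pos v.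
Proof.
by rewrite !inE => /orP[]/eqP->; [exists 0%N | exists (k e)].
Qed.

Lemma pos_notin_pi e i v : (i < k e)%N -> pos v \notin pi e i.
Proof.
move=> hi; apply/negP=> m; have h : dsq (pos v) (pos v) <= r by rewrite dsqxx ltW.
by have := pi_mem_circle hi m (node_pos v) h; rewrite dsqxx => E; move: r_gt0; rewrite -E ltxx.
Qed.

Lemma pos_not_meeting e i v : ~ meeting e i (pos v).
Proof.
move=> m; have [hi _] := m; apply: (node_inner (v := v) hi).
apply: (node_far (z := pos v)); [exact/node_node/inner_le | exact: node_pos | | by rewrite dsqxx ltW].
exact/ltW/meeting_dsq.
Qed.

Lemma meeting_notin_pi e i e' i' c : meeting e i c -> (i' < k e')%N -> c \notin pi e' i'.
Proof.
move=> m hi'; apply/negP=> h; have [hi _] := m; have d := meeting_dsq m.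
have := pi_mem_circle hi' h (node_node (inner_le hi)) (ltW d).
by move=> E; rewrite E ltxx in d.
Qed.

Lemma meeting_node e i e' i' c : meeting e i c -> meeting e' i' c -> node e i = node e' i'.
Proof.
move=> m m'; have [hi _] := m; have [hi' _] := m'.
apply: (node_far (z := c)); try exact/node_node/inner_le.
  exact/ltW/meeting_dsq.
exact/ltW/meeting_dsq.
Qed.

Lemma isv_path e z : z \in L e -> isv pos z -> exists2 v, v \in ends e & z = pos v.
Proof.
case/mem_path=> // -[i hi h] /existsP[v /eqP E]; rewrite E in h.
  by case: (pos_not_meeting h).
by rewrite (negPf (pos_notin_pi v hi)) in h.
Qed.

Lemma common_point e e' z : e != e' -> z \in L e -> z \in L e' ->
  (exists v, [/\ v \in ends e, v \in ends e' & z = pos v]) \/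
  (exists i i', [/\ (0 < i < k e)%N, (0 < i' < k e')%N, node e i = node e' i',
     meeting e i z & meeting e' i' z]).
Proof.
move=> ne /mem_path[[v ve ->]|[i hi m]|[i hi m]] /mem_path[[v' v'e E]|[i' hi' m']|[i' hi' m']].
- by left; exists v; rewrite (pos_inj E) in ve *.
- by case: (pos_not_meeting m').
- by rewrite (negPf (pos_notin_pi v hi')) in m'.
- by rewrite E in m; case: (pos_not_meeting m).
- by right; exists i, i'; split=> //; apply: meeting_node m m'.
- by rewrite (negPf (meeting_notin_pi m hi')) in m'.
- by rewrite E (negPf (pos_notin_pi v' hi)) in m.
- by rewrite (negPf (meeting_notin_pi m' hi)) in m.
by have [E _] := pi_mem_disj hi hi' m m'; rewrite E eqxx in ne.
Qed.

Lemma common_node e e' z : e != e' -> z \in L e -> z \in L e' ->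
  exists i i', [/\ (i <= k e)%N, (i' <= k e')%N, node e i = node e' i' &
    z = node e i /\ isv pos z \/ [/\ ~~ isv pos z, (0 < i < k e)%N & meeting e i z]].
Proof.
move=> ne ze ze'; have [[v [ve ve' zv]]|[i [i' [hi hi' E m m']]]] := common_point ne ze ze'.
  have [i hi iv] := node_end ve; have [i' hi' iv'] := node_end ve'.
  exists i, i'; rewrite iv iv'; split=> //; left; split=> //.
  by apply/existsP; exists v; rewrite zv.
exists i, i'; split=> //; try exact: inner_le; right; split=> //.
by apply/existsP=> -[v /eqP E']; rewrite E' in m; apply: pos_not_meeting m.
Qed.

Lemma pieces_uniq e j m : (j + m <= k e)%N -> uniq (pieces e j m).
Proof.
elim: m j => [|m IH] j // h; rewrite /pieces /= -/(pieces e j.+1 m) cat_uniq cat_uniq.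
have hj : (j < k e)%N by lia.
rewrite pi_uniq // IH; last by lia.
have -> : uniq (X e j) by case: (X_cases e j) => [->|[c _ ->]].
rewrite !andbT /=; apply/andP; split.
  apply/hasPn=> z zj; apply/negP=> /mem_X/meeting_notin_pi/(_ hj).
  by rewrite zj.
apply/hasPn=> z /mem_pieces[i /andP[ji im] zi]; have hi : (i < k e)%N by lia.
rewrite mem_cat negb_or; case/orP: zi => [/mem_X mz|zi].
  rewrite (meeting_notin_pi mz hj) andbT; apply/negP=> /mem_X/meeting_node/(_ mz) E.
  by have [] := mz => /andP[i0 _] _; have := node_inj (ltnW hj) (ltnW hi) E; lia.
apply/andP; split; first by apply/negP=> /mem_X/meeting_notin_pi/(_ hi); rewrite zi.
by apply/negP=> zj; have [_ E] := pi_mem_disj hi hj zi zj; lia.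
Qed.

Lemma pos_notin_pieces e v : pos v \notin pieces e 0 (k e).
Proof.
apply/negP=> /mem_pieces[i /andP[_ hi]] /orP[/mem_X/pos_not_meeting//|].
by rewrite (negPf (pos_notin_pi v hi)).
Qed.

Lemma pos_ends_neq e : pos (ea e) != pos (eb e).
Proof.
apply/eqP; rewrite -node_first -node_last => /(node_inj (leq0n _) (leqnn _)) E.
by have := k_gt0 e; rewrite -E.
Qed.

Lemma path_uniq e : uniq (L e).
Proof.
rewrite /= mem_rcons inE negb_or pos_ends_neq pos_notin_pieces rcons_uniq pos_notin_pieces.
exact: pieces_uniq.
Qed.

(* [hub e i] is the part of the path of [e] inside the disc around its [i]-th node. *)
Definition before e i := if i == 0%N then pos (ea e) else tl e i.-1.
Definition after e i := if i == k e then pos (eb e) else hd e i.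
Definition hub e i := before e i :: rcons (X e i) (after e i).

Lemma path_adj e P Q : adj (L e) P Q ->
  (exists2 i, (i <= k e)%N & adj (hub e i) P Q) \/ (exists2 i, (i < k e)%N & adj (pi e i) P Q).
Proof.
suff gen m j : (j + m = k e)%N -> adj (before e j :: rcons (pieces e j m) (pos (eb e))) P Q ->
  (exists2 i, (i <= k e)%N & adj (hub e i) P Q) \/ (exists2 i, (i < k e)%N & adj (pi e i) P Q).
  exact: (gen (k e) 0%N).
elim: m j => [|m IH] j jm h.
  left; exists j; first by lia.
  have E : j = k e by lia.
  by move: h; rewrite /hub X_out ?E ?ltnn ?andbF // /after eqxx.
have hj : (j < k e)%N by lia.
have [s1 s1E] : exists s1, pi e j = hd e j :: s1.
  by have := pi_size hj; rewrite /hd; case: (pi e j) => [|x s] // _; exists s.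
have [s2 s2E] : exists s2, pi e j = rcons s2 (tl e j).
  by have := pi_size hj; rewrite /tl; case: (pi e j) => [|x s] // _; exists (belast x s); rewrite -lastI.
pose rest := rcons (pieces e j.+1 m) (pos (eb e)).
have E1 : before e j :: rcons (pieces e j m.+1) (pos (eb e)) = (before e j :: X e j) ++ hd e j :: (s1 ++ rest).
  by rewrite /pieces /= -/(pieces e j.+1 m) -catA rcons_cat s1E /= rcons_cat.
have E2 : hd e j :: (s1 ++ rest) = s2 ++ tl e j :: rest by rewrite -cat_cons -s1E s2E cat_rcons.
move: h; rewrite E1 adj_cat => /orP[h|].
  left; exists j; first exact: ltnW.
  by rewrite /hub /after (ltn_eqF hj).
rewrite E2 adj_cat -s2E => /orP[h|h]; first by right; exists j.
by apply: (IH j.+1) => //; lia.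
Qed.

Lemma before_dsq e i : (i <= k e)%N -> dsq (before e i) (node e i) <= r.
Proof.
rewrite /before; case: eqP => [->|/eqP n] h; first by rewrite node_first dsqxx ltW.
have i0 : (i.-1 < k e)%N by lia.
by have := pi_tl i0; rewrite prednK ?lt0n // => ->.
Qed.

Lemma after_dsq e i : (i <= k e)%N -> dsq (after e i) (node e i) <= r.
Proof.
rewrite /after; case: eqP => [->|/eqP n] h; first by rewrite node_last dsqxx ltW.
by rewrite pi_hd // ltn_neqAle n.
Qed.

Lemma hub_dsq e i z : (i <= k e)%N -> z \in hub e i -> dsq z (node e i) <= r.
Proof.
move=> h; rewrite inE mem_rcons inE => /or3P[/eqP->|/eqP->|/mem_X/meeting_dsq/ltW//].
  exact: before_dsq.
exact: after_dsq.
Qed.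

Lemma hub_seg e i P Q z : (i <= k e)%N -> adj (hub e i) P Q -> inseg P Q z -> dsq z (node e i) <= r.
Proof. by move=> h /adj_mem[p q] s; apply: disc_convex s; apply: hub_dsq. Qed.

Lemma hub_circle e i P Q z : (i <= k e)%N -> adj (hub e i) P Q -> inseg P Q z ->
  dsq z (node e i) = r -> z = P \/ z = Q.
Proof. by move=> h /adj_mem[p q] s; apply: disc_strict s; apply: hub_dsq. Qed.

(** A polygon [pi e i] meets a disc only in its end on the circle, and a segment inside the disc
    meets the circle only in its own ends. *)
Lemma pi_hub e i e' i' P Q P' Q' z : (i < k e)%N -> (i' <= k e')%N ->
  adj (pi e i) P Q -> adj (hub e' i') P' Q' -> inseg P Q z -> inseg P' Q' z ->
  (z = P \/ z = Q) /\ (z = P' \/ z = Q').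
Proof.
move=> hi hi' a a' s s'; have d := hub_seg hi' a' s'.
case: (pi_hit hi a s (node_node hi') d) => -[E z1 z2].
  by split; [left | apply: hub_circle a' s' _ => //; rewrite E z1 pi_hd].
by split; [right | apply: hub_circle a' s' _ => //; rewrite E z1 pi_tl].
Qed.

Lemma hub_end e i P Q : (i <= k e)%N -> ~~ (0 < i < k e)%N -> adj (hub e i) P Q ->
  [/\ P = before e i, Q = after e i & exists j q,
    [/\ (j < k e)%N, q \in pi e j, dsq q (node e i) = r & 
     P = node e i /\ Q = q \/ P = q /\ Q = node e i]].
Proof.
move=> hi h; rewrite /hub (X_out h) /= orbF => /andP[/eqP-> /eqP->]; split=> //.
case: (posnP i) => [i0|i0].
  exists 0%N, (hd e 0); split; rewrite ?hd_mem ?i0 ?pi_hd //; left.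
  by rewrite /before /after /= node_first (ltn_eqF (k_gt0 e)).
have E : i = k e by lia.
have i1 : (i.-1 < k e)%N by lia.
exists i.-1, (tl e i.-1); split; rewrite ?tl_mem //.
  by have := pi_tl i1; rewrite prednK.
by right; rewrite /before /after (gtn_eqF i0) E eqxx node_last.
Qed.

Lemma hub_inner e i : (0 < i < k e)%N -> hub e i = tl e i.-1 :: rcons (X e i) (hd e i).
Proof. by case/andP=> h1 h2; rewrite /hub /before /after (gtn_eqF h1) (ltn_eqF h2). Qed.

Lemma hub_chord e i P Q z : (0 < i < k e)%N -> adj (hub e i) P Q -> inseg P Q z ->
  inseg (tl e i.-1) (hd e i) z.
Proof.
move=> h /adj_mem[]; rewrite hub_inner // => p q s.
suff mem x : x \in tl e i.-1 :: rcons (X e i) (hd e i) -> inseg (tl e i.-1) (hd e i) x.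
  by apply: inseg_trans s; apply: mem.
rewrite inE mem_rcons inE => /or3P[/eqP->|/eqP->|/mem_X[_ [? [? []]]]] //.
  exact: inseg_l.
exact: inseg_r.
Qed.

Lemma hub_meeting e i P Q z : meeting e i z -> adj (hub e i) P Q ->
  (P = tl e i.-1 /\ Q = z) \/ (P = z /\ Q = hd e i).
Proof.
move=> m; have [h _] := m; rewrite hub_inner // (X_spec m) /= orbF.
by case/orP=> /andP[/eqP-> /eqP->]; [left | right].
Qed.

Lemma node_outer e i : (i <= k e)%N -> ~~ (0 < i < k e)%N -> exists v, node e i = pos v.
Proof.
move=> hi h; have [->|->] : i = 0%N \/ i = k e by lia.
  by exists (ea e).
by exists (eb e).
Qed.

(** Both segments lie in the disc of one node. At a vertex they are radii; at a crossing they are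
    parts of one chord or of two chords, and the point where two chords meet has been made a vertex
    of the path. *)
Lemma hub_hub e i e' i' P Q P' Q' z : (i <= k e)%N -> (i' <= k e')%N ->
  adj (hub e i) P Q -> adj (hub e' i') P' Q' -> (e != e') || (P != P') ->
  inseg P Q z -> inseg P' Q' z -> z = P \/ z = Q.
Proof.
move=> hi hi' a a' ne s s'.
have nE : node e i = node e' i'.
  by apply: (node_far (z := z)); [apply: node_node.. | apply: hub_seg a s | apply: hub_seg a' s'].
have iE : e = e' -> i = i'.
  by move=> ee; subst e'; apply: node_inj hi hi' nE.
case: (boolP (0 < i < k e)%N) => h; last first.
  have h' : ~~ (0 < i' < k e')%N.
    by apply/negP=> h'; have [v vE] := node_outer hi h; case: (node_inner (v := v) h'); rewrite -nE.
  have [P1 Q1 [j [q [hj qj qr c]]]] := hub_end hi h a.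
  have [P2 Q2 [j' [q' [hj' qj' qr' c']]]] := hub_end hi' h' a'.
  case: (eqVneq e e') ne => [ee|ne _] /=.
    by subst e'; rewrite P1 P2 (iE erefl) eqxx.
  have qq : q != q'.
    apply/eqP=> E; rewrite -E in qj'; have [E' _] := pi_mem_disj hj hj' qj qj'.
    by rewrite E' eqxx in ne.
  rewrite -nE in qr' c'.
  have sz : inseg (node e i) q z by case: c => -[E1 E2]; rewrite E1 E2 in s => //; apply: insegC.
  have sz' : inseg (node e i) q' z by case: c' => -[E1 E2]; rewrite E1 E2 in s' => //; apply: insegC.
  have -> := radii_meet qr qr' qq sz sz'.
  by case: c => -[-> ->]; [left | right].
have c := hub_chord h a s.
case: (eqVneq e e') ne => [ee /= ne|ne _].
  subst e'; have E := iE erefl; subst i'.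
  case: (X_cases e i) => [XE|[x m XE]].
    move: a a' ne; rewrite hub_inner // XE /= !orbF => /andP[/eqP-> _] /andP[/eqP-> _].
    by rewrite eqxx.
  have mt := meeting_inner m; have tn := tl_neq_hd h.
  case: (hub_meeting m a) (hub_meeting m a') => -[E1 E2] [] [E3 E4]; rewrite E1 E3 ?eqxx // in ne.
    by right; rewrite E2; apply: (meet_at tn mt); [rewrite -E1 -E2 | rewrite -E3 -E4].
  by left; rewrite E1; apply: (meet_at tn mt); [rewrite -E3 -E4 | rewrite -E1 -E2].
have h' : (0 < i' < k e')%N.
  by apply: contraT => h'; have [v vE] := node_outer hi' h'; case: (node_inner (v := v) h); rewrite nE.
have m : meeting e i z by split=> //; exists e', i'; split=> //; apply: hub_chord a' s'.
by case: (hub_meeting m a) => -[E1 E2]; [right | left].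
Qed.

Lemma path_plane e e' P Q P' Q' z : adj (L e) P Q -> adj (L e') P' Q' -> (e != e') || (P != P') ->
  inseg P Q z -> inseg P' Q' z -> z = P \/ z = Q.
Proof.
move=> /path_adj[[i hi a]|[i hi a]] /path_adj[[i' hi' a']|[i' hi' a']] ne s s'.
- exact: hub_hub hi hi' a a' ne s s'.
- by have [] := pi_hub hi' hi a' a s' s.
- by have [] := pi_hub hi hi' a a' s s'.
case: (eqVneq (e, i) (e', i')) => [[ee ii]|n].
  by subst e' i'; rewrite eqxx in ne; apply: (pi_simple hi a a').
by case: (pi_disj hi hi' n a a' s s').
Qed.

(** The neighbours of an inserted point on the path are the ends of its chord, so the path goes
    straight through it. *)
Lemma meeting_adj e i c P Q : meeting e i c -> adj (L e) P Q ->
  (Q = c -> P = tl e i.-1) /\ (P = c -> Q = hd e i).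
Proof.
move=> m a; have [hi _] := m; have ci := inner_le hi.
have Pn : P = c \/ Q = c -> adj (hub e i) P Q.
  move=> PQ; case: (path_adj a) => -[j hj b]; last first.
    have [p q] := adj_mem b; have := meeting_notin_pi m hj.
    by case: PQ => E; rewrite -E ?p ?q.
  suff -> : i = j by [].
  have cj : dsq c (node e j) <= r.
    by have [p q] := adj_mem b; apply: hub_dsq => //; case: PQ => <-.
  apply: (node_inj ci hj); apply: (node_far (z := c)) => //; try exact: node_node.
  exact/ltW/meeting_dsq.
have cn : c <> tl e i.-1 /\ c <> hd e i.
  have d := meeting_dsq m; split=> E; rewrite E in d.
    by rewrite pi_tl_pred // ltxx in d.
  by rewrite (pi_hd (inner_lt hi)) ltxx in d.
split=> E.
  have := hub_meeting m (Pn (or_intror E)); case=> -[E1 E2] //.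
  by case: cn => _ []; rewrite -E2.
have := hub_meeting m (Pn (or_introl E)); case=> -[E1 E2] //.
by case: cn => [[]]; rewrite -E1.
Qed.

Lemma pnt_adj e i : (i < nL L e)%N -> adj (L e) (pnt L e i) (pnt L e i.+1).
Proof. by move=> h; apply/(adjP o); exists i. Qed.

(** A common point of two paths lies in the disc of a common node of the arcs, so the conditions on
    crossings are inherited from the nodes. *)
Theorem assembled_paths : plane_paths ea eb pos L.
Proof.
have szL e : size (L e) = (nL L e).+1 by [].
have fst e : pnt L e 0 = pos (ea e) by [].
have lst e : pnt L e (nL L e) = pos (eb e).
  by rewrite /pnt /nL nth_last /L /= last_rcons.
have inn e i : (0 < i < nL L e)%N -> ~~ isv pos (pnt L e i).
  case/andP=> i0 iN; apply/negP=> iv.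
  have m : pnt L e i \in L e by apply: mem_nth; rewrite szL ltnW.
  have [v] := isv_path m iv; rewrite !inE => /orP[]/eqP-> /eqP.
    by rewrite -fst nth_uniq ?szL ?path_uniq // ?(gtn_eqF i0) // ltnW.
  by rewrite -lst nth_uniq ?szL ?path_uniq // ?(ltn_eqF iN) // ltnW.
split=> //.
- by move=> e; rewrite /= size_rcons.
- exact: path_uniq.
- move=> e i e' j z hi hj ne s s'; apply: (path_plane (pnt_adj hi) (pnt_adj hj) _ s s').
  case: (eqVneq e e') => //= ee; subst e'; rewrite nth_uniq ?szL ?path_uniq // 1?ltnW //.
  by apply/eqP=> E; rewrite E in ne.
- move=> e e' i ne hi m.
  have me : pnt L e i \in L e by apply: mem_nth; rewrite szL ltnW //; case/andP: hi.
  case: (common_point ne me m) => [[v [_ _ E]]|[j [j' [hj _ _ mt _]]]].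
    by case/negP: (inn e i hi); apply/existsP; exists v; rewrite E.
  have [i0 iN] := andP hi; have i1 : (i.-1 < nL L e)%N by lia.
  have [_ /(_ erefl) ->] := meeting_adj mt (pnt_adj iN).
  have a1 := pnt_adj i1; rewrite prednK // in a1.
  have [/(_ erefl) -> _] := meeting_adj mt a1.
  exact: meeting_inner.
- move=> e e' z ne ze ze' nv; have [i [i' [hi hi' E [[_ iv]|[_ h m]]]]] := common_node ne ze ze'.
    by rewrite iv in nv.
  exact: node_disj ne h hi' E.
- move=> e e' e'' z ne ze ze' ze'' nv.
  case: (eqVneq e e'') => [->|ne']; first by left.
  have [i [i' [hi hi' E [[_ iv]|[_ h m]]]]] := common_node ne ze ze'; first by rewrite iv in nv.
  have [j [j' [hj hj' E' [[_ iv]|[_ h' m']]]]] := common_node ne' ze ze''; first by rewrite iv in nv.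
  have ij : j = i by apply: (node_inj hj hi); apply: meeting_node m' m.
  by subst j; apply: node_third ne h hi' hj' E E'.
- move=> e e' z z' ne ze ze' z'e z'e'.
  have [i [i' [hi hi' E c]]] := common_node ne ze ze'.
  have [j [j' [hj hj' E' c']]] := common_node ne z'e z'e'.
  have ij := node_once ne hi hi' hj hj' E E'; subst j.
  case: c c' => [[zi iv]|[nv h m]] [[z'i iv']|[nv' h' m']].
  - by rewrite zi z'i.
  - by move/existsP: iv => [v /eqP zv]; case: (node_inner (v := v) h'); rewrite -zi.
  - by move/existsP: iv' => [v /eqP zv]; case: (node_inner (v := v) h); rewrite -z'i.
  exact: meeting_uniq m m'.
move=> e e1 e2 z1 z2 n1 n2 z1e z1e1 z2e z2e2 v1 v2.
have n1' : e != e1 by rewrite eq_sym.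
have n2' : e != e2 by rewrite eq_sym.
have [i [i' [hi hi' E [[_ iv]|[_ h m]]]]] := common_node n1' z1e z1e1; first by rewrite iv in v1.
have [j [j' [hj hj' E' [[_ iv]|[_ h' m']]]]] := common_node n2' z2e z2e2; first by rewrite iv in v2.
exact: node_fan n1 n2 h h' hi' hj' E E'.
Qed.

End Assembly.

End Assembly.

From mathcomp Require Import all_classical all_reals topology normedtype.

(** * Compactness of an interval by continuous induction *)

Module Creeping.
Import PolygonalBound Distances ShortestPolygons.
Import Order.TTheory GRing.Theory Num.Theory numFieldNormedType.Exports.
Local Open Scope classical_set_scope.
Local Open Scope ring_scope.

Section Creeping.
Variable R : realType.
Local Notation pt := (R * R)%type.

(** The supremum of the [t] with [P a t] is [b], because the local property at the supremum reaches
    beyond it. *)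
Lemma creeping (P : R -> R -> Prop) (a b : R) : a <= b ->
  (forall u v w, a <= u -> u <= v -> v <= w -> w <= b -> P u v -> P v w -> P u w) ->
  (forall t, a <= t <= b -> exists2 d, 0 < d &
     forall u v, a <= u -> u <= t -> t <= v -> v <= b -> t - u < d -> v - t < d -> P u v) ->
  P a b.
Proof.
move=> ab tr loc; pose A := [set t | a <= t <= b /\ P a t]%classic.
have aA : A a.
  split; first by rewrite lexx.
  have [|d d0 h] := loc a; first by rewrite lexx.
  by apply: h; rewrite ?subrr.
have ubA : ubound A b by move=> t [/andP[]].
have supA : has_sup A by split; [exists a | exists b].
set s := sup A; have as_ : a <= s by apply: ub_le_sup => //; exists b.
have sb : s <= b by apply: ge_sup => //; exists a.
have [|d d0 h] := loc s; first by rewrite as_.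
have [t [/andP[t1 t2] Pt] st] := sup_adherent d0 supA.
have ts : t <= s by apply: ub_le_sup; [exists b | split; rewrite ?t1].
have d1 : s - t < d by rewrite ltrBlDr -ltrBlDl.
have step v : s <= v -> v <= b -> v - s < d -> P a v.
  by move=> sv vb vd; apply: (tr a t v) => //; [apply: le_trans sv | apply: h].
pose v := Num.min b (s + d / 2).
have Pv : P a v.
  apply: step; first by rewrite le_min sb lerDl divr_ge0 // ltW.
    by rewrite ge_min lexx.
  have : v <= s + d / 2 by rewrite ge_min lexx orbT.
  by lra.
have vs : v <= s.
  apply: ub_le_sup; first by exists b.
  by split=> //; rewrite ge_min lexx le_min ab /= (le_trans as_) // lerDl divr_ge0 // ltW.
move: vs; rewrite ge_min => /orP[bs|]; last by lra.
by have -> : b = s by [apply/le_anti; rewrite bs sb]; apply: step; rewrite ?subrr.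
Qed.

Definition eps_continuous (g : R -> pt) a b := forall t, a <= t <= b -> forall r, 0 < r ->
  exists2 d, 0 < d & forall u, a <= u <= b -> `|u - t| < d -> dsq (g u) (g t) < r.

Lemma continuous_eps (g : R -> pt) a b :
  {within `[a, b]%classic, continuous g} -> eps_continuous g a b.
Proof.
move=> /subspace_continuousP cg t tab r r0.
(* Two coordinates closer than [e] give a squared distance below [2 * e ^+ 2 <= 2 * e <= r]. *)
pose e := Num.min 1 (r / 2).
have e0 : 0 < e by rewrite lt_min ltr01 divr_gt0.
have [e1 er] : e <= 1 /\ e <= r / 2 by split; rewrite ge_min lexx ?orbT.
have /cg/(_ _ (nbhsx_ballx (g t) e e0)) : (`[a, b]%classic : set R) t by rewrite /= in_itv.
rewrite /= /nbhs /= /within /= near_simpl => /nbhs_ballP[d d0 h]; exists d => // u uab ud.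
have /h : ball t d u by rewrite /ball /= distrC.
rewrite /= in_itv => /(_ uab)[]; rewrite /ball /= => h1 h2.
rewrite dsqC /dsq -(real_normK (num_real ((g t).1 - _))) -(real_normK (num_real ((g t).2 - _))).
have n1 := normr_ge0 ((g t).1 - (g u).1); have n2 := normr_ge0 ((g t).2 - (g u).2).
nra.
Qed.

Lemma eps_continuous_sub g a b a' b' : a <= a' -> b' <= b ->
  eps_continuous g a b -> eps_continuous g a' b'.
Proof.
move=> h1 h2 cg t /andP[t1 t2] r r0; have [|d d0 h] := cg t _ r r0.
  by rewrite (le_trans h1) // (le_trans t2).
by exists d => // u /andP[u1 u2]; apply: h; rewrite (le_trans h1) // (le_trans u2).
Qed.

Lemma far_from_point g a b c : a <= b -> eps_continuous g a b ->
  (forall t, a <= t <= b -> g t <> c) ->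
  exists2 r, 0 < r & forall t, a <= t <= b -> r <= dsq (g t) c.
Proof.
move=> ab cg n; pose P u v := exists2 r, 0 < r & forall t, u <= t <= v -> r <= dsq (g t) c.
apply: (creeping (P := P) ab).
  move=> u v w _ _ _ _ [r r0 h] [r' r'0 h']; exists (Num.min r r'); first by rewrite lt_min r0.
  move=> t /andP[t1 t2]; rewrite ge_min; case: (lerP t v) => tv.
    by rewrite h ?t1.
  by rewrite h' ?orbT // t2 ltW.
move=> t tab; have r0 : 0 < dsq (g t) c by rewrite dsq_gt0; apply/eqP; apply: n.
have [|d d0 h] := cg t tab (dsq (g t) c / 4); first by rewrite divr_gt0.
exists d => // u v u1 u2 v1 v2 ud vd; exists (dsq (g t) c / 4); first by rewrite divr_gt0.
move=> x /andP[x1 x2].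
have /h : a <= x <= b by rewrite (le_trans u1) // (le_trans x2).
have : `|x - t| < d by rewrite ltr_norml; apply/andP; split; lra.
by move=> /[swap] /[apply]; have := dsq_triangle (g x) (g t) c; lra.
Qed.

Lemma far_apart g a b g' a' b' : a <= b -> a' <= b' ->
  eps_continuous g a b -> eps_continuous g' a' b' ->
  (forall t t', a <= t <= b -> a' <= t' <= b' -> g t <> g' t') ->
  exists2 r, 0 < r & forall t t', a <= t <= b -> a' <= t' <= b' -> r <= dsq (g t) (g' t').
Proof.
move=> ab ab' cg cg' n.
pose P u v := exists2 r, 0 < r & forall t t', u <= t <= v -> a' <= t' <= b' -> r <= dsq (g t) (g' t').
apply: (creeping (P := P) ab).
  move=> u v w _ _ _ _ [r r0 h] [r' r'0 h']; exists (Num.min r r'); first by rewrite lt_min r0.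
  move=> t t' /andP[t1 t2] ht'; rewrite ge_min; case: (lerP t v) => tv.
    by rewrite h ?t1.
  by rewrite h' ?orbT // t2 ltW.
move=> t tab; have [|r r0 hr] := far_from_point ab' cg' (c := g t).
  by move=> t' ht' E; apply: (n t t').
have [|d d0 h] := cg t tab (r / 4); first by rewrite divr_gt0.
exists d => // u v u1 u2 v1 v2 ud vd; exists (r / 4); first by rewrite divr_gt0.
move=> x t' /andP[x1 x2] ht'; have := hr t' ht'.
have /h : a <= x <= b by rewrite (le_trans u1) // (le_trans x2).
have : `|x - t| < d by rewrite ltr_norml; apply/andP; split; lra.
by move=> /[swap] /[apply]; have := dsq_triangle (g x) (g t) (g' t'); rewrite (dsqC (g t)); lra.
Qed.

Definition tube (g : R -> pt) a b r z := exists2 t, a <= t <= b & dsq z (g t) < r.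

(** Locally one segment suffices, because the disc of the tube around [g t] is convex. *)
Lemma tube_chain g a b r : 0 < r -> a <= b -> eps_continuous g a b ->
  exists2 p, path (seg_in (tube g a b r)) (g a) p & last (g a) p = g b.
Proof.
move=> r0 ab cg.
pose P u v := exists2 p, path (seg_in (tube g a b r)) (g u) p & last (g u) p = g v.
apply: (creeping (P := P) ab).
  move=> u v w _ _ _ _ [p p1 p2] [q q1 q2]; exists (p ++ q); last by rewrite last_cat p2.
  by rewrite cat_path p1 p2.
move=> t tab; have [d d0 h] := cg t tab r r0; exists d => // u v u1 u2 v1 v2 ud vd.
exists [:: g v] => //=; rewrite andbT; apply/asboolP=> z hz; exists t => //.
case/andP: tab => t1 t2; apply: ball_convex hz; apply: h.
- by rewrite u1 (le_trans u2).
- by rewrite ltr_norml; apply/andP; split; lra.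
- by rewrite v2 (le_trans t1).
by rewrite ltr_norml; apply/andP; split; lra.
Qed.

(** The property is required for all smaller radii, so that finitely many choices combine by taking
    the minimum. *)
Lemma small_all (I : eqType) (s : seq I) (P : I -> R -> Prop) :
  (forall i, i \in s -> exists2 r, 0 < r & forall r', 0 < r' <= r -> P i r') ->
  exists2 r, 0 < r & forall r', 0 < r' <= r -> forall i, i \in s -> P i r'.
Proof.
elim: s => [|i s IH] h; first by exists 1.
have [|r r0 hr] := IH; first by move=> j js; apply: h; rewrite inE js orbT.
have [|r1 r10 hr1] := h i; first by rewrite inE eqxx.
exists (Num.min r r1); first by rewrite lt_min r0.
move=> r' /andP[r'0]; rewrite le_min => /andP[h1 h2] j; rewrite inE => /orP[/eqP->|js].
  by apply: hr1; rewrite r'0.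
by apply: hr; rewrite ?r'0.
Qed.

End Creeping.

End Creeping.

(** * Disjoint polygons along arcs that meet only at nodes *)

Module Strands.
Import PolygonalBound Distances ShortestPolygons Creeping.
Import Order.TTheory GRing.Theory Num.Theory.
Local Open Scope ring_scope.

Section Strands.
Variables (R : realType) (S : finType).
Local Notation pt := (R * R)%type.
Local Notation o := ((0 : R), (0 : R)).
Implicit Types (nodes : seq pt) (src tgt : S -> pt) (pi : S -> seq pt).

Record strand_polygons nodes src tgt (r : R) pi : Prop := StrandPolygons {
  sp_gt0 : 0 < r;
  sp_far : forall n n', n \in nodes -> n' \in nodes -> n != n' -> 4 * r < dsq n n';
  sp_size : forall s, (1 < size (pi s))%N;
  sp_uniq : forall s, uniq (pi s);
  sp_head : forall s, dsq (head o (pi s)) (src s) = r;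
  sp_last : forall s, dsq (last o (pi s)) (tgt s) = r;
  sp_hit : forall s i z n, (i.+1 < size (pi s))%N -> n \in nodes ->
    inseg (nth o (pi s) i) (nth o (pi s) i.+1) z -> dsq z n <= r ->
    [/\ n = src s, i = 0%N & z = head o (pi s)] \/
    [/\ n = tgt s, size (pi s) = i.+2 & z = last o (pi s)];
  sp_simple : forall s i j z, (i < j)%N -> (j.+1 < size (pi s))%N ->
    inseg (nth o (pi s) i) (nth o (pi s) i.+1) z ->
    inseg (nth o (pi s) j) (nth o (pi s) j.+1) z -> j = i.+1 /\ z = nth o (pi s) j;
  sp_disj : forall s s' i j z, s != s' -> (i.+1 < size (pi s))%N -> (j.+1 < size (pi s'))%N ->
    inseg (nth o (pi s) i) (nth o (pi s) i.+1) z ->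
    inseg (nth o (pi s') j) (nth o (pi s') j.+1) z -> False
}.

Lemma exists_shortest (U : pt -> Prop) A B (r : R) s : polygon U A B r s ->
  exists s', shortest U A B r s'.
Proof.
move=> p; pose Q n := `[< exists2 s, polygon U A B r s & size s = n >].
have ex : exists n, Q n by exists (size s); apply/asboolP; exists s.
case: (ex_minnP ex) => n /asboolP[s' p' <-] m; exists s'; split=> // s'' p''.
by apply: m; apply/asboolP; exists s''.
Qed.

Variables (g : S -> R -> pt) (a b : S -> R) (nodes : seq pt).
Hypothesis ab : forall s, a s < b s.
Hypothesis cg : forall s, eps_continuous (g s) (a s) (b s).
Hypothesis ga : forall s, g s (a s) \in nodes.
Hypothesis gb : forall s, g s (b s) \in nodes.
Hypothesis gab : forall s, g s (a s) != g s (b s).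
Hypothesis g_inner : forall s t, a s < t < b s -> g s t \notin nodes.
Hypothesis g_disj : forall s s' t t', s != s' -> a s < t < b s -> a s' < t' < b s' ->
  g s t <> g s' t'.

Lemma node_radius : exists r, [/\ 0 < r,
  forall n n', n \in nodes -> n' \in nodes -> n != n' -> 4 * r < dsq n n' &
  forall s n, n \in nodes -> n != g s (a s) -> n != g s (b s) ->
    forall t, a s <= t <= b s -> 4 * r <= dsq (g s t) n].
Proof.
have [r1 r10 h1] : exists2 r, 0 < r & forall r', 0 < r' <= r -> forall n, n \in nodes ->
    forall n', n' \in nodes -> n != n' -> 4 * r' < dsq n n'.
  apply: small_all => n _; have [|r r0 h] := @small_all R pt nodes (fun n' r => n != n' -> 4 * r < dsq n n').
    move=> n' _; case: (eqVneq n n') => [E|ne]; first by exists 1.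
    exists (dsq n n' / 8); first by rewrite divr_gt0 // dsq_gt0.
    by move=> r' /andP[r'0 hr'] _; lra.
  by exists r => // r' /h h' n' n'n; apply: h'.
have [r2 r20 h2] : exists2 r, 0 < r & forall r', 0 < r' <= r -> forall s, s \in enum S ->
    forall n, n \in nodes -> n != g s (a s) -> n != g s (b s) ->
    forall t, a s <= t <= b s -> 4 * r' <= dsq (g s t) n.
  apply: small_all => s _; have [|r r0 h] := @small_all R pt nodes (fun n r => n != g s (a s) ->
     n != g s (b s) -> forall t, a s <= t <= b s -> 4 * r <= dsq (g s t) n).
    move=> n nn; case: (boolP ((n != g s (a s)) && (n != g s (b s)))) => [/andP[na nb]|]; last first.
      by rewrite negb_and => h; exists 1 => // r' _ na nb; rewrite na nb in h.
    have [|r r0 h] := far_from_point (ltW (ab s)) (@cg s) (c := n).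
      move=> t /andP[]; rewrite !le_eqVlt => /orP[/eqP<- _ E|t1]; first by rewrite E eqxx in na.
      case/orP=> [/eqP-> E|t2 E]; first by rewrite E eqxx in nb.
      by have := @g_inner s t; rewrite t1 t2 E nn => /(_ isT).
    exists (r / 4); first by rewrite divr_gt0.
    move=> r' /andP[r'0 hr'] _ _ t /h; lra.
  by exists r => // r' /h h' n nn; apply: h'.
exists (Num.min r1 r2); have r0 : 0 < Num.min r1 r2 by rewrite lt_min r10.
split=> // [n n' nn nn'|s n nn].
  by apply: h1 => //; rewrite r0 ge_min lexx.
by apply: h2; rewrite ?mem_enum // r0 ge_min lexx orbT.
Qed.

(** Strands may share nodes, but their middle parts are disjoint compact arcs, at positive distance
    from each other; the cuts are made inside the discs around the nodes. *)
Lemma strand_middle r s : 0 < r -> exists u v, [/\ a s < u, u < v, v < b s,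
  dsq (g s u) (g s (a s)) < r & dsq (g s v) (g s (b s)) < r].
Proof.
move=> r0; have := ab s => lt.
have [|d d0 hd] := @cg s (a s) _ r r0; first by rewrite lexx ltW.
have [|d' d'0 hd'] := @cg s (b s) _ r r0; first by rewrite lexx ltW.
pose m := (b s - a s) / 3; pose x := Num.min m (d / 2); pose y := Num.min m (d' / 2).
have [x0 xm xd] : [/\ 0 < x, x <= m & x <= d / 2].
  by split; rewrite ?lt_min ?ge_min ?lexx ?orbT // !divr_gt0 // subr_gt0.
have [y0 ym yd] : [/\ 0 < y, y <= m & y <= d' / 2].
  by split; rewrite ?lt_min ?ge_min ?lexx ?orbT // !divr_gt0 // subr_gt0.
have mE : 3 * m = b s - a s by rewrite /m mulrC divfK // pnatr_eq0.
exists (a s + x), (b s - y); split; try lra.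
  by apply: hd; [apply/andP; split; lra | rewrite addrC addKr gtr0_norm //; lra].
by apply: hd'; [apply/andP; split; lra | rewrite addrC addKr normrN gtr0_norm //; lra].
Qed.

Theorem strand_polygons_exist : exists r pi,
  strand_polygons nodes (fun s => g s (a s)) (fun s => g s (b s)) r pi.
Proof.
have [r [r0 far foreign]] := node_radius.
have /choice[u] := fun s => strand_middle s r0; case/choice=> v uv.
have [q q0 hq] : exists2 q, 0 < q & forall q', 0 < q' <= q -> forall s, s \in enum S ->
    forall s', s' \in enum S -> s != s' -> forall t t', u s <= t <= v s -> u s' <= t' <= v s' ->
    4 * q' <= dsq (g s t) (g s' t').
  apply: small_all => s _.
  have [|r1 r10 h] := @small_all R S (enum S) (fun s' q => s != s' -> forall t t',
      u s <= t <= v s -> u s' <= t' <= v s' -> 4 * q <= dsq (g s t) (g s' t')).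
    move=> s' _; case: (eqVneq s s') => [E|ne]; first by exists 1.
    have [a1 a2 a3 a4 a5] := uv s; have [b1 b2 b3 b4 b5] := uv s'.
    have [t t' /andP[t1 t2] /andP[t'1 t'2]|r1 r10 h] := far_apart (ltW a2) (ltW b2)
      (eps_continuous_sub (ltW a1) (ltW a3) (@cg s)) (eps_continuous_sub (ltW b1) (ltW b3) (@cg s')).
      by apply: g_disj => //; apply/andP; split; lra.
    by exists (r1 / 4); [rewrite divr_gt0 | move=> r' /andP[r'0 hr'] _ t t' ht /(h t t' ht); lra].
  by exists r1 => // r' /h h' n' n'n; apply: h'.
(* [w <= q] keeps the tubes of different strands apart, and [w <= r] keeps a tube out of the discs
   of foreign nodes. *)
pose w := Num.min q r; have w0 : 0 < w by rewrite lt_min q0.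
have [wq wr] : w <= q /\ w <= r by rewrite !ge_min !lexx orbT.
pose U s := tube (g s) (u s) (v s) w.
have Ufar s n z : n \in nodes -> n != g s (a s) -> n != g s (b s) -> U s z -> r < dsq z n.
  move=> nn na nb [t /andP[t1 t2] zt]; have [a1 a2 a3 a4 a5] := uv s.
  have := foreign s n nn na nb t; have := dsq_triangle z (g s t) n.
  move=> h1 h2; have : 4 * r <= dsq (g s t) n by apply: h2; apply/andP; split; lra.
  lra.
have Udisj s s' z : s != s' -> U s z -> U s' z -> False.
  move=> ne [t ht zt] [t' ht' zt']; have := hq w _ s _ s' _ ne t t' ht ht'.
  rewrite w0 wq !mem_enum => /(_ isT isT isT).
  by have := dsq_triangle z (g s t) (g s' t'); lra.
have gabr s : 4 * r < dsq (g s (a s)) (g s (b s)) by apply: far.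
have : forall s, exists p, shortest (U s) (g s (a s)) (g s (b s)) r p /\
  [/\ dsq (head o p) (g s (a s)) = r, dsq (last o p) (g s (b s)) = r,
      forall z, inseg (nth o p 0) (nth o p 1) z -> dsq z (g s (a s)) <= r -> z = head o p &
      forall z, inseg (nth o p (size p).-2) (nth o p (size p).-1) z -> dsq z (g s (b s)) <= r ->
        z = last o p].
  move=> s; have [a1 a2 a3 a4 a5] := uv s.
  have [p p1 p2] := tube_chain w0 (ltW a2) (eps_continuous_sub (ltW a1) (ltW a3) (@cg s)).
  have [|s' /(shortest_trim (gabr s))//] := @exists_shortest (U s) (g s (a s)) (g s (b s)) r (g s (u s) :: p).
  by split; rewrite //= ?p2 ltW.
case/choice=> pi hpi; exists r, pi.
have inU s i z : (i.+1 < size (pi s))%N -> inseg (nth o (pi s) i) (nth o (pi s) i.+1) z -> U s z.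
  by move=> hi; have [ss _] := hpi s; apply: (seg_inP (polygon_seg ss.1 hi)).
split=> //.
- by move=> s; case: (hpi s) => ss _; apply: (shortest_size (gabr s) ss).
- by move=> s; case: (hpi s) => ss _; apply: (polygon_uniq (gabr s) ss).
- by move=> s; case: (hpi s) => _ [].
- by move=> s; case: (hpi s) => _ [].
- move=> s i z n hi nn hz hr; have [ss [_ _ h3 h4]] := hpi s.
  have Uz := inU s i z hi hz.
  case: (eqVneq n (g s (a s))) => [na|na].
    left; rewrite na in hr; have i0 := shortest_hits_start (gabr s) ss hi hz hr.
    by split=> //; apply: h3 hr; rewrite i0 in hz.
  case: (eqVneq n (g s (b s))) => [nb|nb]; last first.
    by have := Ufar s n z nn na nb Uz; rewrite ltNge hr.
  right; rewrite nb in hr; have iE := shortest_hits_end ss hi hz hr.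
  by split=> //; apply: h4 hr; rewrite iE.
- move=> s i j z ij hj hz hz'; have [ss _] := hpi s.
  exact: (shortest_simple (gabr s) ss ij hj hz hz').
by move=> s s' i j z ne hi hj hz hz'; apply: (Udisj s s' z ne); [apply: inU hz | apply: inU hz'].
Qed.

End Strands.

End Strands.

(** * Replacing arcs by polygons *)

Module Polygonization.
Import PolygonalBound PlanePathsBound Arcs Distances Creeping Strands Circles Assembly.
Import Order.TTheory GRing.Theory Num.Theory.
Local Open Scope ring_scope.

Section Polygonize.
Variables (R : realType) (T Ed : finType) (ea eb : Ed -> T).
Variables (pos : T -> R * R) (arc : Ed -> R -> R * R).
Hypothesis pa : plane_arcs ea eb pos arc.
Hypothesis arc_cont : forall e, eps_continuous (arc e) 0 1.
Variable e0 : Ed.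
Local Notation o := ((0 : R), (0 : R)).
Local Notation k := (nT arc).
Local Notation tm := (tm arc).
Let S := cell k.
Let u0 : S := SeqSub (etrans (mem_cells k e0 0) (nT_gt0 arc e0)).
Let se (s : S) := (val s).1.
Let si (s : S) : nat := (val s).2.
Let si_lt (s : S) : (si s < k (se s))%N. Proof. exact: cell_lt. Qed.
Let node e i := arc e (tm e i).
Let nodes := [seq pos v | v <- enum T] ++ [seq arc e t | e <- enum Ed, t <- times arc e].

Lemma mem_nodes n : reflect (is_node pos k node n) (n \in nodes).
Proof.
apply: (iffP idP); rewrite mem_cat.
  case/orP=> [/mapP[v _ ->]|/allpairsPdep[e [t [_ ht ->]]]]; first by left; exists v.
  right; move: ht => /(nthP 0)[i]; rewrite size_timesE ltnS => hi <-.
  by exists e, i.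
case=> [[v ->]|[e [i [hi ->]]]]; apply/orP; [left | right].
  by apply/mapP; exists v; rewrite ?mem_enum.
by apply/allpairsPdep; exists e, (tm e i); rewrite mem_enum tm_mem.
Qed.

Let tm01 e i : (i <= k e)%N -> 0 <= tm e i <= 1.
Proof. by move=> h; apply: (times_01 pa); apply: tm_mem. Qed.

Let gap e i t : (i < k e)%N -> tm e i < t < tm e i.+1 -> 0 < t < 1 /\ t \notin times arc e.
Proof.
move=> hi /andP[h1 h2]; have /andP[a0 _] := tm01 (ltnW hi); have /andP[_ a1] := tm01 hi.
split; first by rewrite (le_lt_trans a0) // (lt_le_trans h2).
apply/negP=> m; have [||E|E] := tm_between pa hi (t := t); rewrite ?(ltW h1) ?(ltW h2) //.
  by rewrite E ltxx in h1.
by rewrite E ltxx in h2.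
Qed.

Lemma strands_exist : exists r pi, strand_polygons nodes (fun s : S => node (se s) (si s))
  (fun s => node (se s) (si s).+1) r pi.
Proof.
have le01 (t : R) : 0 < t < 1 -> 0 <= t <= 1 by case/andP=> a b; rewrite !ltW.
apply: (@strand_polygons_exist R S (fun s => arc (se s)) (fun s => tm (se s) (si s))
   (fun s => tm (se s) (si s).+1)).
- by move=> s; rewrite (ltr_tm pa) // ltnW // si_lt.
- move=> s; have := si_lt s => h; apply: eps_continuous_sub (arc_cont (se s)).
    by case/andP: (tm01 (ltnW h)).
  by case/andP: (tm01 h).
- by move=> s; apply/mem_nodes; right; exists (se s), (si s); rewrite ltnW // si_lt.
- by move=> s; apply/mem_nodes; right; exists (se s), (si s).+1; rewrite si_lt.
- move=> s; have h := si_lt s; apply/eqP => /(pa_inj pa (tm01 (ltnW h)) (tm01 h)) E.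
  by have := ltr_tm pa (ltnW h) h; rewrite E ltxx ltnSn.
- move=> s t /(gap (si_lt s))[t01 tn]; apply/negP => /mem_nodes[[v E]|[e' [i' [hi' E]]]].
    exact: (pa_inner pa t01 E).
  have [ee|ne] := eqVneq (se s) e'; last first.
    by move/negP: tn; apply; apply: (crossing_time pa ne (le01 _ t01) (tm01 hi') E).
  rewrite -ee in E hi'; move/negP: tn; apply.
  by rewrite (pa_inj pa (le01 _ t01) (tm01 hi') E) tm_mem.
move=> s s' t t' ne ht ht' E; have [t01 tn] := gap (si_lt s) ht.
have [t01' tn'] := gap (si_lt s') ht'.
have [ee|n] := eqVneq (se s) (se s'); last first.
  by move/negP: tn; apply; apply: (crossing_time pa n (le01 _ t01) (le01 _ t01') E).
rewrite -ee in E ht'; have E' := pa_inj pa (le01 _ t01) (le01 _ t01') E; subst t'.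
have hs' : (si s' < k (se s))%N by rewrite ee si_lt.
case/andP: ht => h1 h2; case/andP: ht' => h3 h4.
have a1 := lt_trans h1 h4; have a2 := lt_trans h3 h2.
rewrite (ltr_tm pa) ?(ltnW (si_lt s)) // ltnS in a1.
rewrite (ltr_tm pa) ?(ltnW hs') ?si_lt // ltnS in a2.
case/eqP: ne; apply: val_inj; apply/eqP; rewrite -pair_eqE /= [_ == _]/((val s).1 == (val s').1).
by apply/andP; split; [apply/eqP | rewrite eqn_leq a1].
Qed.

Theorem polygonal_drawing : exists L, plane_paths ea eb pos L.
Proof.
have [r [pi0 sp]] := strands_exist.
pose pi e i := pi0 (mkcell u0 e i).
have ve e i : (i < k e)%N -> se (mkcell u0 e i) = e /\ si (mkcell u0 e i) = i.
  by move=> h; rewrite /se /si val_mkcell.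
have inner e i : (0 < i < k e)%N -> 0 < tm e i < 1 by apply: (tm_inner pa).
exists (path_of ea eb pos k node pi); apply: (@assembled_paths _ _ _ ea eb pos k node pi r).
- exact: pa_pos_inj pa.
- exact: sp_gt0 sp.
- exact: nT_gt0.
- by move=> e; rewrite /node [tm _ _]times_first (pa_first pa).
- by move=> e; rewrite /node [tm _ _]times_last (pa_last pa).
- by move=> e i v /inner; apply: (pa_inner pa).
- by move=> e i j hi hj /(pa_inj pa (tm01 hi) (tm01 hj))/(tm_inj pa hi hj).
- move=> n n' z /mem_nodes hn /mem_nodes hn' d d'; apply/eqP/negPn/negP => ne.
  by have := sp_far sp hn hn' ne; have := dsq_triangle z n n'; lra.
- move=> e e' i i' j j' ne hi hi' hj hj' E E'.
  exact: (tm_inj pa hi hj (pa_once pa ne (tm01 hi) (tm01 hi') (tm01 hj) (tm01 hj') E E')).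
- by move=> e e' i i' ne /inner hi /tm01 hi' E; apply: (pa_disj pa ne hi hi' E).
- move=> e e' e'' i i' i'' ne /inner hi /tm01 hi' /tm01 hi'' E E'.
  exact: (pa_third pa ne hi hi' hi'' E E').
- move=> e e1 e2 i1 i2 j1 j2 n1 n2 /inner h1 /inner h2 /tm01 g1 /tm01 g2 E1 E2.
  exact: (pa_fan pa n1 n2 h1 h2 g1 g2 E1 E2).
- by move=> e i _; apply: sp_size sp _.
- by move=> e i _; apply: sp_uniq sp _.
- by move=> e i /ve[E1 E2]; have := sp_head sp (mkcell u0 e i); rewrite E1 E2.
- by move=> e i /ve[E1 E2]; have := sp_last sp (mkcell u0 e i); rewrite E1 E2.
- move=> e i P Q z n /ve[E1 E2] /(adjP o)[j hj [-> ->]] s /mem_nodes nn d.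
  have := sp_hit sp hj nn s d; rewrite E1 E2.
  case=> -[-> jE zE]; [left | right]; split=> //.
    by rewrite zE jE nth0.
  by rewrite zE -nth_last jE.
- move=> e i P Q P' Q' z _ /(adjP o)[j hj [-> ->]] /(adjP o)[j' hj' [-> ->]] ne s s'.
  case: (ltngtP j j') => [lt|lt|E]; last by rewrite E eqxx in ne.
    by have [-> ->] := sp_simple sp lt hj' s s'; right.
  by have [_ ->] := sp_simple sp lt hj s' s; left.
move=> e i e' i' P Q P' Q' z hi hi' ne /(adjP o)[j hj [-> ->]] /(adjP o)[j' hj' [-> ->]] s s'.
apply: (sp_disj sp _ hj hj' s s'); apply: contra ne => /eqP E.
by rewrite -(val_mkcell u0 hi) -(val_mkcell u0 hi') E.
Qed.

End Polygonize.

End Polygonization.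

(** * Topological drawings as systems of arcs *)

Module Drawings.
Import PolygonalBound Arcs.
Import Order.TTheory GRing.Theory Num.Theory.
Local Open Scope ring_scope.

Section DrawingArcs.
Variables (R : realType) (T : finType) (E : rel T) (pos : T -> pt R) (arc : T -> T -> R -> pt R).
Hypothesis drawing : simple_drawing E pos arc.
Hypothesis fans : crossing_condition E arc.
Variables (Ed : finType) (ea eb : Ed -> T).
Hypothesis edge : forall e, E (ea e) (eb e).
Local Notation ends := (ends ea eb).
Hypothesis ends_inj : injective ends.
(** The edge may be parametrized anew: by the given arc in general, linearly in a straight-line
    drawing. *)
Variable curve : Ed -> R -> pt R.
Hypothesis curve_inj : forall e t t', 0 <= t <= 1 -> 0 <= t' <= 1 -> curve e t = curve e t' -> t = t'.
Hypothesis curve_first : forall e, curve e 0 = pos (ea e).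
Hypothesis curve_last : forall e, curve e 1 = pos (eb e).
Hypothesis curve_trace : forall e t, 0 <= t <= 1 -> trace (arc (ea e) (eb e)) (curve e t).

Let lt01_le (t : R) : 0 < t < 1 -> 0 <= t <= 1.
Proof. by case/andP=> a b; rewrite !ltW. Qed.
Let le00 : 0 <= (0 : R) <= 1. Proof. by rewrite lexx ler01. Qed.
Let le11 : 0 <= (1 : R) <= 1. Proof. by rewrite lexx ler01. Qed.

Lemma curve_inner e t v : 0 < t < 1 -> curve e t <> pos v.
Proof.
move=> t01 tv; have [[_ _ _ noV _] _] := drawing.
have [va|va] := eqVneq v (ea e).
  have t0 : t = 0 by apply: (curve_inj (e := e) (lt01_le t01) le00); rewrite tv va curve_first.
  by rewrite t0 ltxx in t01.
have [vb|vb] := eqVneq v (eb e).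
  have t1 : t = 1 by apply: (curve_inj (e := e) (lt01_le t01) le11); rewrite tv vb curve_last.
  by rewrite t1 ltxx andbF in t01.
by apply: (noV _ _ _ (edge e) va vb); rewrite -tv; apply/curve_trace/lt01_le.
Qed.

Let ends_neqP e e' : e != e' -> ends e != ends e'.
Proof. by rewrite (inj_eq ends_inj). Qed.

Lemma curve_end e v : v \in ends e -> exists2 t, 0 <= t <= 1 & curve e t = pos v.
Proof. by rewrite !inE => /orP[]/eqP->; [exists 0 | exists 1]. Qed.

Lemma curve_once e e' t t' u u' : e != e' -> 0 <= t <= 1 -> 0 <= t' <= 1 ->
  0 <= u <= 1 -> 0 <= u' <= 1 -> curve e t = curve e' t' -> curve e u = curve e' u' -> t = u.
Proof.
move=> ne ht ht' hu hu' tE uE; have [_ once] := drawing; apply: (curve_inj ht hu).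
apply: (once _ _ _ _ (edge e) (edge e') (ends_neqP ne)).
- exact: curve_trace.
- by rewrite tE; apply: curve_trace.
- exact: curve_trace.
by rewrite uE; apply: curve_trace.
Qed.

(** A common endpoint would be a second common point of the two edges. *)
Lemma curve_disj e e' t t' : e != e' -> 0 < t < 1 -> 0 <= t' <= 1 -> curve e t = curve e' t' ->
  [disjoint ends e & ends e'].
Proof.
move=> ne ht ht' tE; rewrite -setI_eq0; apply/negPn/negP => /set0Pn[v]; rewrite inE => /andP[ve ve'].
have [u hu uv] := curve_end ve; have [u' hu' uv'] := curve_end ve'.
have tu := curve_once ne (lt01_le ht) ht' hu hu' tE (etrans uv (esym uv')).
by apply: (curve_inner ht (e := e) (v := v)); rewrite tu.
Qed.

Lemma curve_cross e e' t t' : e != e' -> 0 < t < 1 -> 0 <= t' <= 1 -> curve e t = curve e' t' ->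
  edges_cross arc (ea e') (eb e') (ea e) (eb e).
Proof.
move=> ne ht ht' tE; have [[_ _ _ _ cross] _] := drawing.
have ne' : e' != e by rewrite eq_sym.
have [_ /(_ (curve e t))] := cross _ _ _ _ (edge e') (edge e) (ends_neqP ne').
have t1 : trace (arc (ea e') (eb e')) (curve e t) by rewrite tE; apply: curve_trace.
have t2 : trace (arc (ea e) (eb e)) (curve e t) by apply/curve_trace/lt01_le.
case=> // [[v _ /(curve_inner ht)]|c] //.
by exists (curve e t).
Qed.

Lemma curve_fan e e1 e2 t1 t2 u1 u2 : e1 != e -> e2 != e -> 0 < t1 < 1 -> 0 < t2 < 1 ->
  0 <= u1 <= 1 -> 0 <= u2 <= 1 -> curve e t1 = curve e1 u1 -> curve e t2 = curve e2 u2 ->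
  ~~ [disjoint ends e1 & ends e2].
Proof.
rewrite [e1 == e]eq_sym [e2 == e]eq_sym => n1 n2 h1 h2 g1 g2 E1 E2; rewrite -setI_eq0.
have [<-|ne] := eqVneq e1 e2.
  by rewrite finset.setIid; apply/set0Pn; exists (ea e1); rewrite !inE eqxx.
apply: (fans (edge e1) (edge e2) (edge e) (ends_neqP ne)).
  exact: curve_cross n1 h1 g1 E1.
exact: curve_cross n2 h2 g2 E2.
Qed.

Lemma drawing_plane_arcs : plane_arcs ea eb pos curve.
Proof.
have [[pos_inj _ _ _ _] _] := drawing; split=> //.
- exact: curve_inner.
- exact: curve_once.
- exact: curve_disj.
- move=> e e' e'' t t' t'' ne ht ht' ht'' tE tE'.
  have [->|n1] := eqVneq e'' e; first by left.
  have [->|n2] := eqVneq e'' e'; first by right.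
  rewrite eq_sym in ne; rewrite eq_sym in n2.
  (* Crossing [e] at this point, [e'] and [e''] share an endpoint by the fan condition; but they
     also meet in the point itself, which makes their ends disjoint. *)
  have := curve_fan ne n1 ht ht ht' ht'' tE tE'.
  have h : 0 < t' < 1.
    case/andP: ht' => a b; rewrite !lt_neqAle a b !andbT; apply/andP; split; apply/eqP => tE0.
      by apply: (curve_inner (e := e) (v := ea e') ht); rewrite tE -tE0 curve_first.
    by apply: (curve_inner (e := e) (v := eb e') ht); rewrite tE tE0 curve_last.
  by rewrite (curve_disj n2 h ht'') // -tE.
exact: curve_fan.
Qed.

End DrawingArcs.

(** * Removing vertices of small degree *)

Section Counting.
Variables (T : finType) (E : rel T).
Hypothesis simple : simple_graph E.
Implicit Type A : {set T}.

Definition edge_sets A := [set s : {set T} | [exists x, exists y, E x y && (s == [set x; y])] & s \subset A].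

(** The ranks orient each edge, so that it occurs as one pair only. *)
Definition is_edge A (p : T * T) :=
  [&& E p.1 p.2, p.1 \in A, p.2 \in A & (enum_rank p.1 < enum_rank p.2)%N].
Definition edge_in A := {p : T * T | is_edge A p}.
Definition lo A (e : edge_in A) : T := (val e).1.
Definition hi A (e : edge_in A) : T := (val e).2.
Arguments lo : clear implicits.
Arguments hi : clear implicits.
Local Notation endsA A := (ends (lo A) (hi A)).

Lemma edge_inP A (e : edge_in A) :
  [/\ E (lo A e) (hi A e), lo A e \in A, hi A e \in A & (enum_rank (lo A e) < enum_rank (hi A e))%N].
Proof. exact/and4P/(valP e). Qed.

Lemma lo_neq_hi A (e : edge_in A) : lo A e != hi A e.
Proof. by apply/eqP=> h; have [_ _ _] := edge_inP e; rewrite h ltnn. Qed.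

Lemma ends_edge_inj A : injective (endsA A).
Proof.
move=> e e' h; have [_ _ _ r] := edge_inP e; have [_ _ _ r'] := edge_inP e'.
apply: val_inj; rewrite [val e]surjective_pairing [val e']surjective_pairing -!/(lo A _) -!/(hi A _).
have l : lo A e \in endsA A e' by rewrite -h !inE eqxx.
have g : hi A e \in endsA A e' by rewrite -h !inE eqxx orbT.
have n := lo_neq_hi e; rewrite !inE in l g.
case/orP: l => /eqP l; case/orP: g => /eqP g; rewrite l g ?eqxx // in n r *.
by have := ltn_trans r r'; rewrite ltnn.
Qed.

Lemma edge_setsE A : edge_sets A = [set endsA A e | e in [set: edge_in A]%SET].
Proof.
apply/setP=> s; apply/idP/imsetP => [|[e _ ->]]; last first.
  have [h1 h2 h3 _] := edge_inP e; rewrite inE finset.subUset !finset.sub1set h2 h3 !andbT.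
  by apply/existsP; exists (lo A e); apply/existsP; exists (hi A e); rewrite h1 eqxx.
rewrite inE => /andP[/existsP[x /existsP[y /andP[xy /eqP->]]]]; rewrite finset.subUset !finset.sub1set => /andP[xA yA].
have [sym irr] := simple; case: (ltngtP (enum_rank x) (enum_rank y)) => h.
- have p : is_edge A (x, y) by rewrite /is_edge /= xy xA yA.
  by exists (exist (fun p => is_true (is_edge A p)) _ p).
- have p : is_edge A (y, x) by rewrite /is_edge /= sym xy xA yA.
  by exists (exist (fun p => is_true (is_edge A p)) _ p) => //; rewrite /ends /lo /hi /= finset.setUC.
by have := irr x; rewrite {2}(enum_rank_inj (val_inj h)) xy.
Qed.

Lemma card_edge_in A : #|{: edge_in A}| = #|edge_sets A|.
Proof. by rewrite edge_setsE card_imset ?cardsT //; apply: ends_edge_inj. Qed.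

Lemma degreeE A v : #|[set e | v \in endsA A e]| = #|[set s in edge_sets A | v \in s]|.
Proof.
rewrite -(card_imset _ (@ends_edge_inj A)); apply: eq_card => s; rewrite inE.
apply/imsetP/andP => [[e]|[]].
  by rewrite inE => ve ->; rewrite edge_setsE imset_f.
by rewrite edge_setsE => /imsetP[e _ ->] ve; exists e; rewrite // inE.
Qed.

Lemma edge_sets_remove A v : v \in A ->
  #|edge_sets A| = (#|edge_sets (A :\ v)| + #|[set s in edge_sets A | v \in s]|)%N.
Proof.
move=> vA; rewrite -(cardsID [set s : {set T} | v \in s] (edge_sets A)) addnC; congr addn.
  by apply: eq_card => s; rewrite !inE finset.subsetD1; case: (v \in s); rewrite ?andbF ?andbT.
by apply: eq_card => s; rewrite !inE.
Qed.

Lemma edge_sets_pairs A : (#|edge_sets A| <= 'C(#|A|, 2))%N.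
Proof.
rewrite -cards_draws; apply: subset_leq_card; apply/fintype.subsetP=> s; rewrite !inE => /andP[/existsP[x /existsP[y /andP[xy /eqP->]]] ->].
have [_ irr] := simple; rewrite cards2; have [xE|//] := eqVneq x y.
by rewrite xE irr in xy.
Qed.

(* A vertex of degree at most five can be removed, so only dense subgraphs need a bound. *)
Lemma peel c : (c <= 11)%N ->
  (forall A (e0 : edge_in A),
    (forall v, v \in touched (lo A) (hi A) -> (4 <= #|[set e | v \in endsA A e]|)%N) ->
    (4 * #|{: edge_in A}| + 4 * c <= 20 * #|touched (lo A) (hi A)|)%N) ->
  forall A, (3 <= #|A|)%N -> (#|edge_sets A| + c <= 5 * #|A|)%N.
Proof.
move=> c11 dense A; have [n] := ubnP #|A|; elim: n A => // n IH A nA A3.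
case: (boolP [exists v in A, #|[set s in edge_sets A | v \in s]| <= 5]%N) => [/exists_inP[v vA dv]|].
  have [A4|A4] := ltnP 3 #|A|; last first.
    (* Three vertices carry at most three edges, and 3 + 11 <= 15. *)
    have E3 : #|A| = 3%N by apply/eqP; rewrite eqn_leq A4.
    have := edge_sets_pairs A; rewrite E3 => h; have : 'C(3, 2) = 3%N by [].
    by move: h c11; clear; lia.
  have cA := cardsD1 v A; rewrite vA in cA.
  have := IH (A :\ v); rewrite (edge_sets_remove vA); move: cA nA A4 dv c11; clear; lia.
move/exists_inPn=> deg.
have deg4 v : v \in A -> (4 <= #|[set e | v \in endsA A e]|)%N.
  by move=> /deg; rewrite degreeE -ltnNge => /ltnW/ltnW.
have tA : touched (lo A) (hi A) \subset A.
  apply/fintype.subsetP => v; rewrite !inE => /existsP[e]; have [_ h1 h2 _] := edge_inP e.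
  by rewrite !inE => /orP[]/eqP->.
have [v vA] : exists v, v \in A by apply/card_gt0P; apply: leq_trans A3.
have [e0 _] : exists e0 : edge_in A, v \in endsA A e0.
  have /card_gt0P[e] : (0 < #|[set e | v \in endsA A e]|)%N by apply: leq_trans (deg4 v vA).
  by rewrite inE; exists e.
have := dense A e0 (fun v vt => deg4 v (fintype.subsetP tA v vt)).
rewrite card_edge_in; have := subset_leq_card tA; clear; lia.
Qed.

End Counting.

End Drawings.

(** * The two bounds *)

Module Bounds.
Import PolygonalBound PlanePathsBound Arcs Distances Creeping Circles Polygonization Drawings.
Import Order.TTheory GRing.Theory Num.Theory.
Local Open Scope ring_scope.

Section SimpleDrawing.
Variables (R : realType) (T : finType) (E : rel T) (pos : T -> pt R) (arc : T -> T -> R -> pt R).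
Hypothesis simple : simple_graph E.
Hypothesis T3 : (3 <= #|T|)%N.
Hypothesis drawing : simple_drawing E pos arc.
Hypothesis fans : crossing_condition E arc.
Implicit Type A : {set T}.

Lemma num_edges_sets : num_edges E = #|edge_sets E [set: T]%SET|.
Proof.
apply: eq_card => s; rewrite [RHS]inE finset.subsetT andbT.
(* [num_edges] counts a classical set, [edge_sets] is a finite one. *)
by apply/idP/idP => [/set_mem//|h]; apply/mem_set.
Qed.

Let edgeE A (e : edge_in E A) : E (lo e) (hi e). Proof. by case: (edge_inP e). Qed.

Lemma arcs_bound c : (c <= 11)%N ->
  (forall A (e0 : edge_in E A),
    (forall v, v \in touched (@lo _ E A) (@hi _ E A) ->
      (4 <= #|[set e | v \in ends (@lo _ E A) (@hi _ E A) e]|)%N) ->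
    (4 * #|{: edge_in E A}| + 4 * c <= 20 * #|touched (@lo _ E A) (@hi _ E A)|)%N) ->
  (num_edges E <= 5 * #|T| - c)%N.
Proof.
move=> c11 dense; have := peel simple c11 dense (A := [set: T]%SET).
by rewrite finset.cardsT num_edges_sets => /(_ T3); clear; lia.
Qed.

Lemma arc_spec x y : E x y ->
  [/\ jordan_arc (arc x y),
      arc x y 0 = pos x & arc x y 1 = pos y].
Proof. by have [[_ h _ _ _] _] := drawing => /h. Qed.

Theorem simple_bound : (num_edges E <= 5 * #|T| - 10)%N.
Proof.
apply: arcs_bound => // A e0 deg.
pose curve (e : edge_in E A) := arc (lo e) (hi e).
have pa : plane_arcs (@lo _ E A) (@hi _ E A) pos curve.
  apply: (drawing_plane_arcs drawing fans (@edgeE A)).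
  - exact: ends_edge_inj.
  - move=> e t t' t01 t'01; have [[_ inj] _ _] := arc_spec (edgeE e).
    by apply: inj; rewrite inE /I01 /= in_itv.
  - by move=> e; have [_ ? _] := arc_spec (edgeE e).
  - by move=> e; have [_ _ ?] := arc_spec (edgeE e).
  by move=> e t t01; exists t => //; rewrite /I01 /= in_itv.
have cont e : eps_continuous (curve e) 0 1.
  by have [[? _] _ _] := arc_spec (edgeE e); apply: continuous_eps.
have [L pp] := polygonal_drawing pa cont e0.
exact: (plane_paths_bound (@lo_neq_hi _ E A) (@ends_edge_inj _ E A) e0 deg pp).
Qed.

Theorem straight_bound : straight_line E pos arc -> (num_edges E <= 5 * #|T| - 11)%N.
Proof.
move=> straight; apply: arcs_bound => // A e0 deg.
(* The given arcs are replaced by linear parametrizations of the same segments. *)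
have pa : plane_arcs (@lo _ E A) (@hi _ E A) pos (linear_arc (@lo _ E A) (@hi _ E A) pos).
  apply: (drawing_plane_arcs drawing fans (@edgeE A)).
  - exact: ends_edge_inj.
  - move=> e t t' _ _; apply: mix_inj; have [[inj _ _ _ _] _] := drawing.
    by rewrite (inj_eq inj) lo_neq_hi.
  - by move=> e; apply: mix0.
  - by move=> e; apply: mix1.
  by move=> e t t01; rewrite straight; [exists t; rewrite // /I01 /= in_itv | apply: edgeE].
apply: (plane_paths_bound_straight (@lo_neq_hi _ E A) (@ends_edge_inj _ E A) e0 deg
  (straight_plane_paths pa)).
exact: straight_path_inseg.
Qed.

End SimpleDrawing.

End Bounds.

Theorem theorem1 (R : realType) (T : finType) (E : rel T) :
  simple_graph E -> 3 <= #|T| ->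
  ((exists (pos : T -> pt R) (arc : T -> T -> R -> pt R),
      simple_drawing E pos arc /\ crossing_condition E arc) ->
     num_edges E <= 5 * #|T| - 10) /\
  ((exists (pos : T -> pt R) (arc : T -> T -> R -> pt R),
      [/\ simple_drawing E pos arc, crossing_condition E arc
        & straight_line E pos arc]) ->
     num_edges E <= 5 * #|T| - 11).
Proof.
move=> simple T3; split; first by case=> pos [arc [d f]]; apply: Bounds.simple_bound T3 d f.
by case=> pos [arc [d f s]]; apply: Bounds.straight_bound T3 d f s.
Qed.
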